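(* Let $\pi<\beta\le2\pi$ and let $r:[0,\beta]\to(0,\infty)$ be a Lipschitz function such that $r'(\theta)\le0$ for $0\le\theta\le\beta/2$ and $r'(\theta)\ge0$ for $\beta/2\le\theta\le\beta$. Let $D_\beta=\{(\rho\cos\theta,\rho\sin\theta): 0<\theta<\beta,\ 0<\rho<r(\theta)\}$, whose boundary is $\Gamma_0\cup\Gamma$ with $\Gamma_0=\{(t,0):0\le t\le r(0)\}\cup\{t(\cos\beta,\sin\beta):0\le t\le r(\beta)\}$ and $\Gamma=\{(r(\theta)\cos\theta,r(\theta)\sin\theta):0\le\theta\le\beta\}$, and let $d(x)=\mathrm{dist}(x,\Gamma_0)$. Then for all $u\in C^\infty(\overline{D_\beta})$ that vanish in a neighbourhood of $\Gamma_0$, $$\int_{D_\beta}|\nabla u|^2\,dx\,dy\ge c_\beta\int_{D_\beta}\frac{u^2}{d^2}\,dx\,dy,$$ and the constant $c_\beta$ is the best possible for this inequality.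
   Context: For $\beta\in[\pi,2\pi]$, $\Lambda_\beta=\{(r\cos\theta,r\sin\theta): r>0,\ 0<\theta<\beta\}$ and $c_\beta$ denotes the Hardy constant of $\Lambda_\beta$, i.e. the largest $c\ge0$ with $\int_{\Lambda_\beta}|\nabla u|^2\ge c\int_{\Lambda_\beta}u^2/\mathrm{dist}(x,\partial\Lambda_\beta)^2$ for all $u\in C_c^\infty(\Lambda_\beta)$. It is known that $c_\beta\in(0,1/4]$; $c_\beta=1/4$ for $\pi\le\beta\le\beta_{cr}$, where $\beta_{cr}\in(\pi,2\pi)$ is the unique solution in $(\pi,2\pi)$ of $\tan\big(\frac{\beta_{cr}-\pi}{4}\big)=4\big(\Gamma(3/4)/\Gamma(1/4)\big)^2$; and for $\beta_{cr}\le\beta<2\pi$, $c_\beta$ is the unique solution of $\sqrt{c}\tan\big(\sqrt{c}\,\frac{\beta-\pi}{2}\big)=2\Big(\frac{\Gamma(\frac{3+\sqrt{1-4c}}{4})}{\Gamma(\frac{1+\sqrt{1-4c}}{4})}\Big)^2$. *)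

(* Defs.v *)
From HB Require Import structures.
From mathcomp Require Import all_boot all_order all_algebra.
From mathcomp Require Import all_classical all_reals all_analysis.
Set Implicit Arguments. Unset Strict Implicit. Unset Printing Implicit Defensive.
Import Order.TTheory GRing.Theory Num.Theory.
Import numFieldNormedType.Exports.
Local Open Scope classical_set_scope.
Local Open Scope ring_scope.

Section Defs.
Variable R : realType.

Definition leb2 := ((@lebesgue_measure R) \x (@lebesgue_measure R))%E.

(* Euclidean distance in the plane (the library norm on R*R is the max norm) *)
Definition edist (p q : R * R) : R :=
  Num.sqrt ((p.1 - q.1) ^+ 2 + (p.2 - q.2) ^+ 2).

Definition dist_set (p : R * R) (S : set (R * R)) : R :=
  inf [set edist p q | q in S].

Definition polar (rho theta : R) : R * R := (rho * cos theta, rho * sin theta).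

Definition dx (u : R * R -> R) : R * R -> R :=
  fun p => derive1 (fun t => u (t, p.2)) p.1.
Definition dy (u : R * R -> R) : R * R -> R :=
  fun p => derive1 (fun t => u (p.1, t)) p.2.

Fixpoint iter_partial (s : seq bool) (u : R * R -> R) : R * R -> R :=
  if s is b :: s' then (if b then dx else dy) (iter_partial s' u) else u.

Definition smooth2 (u : R * R -> R) : Prop :=
  forall s : seq bool, continuous (iter_partial s u) /\
    forall p : R * R, derivable (fun t => iter_partial s u (t, p.2)) p.1 1 /\
                      derivable (fun t => iter_partial s u (p.1, t)) p.2 1.

Definition grad_sq (u : R * R -> R) (p : R * R) : R :=
  dx u p ^+ 2 + dy u p ^+ 2.

Definition Lambda (beta : R) : set (R * R) :=
  [set p | exists rho theta, 0 < rho /\ 0 < theta < beta /\ p = polar rho theta].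

Definition bdry (A : set (R * R)) : set (R * R) := closure A `\` interior A.

Definition Cc_infty (Omega : set (R * R)) (u : R * R -> R) : Prop :=
  smooth2 u /\ exists K : set (R * R), compact K /\ K `<=` Omega /\
    (forall p, ~ K p -> u p = 0).

Definition hardy_ineq (Omega : set (R * R)) (c : R) : Prop :=
  forall u, Cc_infty Omega u ->
    (c%:E * \int[leb2]_(p in Omega) ((u p) ^+ 2 / (dist_set p (bdry Omega)) ^+ 2)%:E
     <= \int[leb2]_(p in Omega) (grad_sq u p)%:E)%E.

Definition hardy_const (Omega : set (R * R)) : R :=
  sup [set c | 0 <= c /\ hardy_ineq Omega c].

Definition c_beta (beta : R) : R := hardy_const (Lambda beta).

Definition Dom (beta : R) (r : R -> R) : set (R * R) :=
  [set p | exists rho theta,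
     0 < theta < beta /\ 0 < rho < r theta /\ p = polar rho theta].

Definition Gamma0 (beta : R) (r : R -> R) : set (R * R) :=
  [set (t, 0) | t in [set t | 0 <= t <= r 0]] `|`
  [set polar t beta | t in [set t | 0 <= t <= r beta]].

End Defs.

(* Main.v *)
(* Write [V(th)] for the inverse square of the distance from [polar 1 th] to the boundary of
   the sector. Since this distance is homogeneous, [dist^-2 = rho^-2 V(th)] in polar
   coordinates. Testing the Hardy inequality on [a(ln rho) w(th)], with [a] spread over many
   logarithmic scales, shows that a constant [c >= 0] is admissible for the sector iff
   [c * int V w^2 <= int w'^2] for all smooth [w] vanishing near [0] and [beta].

   On the circle of radius [rho], each half of [D] (about the bisector) is an initial arc
   [(0, a)], because [r] decreases away from the sides. A function [g] on [(0, a)] vanishing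
   near [0] is continued by the constant [g a] up to the bisector and then by reflection;
   as [V] is symmetric the angular inequality for the continuation gives
   [c * int_0^a V g^2 <= int_0^a g'^2]. Integrating over [rho] yields the inequality on
   [D], where moreover [d >= dist].

   If [c > c_beta], the angular inequality fails for some [w]; a test function
   [a(ln rho) w(th)] supported so close to the vertex that it lives in [D] and that [d]
   agrees there with the distance to the boundary of the sector violates the inequality
   on [D]. No formula for [c_beta] enters. *)

Require Import Defs.
From HB Require Import structures.
From mathcomp Require Import all_boot all_order all_algebra.
From mathcomp Require Import all_classical all_reals all_analysis.
From mathcomp Require Import measurable_realfun.
From mathcomp Require Import ring lra.
Import Order.TTheory GRing.Theory Num.Theory.
Import numFieldNormedType.Exports.
Local Open Scope classical_set_scope.
Local Open Scope ring_scope.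

(** * Smooth functions of one variable *)

(** On [D] the radial derivative is discarded, and this loses nothing: after the Jacobian both sides
    carry the measure [rho^-1 d rho], invariant under dilations, so a cutoff stretched over [n]
    logarithmic scales has energy of order [1 / n^2] relative to its mass. Freezing [g] beyond [a]
    adds no angular energy and can only enlarge the potential term, which [c >= 0] multiplies.

    Three obstacles shape the proof. The monotonicity of [r] is given only through the sign of [r']
    at almost every point of differentiability, so Lipschitz functions must be shown to be integrals
    of their derivative. Finally, [c_beta] is a supremum of reals: the set of admissible constants
    has to be bounded, and the inequality is transferred to [D] constant by constant before the
    supremum is taken. *)

Fixpoint Cn {R : realType} (n : nat) (f : R -> R) : Prop :=
  if n is m.+1 then
    exists f', (forall x, is_derive x (1 : R) f (f' x)) /\ Cn m f'
  else True.

(** [Cn 0] asks nothing, so a single [Cn n] says nothing about the continuity of the last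
    derivative; asking for every [n] does. Derivatives are witnesses, identified by
    [is_derive_unique_fun]. *)
Definition smooth1 {R : realType} (f : R -> R) := forall n, Cn n f.

Section smooth1.
Context {R : realType}.
Implicit Types f g : R -> R.

Lemma is_derive_unique_fun f f1 f2 :
  (forall x, is_derive x (1 : R) f (f1 x)) ->
  (forall x, is_derive x (1 : R) f (f2 x)) -> f1 = f2.
Proof.
move=> h1 h2; apply/funext => x.
by rewrite -(@derive_val _ _ _ _ _ _ _ (h1 x)) -(@derive_val _ _ _ _ _ _ _ (h2 x)).
Qed.

Lemma CnW n f : Cn n.+1 f -> Cn n f.
Proof.
elim: n f => [//|n IH] f [f' [h1 h2]]; exists f'; split => //; exact: IH.
Qed.

Lemma smooth1_derive f : smooth1 f ->
  exists2 f', (forall x, is_derive x (1 : R) f (f' x)) & smooth1 f'.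
Proof.
move=> sf; have [f' [h1 _]] := sf 1%N; exists f' => // n.
have [f2 [h2 h3]] := sf n.+1.
by rewrite (is_derive_unique_fun _ _ _ h1 h2).
Qed.

Lemma smooth1_continuous f : smooth1 f -> continuous f.
Proof.
move=> /smooth1_derive [f' h _] x.
by apply/differentiable_continuous/derivable1_diffP; case: (h x).
Qed.

Lemma Cn_cst n (c : R) : Cn n (fun=> c).
Proof.
elim: n c => [//|n IH] c; exists (fun=> 0); split => // x; exact: is_derive_cst.
Qed.

Lemma Cn_id n : Cn n (fun x : R => x).
Proof.
case: n => [//|n]; exists (fun=> 1); split => [x|]; first exact: is_derive_id.
exact: Cn_cst.
Qed.

Lemma CnD n f g : Cn n f -> Cn n g -> Cn n (fun x => f x + g x).
Proof.
elim: n f g => [//|n IH] f g [f' [f1 f2]] [g' [g1 g2]].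
exists (fun x => f' x + g' x); split => [x|]; last exact: IH.
by have := is_deriveD (f1 x) (g1 x).
Qed.

Lemma CnM n f g : Cn n f -> Cn n g -> Cn n (fun x => f x * g x).
Proof.
elim: n f g => [//|n IH] f g fn gn.
have [f' [f1 f2]] := fn; have [g' [g1 g2]] := gn.
exists (fun x => f x * g' x + g x * f' x); split => [x|].
  by have := is_deriveM (f1 x) (g1 x).
by apply: CnD; apply: IH => //; exact: CnW.
Qed.

Lemma CnN n f : Cn n f -> Cn n (fun x => - f x).
Proof.
move=> fn; have := CnM _ _ _ (Cn_cst n (-1)) fn.
by congr Cn; apply/funext => x; rewrite mulN1r.
Qed.

Lemma CnB n f g : Cn n f -> Cn n g -> Cn n (fun x => f x - g x).
Proof. by move=> fn gn; apply: CnD => //; exact: CnN. Qed.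

Lemma Cn_comp n f g : Cn n f -> Cn n g -> Cn n (fun x => f (g x)).
Proof.
elim: n f g => [//|n IH] f g fn gn.
have [f' [f1 f2]] := fn; have [g' [g1 g2]] := gn.
exists (fun x => f' (g x) * g' x); split => [x|].
  by have := @is_derive1_comp _ f g x _ _ (f1 (g x)) (g1 x).
apply: CnM => //; apply: IH => //; exact: CnW.
Qed.

Lemma CnV n f : (forall x, f x != 0) -> Cn n f -> Cn n (fun x => (f x)^-1).
Proof.
move=> f0; elim: n => [//|n IH] fn.
have [f' [f1 f2]] := fn.
exists (fun x => (- f' x) * ((f x)^-1 * (f x)^-1)); split => [x|].
  have h := @is_deriveV R f x (f' x) 1 (f0 x) (f1 x).
  apply: (is_derive_eq h).
  by rewrite -[LHS]/(_ * _) expr2 invfM !mulNr mulrC.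
have h := IH (CnW _ _ fn).
by apply: CnM; [exact: CnN|exact: CnM].
Qed.

Lemma Cn_expR n : Cn n (@expR R).
Proof. elim: n => [//|n IH]; exists expR; split => // x; exact: is_derive_expR. Qed.

Lemma Cn_sincos n : Cn n (@sin R) /\ Cn n (@cos R).
Proof.
elim: n => [//|n [IH1 IH2]]; split.
  exists cos; split => // x; exact: is_derive_sin.
exists (fun x => - sin x); split => [x|]; [exact: is_derive_cos|exact: CnN].
Qed.

Lemma Cn_sin n : Cn n (@sin R). Proof. by have [] := Cn_sincos n. Qed.
Lemma Cn_cos n : Cn n (@cos R). Proof. by have [] := Cn_sincos n. Qed.

(** The powers of [1 / x] make this family stable under differentiation up to linear combinations,
    so smoothness at 0 follows for all [k] in one induction. *)
Definition flat (k : nat) (x : R) : R :=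
  if 0 < x then (x^-1) ^+ k * expR (- x^-1) else 0.

Lemma flat_ge0 k x : 0 <= flat k x.
Proof.
rewrite /flat; case: ifP => // x0.
by rewrite mulr_ge0 ?expR_ge0// exprn_ge0// invr_ge0 ltW.
Qed.

Lemma flat_gt0 k x : 0 < x -> 0 < flat k x.
Proof. by move=> x0; rewrite /flat x0 mulr_gt0 ?expR_gt0// exprn_gt0// invr_gt0. Qed.

Lemma flat_le0 k x : x <= 0 -> flat k x = 0.
Proof. by move=> x0; rewrite /flat ltNge x0. Qed.

(* [exp y >= y^(k+1)/(k+1)!] at [y = 1/x]. *)
Lemma flat_le k x : 0 < x -> flat k x <= k.+1`!%:R * x.
Proof.
move=> x0; rewrite /flat x0 expRN.
have y0 : 0 < x^-1 by rewrite invr_gt0.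
have h := @expR_ge1Dxn _ (x^-1) k (ltW y0).
have h2 : (x^-1) ^+ k.+1 / k.+1`!%:R <= expR x^-1.
  by apply: le_trans h; rewrite lerDr.
rewrite ler_pdivrMr ?expR_gt0//.
rewrite ler_pdivrMr ?ltr0n ?fact_gt0// in h2.
apply: (@le_trans _ _ (x * (expR x^-1 * k.+1`!%:R))); last by rewrite mulrC -!mulrA [x * _]mulrC !mulrA [expR _ * _]mulrC.
rewrite -ler_pdivrMl// -exprS//.
Qed.

Lemma is_derive_flat k x :
  is_derive x (1 : R) (flat k) (flat k.+2 x - k%:R * flat k.+1 x).
Proof.
have [x0|x0|x0] := ltgtP x 0.
- rewrite !flat_le0 ?ltW// mulr0 subr0.
  apply: (near_eq_is_derive _ (@is_derive_cst R R R 0 x 1)).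
  near=> y; rewrite flat_le0// ltW//; near: y; exact: lt_nbhsl.
- have x0' : x != 0 by rewrite gt_eqF.
  have dV : is_derive x (1:R) (fun y : R => y^-1) (- x ^- 2).
    have := @is_deriveV R id x 1 1 x0' (is_derive_id _ _).
    by rewrite -[_ *: _]/(_ * _) mulr1.
  have dN : is_derive x (1:R) (fun y : R => - y^-1) (x ^- 2).
    by have := is_deriveN dV; rewrite opprK.
  have dE := @is_derive1_comp _ expR (fun y : R => - y^-1) x _ _ (is_derive_expR _) dN.
  have dX := @is_deriveX R R (fun y : R => y^-1) k x 1 _ dV.
  have eX : (fun y : R => y^-1) ^+ k = (fun y : R => (y^-1) ^+ k).
    by apply/funext => y; rewrite exprfctE.
  rewrite eX in dX.
  have h := is_deriveM dX dE.
  apply: (near_eq_is_derive _ (is_derive_eq h _)).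
    near=> y; rewrite /flat ifT//; near: y; exact: lt_nbhsr.
  rewrite -![_ *: _]/(_ * _) /=.
  rewrite /flat x0; case: k {dX eX h} => [|k] /=; first by field.
  rewrite !exprS; field.
  by [].
- rewrite x0 !flat_le0// mulr0 subr0.
  suff h : (h^-1 *: (flat k (h *: 1 + 0) - flat k 0)) @[h --> 0^'] --> (0 : R).
    by split; [apply/cvg_ex; exists 0|exact/cvg_lim].
  apply/cvgrPdist_le => /= e e0; near=> h.
  have hn0 : h != 0 by near: h; exact: nbhs_dnbhs_neq.
  rewrite sub0r normrN (flat_le0 k 0)// subr0 addr0 /GRing.scale /= mulr1.
  have [h0|h0] := leP h 0; first by rewrite flat_le0// mulr0 normr0 ltW.
  (* The difference quotient of [flat k] at 0 is [flat k.+1] itself, which [flat_le] bounds by a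
     multiple of [h]. *)
  have -> : h^-1 * flat k h = flat k.+1 h by rewrite /flat h0 mulrA -exprS.
  rewrite ger0_norm ?flat_ge0//; apply: le_trans (flat_le _ _ h0) _.
  rewrite -ler_pdivlMl ?ltr0n ?fact_gt0//.
  apply: le_trans (ler_norm h) _.
  near: h; apply: dnbhs0_le; rewrite mulr_gt0// invr_gt0 ltr0n fact_gt0//.
Unshelve. all: by end_near. Qed.

Lemma Cn_flat n k : Cn n (flat k).
Proof.
elim: n k => [//|n IH] k.
exists (fun x => flat k.+2 x - k%:R * flat k.+1 x); split => [x|].
  exact: is_derive_flat.
by apply: CnB => //; apply: CnM => //; exact: Cn_cst.
Qed.

Definition step (x : R) : R := flat 0 x / (flat 0 x + flat 0 (1 - x)).

Lemma step_den_gt0 x : 0 < flat 0 x + flat 0 (1 - x).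
Proof.
have [x0|x0] := ltP 0 x; first by rewrite ltr_pwDl ?flat_gt0 ?flat_ge0.
by rewrite ltr_wpDl ?flat_ge0// flat_gt0//; lra.
Qed.

Lemma smooth1_step : smooth1 step.
Proof.
move=> n; apply: CnM; first exact: Cn_flat.
apply: CnV => [x|]; first by rewrite gt_eqF// step_den_gt0.
apply: CnD; first exact: Cn_flat.
apply: (Cn_comp n (flat 0) (fun x => 1 - x)); first exact: Cn_flat.
by apply: CnB; [exact: Cn_cst|exact: Cn_id].
Qed.

Lemma step0 x : x <= 0 -> step x = 0.
Proof. by move=> x0; rewrite /step flat_le0// mul0r. Qed.

Lemma step1 x : 1 <= x -> step x = 1.
Proof.
move=> x1; rewrite /step (flat_le0 0 (1 - x)) ?subr_le0// addr0 divff//.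
by rewrite gt_eqF// flat_gt0//; lra.
Qed.

Lemma step_ge0 x : 0 <= step x.
Proof. by rewrite divr_ge0 ?flat_ge0// ltW// step_den_gt0. Qed.

Lemma step_le1 x : step x <= 1.
Proof. by rewrite ler_pdivrMr ?step_den_gt0// mul1r lerDl flat_ge0. Qed.

Lemma cutoff_bump : exists chi : R -> R, [/\ smooth1 chi,
  (forall x, 0 <= chi x <= 1), (forall x, `|x| <= 1 -> chi x = 1) &
  (forall x, 2 <= `|x| -> chi x = 0)].
Proof.
exists (fun x => step (x + 2) * step (2 - x)); split.
- move=> n; apply: CnM.
    apply: (Cn_comp n step (fun x => x + 2)); first exact: smooth1_step.
    by apply: CnD; [exact: Cn_id|exact: Cn_cst].
  apply: (Cn_comp n step (fun x => 2 - x)); first exact: smooth1_step.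
  by apply: CnB; [exact: Cn_cst|exact: Cn_id].
- by move=> x; rewrite mulr_ge0 ?step_ge0// mulr_ile1 ?step_ge0 ?step_le1.
- by move=> x; rewrite ler_norml => /andP[h1 h2]; rewrite !step1 ?mulr1//; lra.
- move=> x; rewrite ler_normr => /orP[h|h].
    by rewrite (step0 (2 - x)) ?mulr0//; lra.
  by rewrite step0 ?mul0r//; lra.
Qed.

(** Rescaled as [a + e * Phi ((th - a) / e)], this is the identity up to [a - e] and the constant
    [a] from [a] on: a smooth substitute for the minimum of [th] and [a]. *)
Lemma freezing_function : exists Phi : R -> R, [/\ smooth1 Phi,
  (forall s, s <= -1 -> Phi s = s) & (forall s, 0 <= s -> Phi s = 0)].
Proof.
exists (fun s => s * step (- s)); split.
- move=> n; apply: CnM; first exact: Cn_id.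
  apply: (Cn_comp n step (fun x => - x)); first exact: smooth1_step.
  by apply: CnN; exact: Cn_id.
- by move=> s s1; rewrite step1 ?mulr1//; lra.
- by move=> s s0; rewrite step0 ?mulr0//; lra.
Qed.

Lemma derive_eq0_on_open f f' (A : set R) x : open A -> A x ->
  (forall y, A y -> f y = 0) -> is_derive x (1 : R) f (f' x) -> f' x = 0.
Proof.
move=> oA Ax fA df.
have : is_derive x (1 : R) f 0.
  apply: (near_eq_is_derive _ (@is_derive_cst R R R 0 x 1)).
  near=> y; rewrite fA//; near: y; exact: open_nbhs_nbhs.
by move=> df0; rewrite -(@derive_val _ _ _ _ _ _ _ df) (@derive_val _ _ _ _ _ _ _ df0).
Unshelve. all: by end_near. Qed.

End smooth1.

(** * Integration in polar coordinates *)

Section plane_measurability.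
Context {R : realType}.

(** The plane carries the product sigma-algebra, so an open set is written as a countable union of
    rational boxes; indices that code no box inside [A] contribute the empty set. *)
Lemma open_measurable_prod (A : set (R * R)) : open A ->
  measurable (A : set (measurableTypeR R * measurableTypeR R)).
Proof.
move=> oA.
pose box (q : rat * rat * (rat * rat)) : set (R * R) :=
  `]ratr q.1.1, ratr q.1.2[ `*` `]ratr q.2.1, ratr q.2.2[.
pose B n := if unpickle n is Some q then
  (if `[< box q `<=` A >] then box q else set0) else set0.
have -> : A = \bigcup_n B n.
  apply/seteqP; split => [[x y] Axy|p [n _]]; last first.
    by rewrite /B; case: unpickle => // q; case: asboolP => // h /h.
  have /nbhs_ballP[e /= e0 sub] : nbhs (x, y) A by exact: open_nbhs_nbhs.
  have rat_below (z : R) : exists q : rat, z - e < ratr q < z.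
    have /rat_in_itvoo [q] : z - e < z by lra.
    by rewrite in_itv/= => h; exists q.
  have rat_above (z : R) : exists q : rat, z < ratr q < z + e.
    have /rat_in_itvoo [q] : z < z + e by lra.
    by rewrite in_itv/= => h; exists q.
  have [a /andP[a1 a2]] := rat_below x; have [b /andP[b1 b2]] := rat_above x.
  have [c /andP[c1 c2]] := rat_below y; have [d /andP[d1 d2]] := rat_above y.
  exists (pickle (a, b, (c, d))); first exact: I.
  rewrite /B pickleK.
  rewrite asboolT.
    by split; rewrite /= in_itv/=; apply/andP; split.
  move=> [u v] [/= ]; rewrite !in_itv/= => /andP[h1 h2] /andP[h3 h4].
  apply: sub; split; rewrite /ball/= ltr_norml; lra.
apply: bigcupT_measurable => n; rewrite /B; case: unpickle => // q.
by case: asboolP => // _; apply: measurableX; exact: measurable_itv.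
Qed.

Lemma continuous_measurable_prod (f : R * R -> R) : continuous f ->
  measurable_fun [set: measurableTypeR R * measurableTypeR R] f.
Proof.
move=> /continuousP cf; apply: (measurability _ (RGenOpens.measurableE R)).
move=> _ [_ [a [b ->] <-]]; rewrite setTI; apply: open_measurable_prod.
exact/cf/interval_open.
Qed.

End plane_measurability.

(** * Image measures with a density *)

Section weighted_image.
Context d d' (T : measurableType d) (T' : measurableType d') (R : realType).
Variables (mu : {measure set T -> \bar R}) (g : T -> R) (phi : T -> T').
Local Open Scope ereal_scope.

(** The image under [phi] of the measure with density [g]. The proofs are arguments so that the
    measure structure below can be attached to the function. *)
Definition weighted_image of measurable_fun setT g & (forall x, 0 <= g x)%R &
  measurable_fun setT phi := fun A : set T' => \int[mu]_(t in phi @^-1` A) (g t)%:E.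

Hypotheses (mg : measurable_fun setT g) (g0 : forall x, (0 <= g x)%R)
  (mphi : measurable_fun setT phi).
Local Notation nu := (weighted_image mg g0 mphi).

Let nu0 : nu set0 = 0.
Proof. by rewrite /weighted_image preimage_set0 integral_set0. Qed.

Let nu_ge0 A : 0 <= nu A.
Proof. by apply: integral_ge0 => x _; rewrite lee_fin. Qed.

Let meg : measurable_fun setT (EFin \o g).
Proof. exact/measurable_EFinP. Qed.

Let eg0 x : 0 <= (EFin \o g) x.
Proof. by rewrite lee_fin. Qed.

Let nu_sigma_additive : semi_sigma_additive nu.
Proof.
move=> F mF tF mUF; rewrite /weighted_image preimage_bigcup.
apply: (@semi_sigma_additive_nng_induced _ _ _ mu _ meg eg0 (fun n => phi @^-1` F n)).
- by move=> n; rewrite -[X in measurable X]setTI; exact: mphi.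
- by apply/trivIsetP => i j _ _ ij; rewrite -preimage_setI;
    move/trivIsetP : tF => /(_ _ _ _ _ ij) ->//; rewrite preimage_set0.
- by rewrite -preimage_bigcup -[X in measurable X]setTI; exact: mphi.
Qed.

HB.instance Definition _ := isMeasure.Build _ _ _ nu nu0 nu_ge0 nu_sigma_additive.

Import HBNNSimple.

(** Monotone convergence along simple approximations of [f] reduces the formula to indicators, where
    it is the definition of the image measure. *)
Lemma ge0_integral_weighted_image (f : T' -> \bar R) : measurable_fun setT f ->
  (forall x, 0 <= f x) -> \int[nu]_x f x = \int[mu]_x (f (phi x) * (g x)%:E).
Proof.
move=> mf f0; pose f_ := nnsfun_approx measurableT mf.
have mf_ n : measurable_fun setT (fun x => (f_ n (phi x))%:E).
  by apply/measurable_EFinP; exact: measurableT_comp.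
transitivity (limn (fun n => \int[nu]_x (f_ n x)%:E)).
  rewrite -monotone_convergence//.
  - by apply: eq_integral => x _; apply/esym/cvg_lim => //; exact: cvg_nnsfun_approx.
  - by move=> n; exact/measurable_EFinP.
  - by move=> *; rewrite lee_fin.
  - by move=> x _ m n mn; rewrite lee_fin; exact/lefP/nd_nnsfun_approx.
transitivity (limn (fun n => \int[mu]_x ((f_ n (phi x))%:E * (g x)%:E))); last first.
  rewrite -monotone_convergence//.
  - apply: eq_integral => x _; apply/cvg_lim => //.
    by apply: cvgeZr => //; exact: (@cvg_nnsfun_approx _ _ _ _ _ _ mf).
  - by move=> n; apply: emeasurable_funM.
  - by move=> n x _; rewrite mule_ge0// lee_fin.
  - move=> x _ m n mn; apply: lee_wpmul2r; first by rewrite lee_fin.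
    by rewrite lee_fin; exact/lefP/nd_nnsfun_approx.
congr (limn _); apply/funext => n.
under [LHS]eq_integral do rewrite fimfunE// -fsumEFin//.
rewrite [LHS]ge0_integral_fsum//; last 2 first.
- by move=> r; exact/measurable_EFinP/measurableT_comp.
- by move=> r x _; rewrite nnfun_muleindic_ge0.
under [RHS]eq_integral.
  move=> x xD; rewrite fimfunE -fsumEFin// ge0_mule_fsuml; last first.
    by move=> r; rewrite EFinM nnfun_muleindic_ge0.
  over.
have mi r : measurable_fun setT (fun x => (\1_(f_ n @^-1` [set r]) (phi x))%:E : \bar R).
  by apply/measurable_EFinP; apply: measurableT_comp => //; exact: measurable_indic.
rewrite [RHS]ge0_integral_fsum//; last 2 first.
- move=> r; apply: emeasurable_funM => //; under eq_fun do rewrite EFinM.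
  exact: emeasurable_funM.
- move=> r x _; apply: mule_ge0; last by rewrite lee_fin.
  by rewrite EFinM nnfun_muleindic_ge0.
apply: eq_fsbigr => r _.
rewrite integralZl_indic_nnsfun//= integral_indic//= setIT /weighted_image.
have [r0|r0] := leP 0%R r; last first.
  rewrite preimage_nnfun0// preimage_set0 integral_set0 mule0.
  apply/esym/integral0_eq => x _.
  by rewrite indic0 mulr0 mul0e.
under [RHS]eq_integral do rewrite EFinM -muleA.
rewrite ge0_integralZl//; last 2 first.
- exact: emeasurable_funM.
- by move=> x _; rewrite mule_ge0// lee_fin.
congr (_ * _); rewrite [LHS]integral_mkcond; apply: eq_integral => x _.
rewrite patchE indicE; have -> : (x \in phi @^-1` (f_ n @^-1` [set r])) = (phi x \in f_ n @^-1` [set r]).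
  by apply/idP/idP; rewrite !inE.
by case: ifPn => _; rewrite ?mul1e ?mul0e.
Qed.

End weighted_image.
Arguments weighted_image {d d' T T' R}.

(** * Substitutions on the line, Tonelli, polar coordinates *)

Section substitutions.
Context {R : realType}.
Local Open Scope ereal_scope.
Local Notation mu := (@lebesgue_measure R).

(** Affine and tangent substitutions follow one scheme: the weighted image measure gives every
    half-open interval its length, so by uniqueness it is Lebesgue measure. *)
Lemma ge0_integral_affine (k b : R) (f : R -> \bar R) : (k != 0)%R ->
  measurable_fun setT f -> (forall x, 0 <= f x) ->
  \int[mu]_x f x = `|k|%:E * \int[mu]_x f (k * x + b)%R.
Proof.
move=> k0 mf f0.
have mphi : measurable_fun [set: measurableTypeR R]
    ((fun x => k * x + b)%R : measurableTypeR R -> measurableTypeR R).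
  by apply: measurable_funD => //; apply: measurable_funM.
have mg : measurable_fun [set: measurableTypeR R] (cst `|k|%R : _ -> R) by [].
have g0 (x : measurableTypeR R) : (0 <= (cst `|k|%R : _ -> R) x)%R by [].
transitivity (\int[weighted_image mu _ _ mg g0 mphi]_x f x); last first.
  rewrite ge0_integral_weighted_image//= ge0_integralZr//=; last first.
    exact: measurableT_comp.
  by rewrite muleC.
apply: eq_measure_integral => A mA _; apply: lebesgue_measure_unique => //.
move=> _ [[a c] _ <-] /=; rewrite /weighted_image /= integral_cst//; last first.
  by rewrite -[X in measurable X]setTI; apply: mphi.
have [kn|kp|k00] := ltgtP k 0%R; last by rewrite k00 eqxx in k0.
- have -> : (fun x : R => k * x + b)%R @^-1` `]a, c] = `[((c - b) / k)%R, ((a - b) / k)%R[%classic.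
    apply/seteqP; split => x /=; rewrite !in_itv/= ltr_ndivlMr// ler_ndivrMr// => /andP[h1 h2];
      apply/andP; split; lra.
  rewrite lebesgue_measure_itv/= [X in _ = _ * X]lebesgue_measure_itv/= !lte_fin.
  rewrite ltr_nM2r ?invr_lt0// ltrBlDr subrK.
  case: ifPn => _; last by rewrite mule0.
  rewrite ltr0_norm// -!EFinD -EFinM; congr EFin; field; by rewrite lt_eqF.
- have -> : (fun x : R => k * x + b)%R @^-1` `]a, c] = `]((a - b) / k)%R, ((c - b) / k)%R]%classic.
    apply/seteqP; split => x /=; rewrite !in_itv/= ltr_pdivrMr// ler_pdivlMr// => /andP[h1 h2];
      apply/andP; split; lra.
  rewrite lebesgue_measure_itv/= [X in _ = _ * X]lebesgue_measure_itv/= !lte_fin.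
  rewrite ltr_pM2r ?invr_gt0// ltrBlDr subrK.
  case: ifPn => _; last by rewrite mule0.
  rewrite gtr0_norm// -!EFinD -EFinM; congr EFin; field; by rewrite gt_eqF.
Qed.

Lemma ge0_integral_affine_set (k b : R) (D : set R) (f : R -> \bar R) : (k != 0)%R ->
  measurable D -> measurable_fun setT f -> (forall x, 0 <= f x) ->
  \int[mu]_(x in D) f x =
  `|k|%:E * \int[mu]_(x in [set x | D (k * x + b)%R]) f (k * x + b)%R.
Proof.
move=> k0 mD mf f0; rewrite integral_mkcond (ge0_integral_affine _ b _ k0); last 2 first.
  by apply/(measurable_restrictT _ _).1 => //; exact: measurable_funS mf.
  by move=> x; rewrite patchE; case: ifP.
congr (_ * _); rewrite [RHS]integral_mkcond; apply: eq_integral => x _.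
rewrite !patchE; have -> : (x \in [set x | D (k * x + b)%R]) = ((k * x + b)%R \in D).
  by apply/idP/idP; rewrite !inE.
by [].
Qed.

Definition tan_dom : set R := `](- (pi / 2))%R, (pi / 2)%R[.
(** A total measurable function; the value chosen off [tan_dom] never counts, since the density
    [tan_der] vanishes there. *)
Definition tan_ext (t : R) : R := if t \in tan_dom then tan t else 0%R.
Definition tan_der (t : R) : R := if t \in tan_dom then ((cos t)^-2)%R else 0%R.

Lemma tan_domP (t : R) : (t \in tan_dom) = ((- (pi / 2) < t < pi / 2)%R).
Proof. by rewrite /tan_dom; apply/idP/idP; rewrite inE /= in_itv. Qed.

Lemma cos_tan_dom (t : R) : (- (pi / 2) < t < pi / 2)%R -> (0 < cos t)%R.
Proof. exact: cos_gt0_pihalf. Qed.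

Lemma open_tan_dom : open tan_dom.
Proof. exact: interval_open. Qed.

Lemma measurable_tan_dom (f : R -> R) :
  (forall t, (0 < cos t)%R -> {for t, continuous f}) -> measurable_fun tan_dom f.
Proof.
move=> cf; apply: (open_continuous_measurable_fun open_tan_dom).
by move=> t; rewrite tan_domP => /cos_tan_dom; exact: cf.
Qed.

Lemma continuous_cosV2 (t : R) : (0 < cos t)%R ->
  {for t, continuous (fun t => (cos t) ^-2)%R}.
Proof.
move=> c0; apply: (@cvgV _ _ _ _ (fun t => (cos t)^+2)%R); first by rewrite expf_eq0/= gt_eqF.
by apply: cvgM; exact: continuous_cos.
Qed.

Lemma measurable_tan_ext : measurable_fun setT tan_ext.
Proof.
have -> : tan_ext = tan \_ tan_dom by apply/funext => t; rewrite /tan_ext patchE.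
apply/(measurable_restrictT _ _).1 => //.
  exact: open_measurable open_tan_dom.
by apply: measurable_tan_dom => t c0; apply: continuous_tan; rewrite gt_eqF.
Qed.

Lemma measurable_tan_der : measurable_fun setT tan_der.
Proof.
have -> : tan_der = (fun t => (cos t) ^-2)%R \_ tan_dom by apply/funext => t; rewrite /tan_der patchE.
apply/(measurable_restrictT _ _).1 => //.
  exact: open_measurable open_tan_dom.
by apply: measurable_tan_dom => t c0; exact: continuous_cosV2.
Qed.

Lemma tan_der_ge0 t : (0 <= tan_der t)%R.
Proof. by rewrite /tan_der; case: ifP => // _; rewrite invr_ge0 sqr_ge0. Qed.

Lemma ge0_integral_tan (f : R -> \bar R) :
  measurable_fun setT f -> (forall x, 0 <= f x) ->
  \int[mu]_x f x = \int[mu]_t (f (tan_ext t) * (tan_der t)%:E).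
Proof.
move=> mf f0.
have mg : measurable_fun [set: measurableTypeR R] tan_der := measurable_tan_der.
have g0 := tan_der_ge0.
have mphi : measurable_fun [set: measurableTypeR R]
    (tan_ext : measurableTypeR R -> measurableTypeR R) := measurable_tan_ext.
transitivity (\int[weighted_image mu _ _ mg g0 mphi]_x f x); last first.
  exact: ge0_integral_weighted_image.
apply: eq_measure_integral => A mA _; apply: lebesgue_measure_unique => //.
move=> _ [[a c] _ <-] /=; rewrite /weighted_image.
have [ca|ac] := leP c a.
  rewrite set_itv_ge ?bnd_simp -?leNgt//.
  by rewrite preimage_set0 integral_set0 measure0.
have atac : (atan a < atan c)%R by exact: lt_atan.
rewrite lebesgue_measure_itv/= lte_fin ac.
(* Within [tan_dom] the preimage of []a, c]] is []atan a, atan c]]. The left end point is added for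
   the fundamental theorem of calculus. *)
transitivity (\int[mu]_(t in `[atan a, atan c]) ((cos t)^-2)%:E); last first.
  rewrite -integral_itv_obnd_cbnd; last first.
    apply/measurable_EFinP.
    apply: (@measurable_funS _ _ _ _ tan_dom); first exact: open_measurable open_tan_dom.
      move=> t /=; rewrite !in_itv/= => /andP[h1 h2]; apply/andP; split.
        by apply: lt_trans h1; exact: atan_gtNpi2.
      by apply: le_lt_trans h2 _; exact: atan_ltpi2.
    by apply: measurable_tan_dom => t c0; exact: continuous_cosV2.
  rewrite [LHS]integral_mkcond [RHS]integral_mkcond.
  apply: eq_integral => t _; rewrite !patchE /= /tan_der /tan_ext.
  case: (boolP (t \in tan_dom)) => ht.
    have ht' := ht; rewrite tan_domP in ht'.
    have tK : atan (tan t) = t by apply: tanK; rewrite in_itv.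
    congr (if _ then _ else _); apply/idP/idP; rewrite !inE /= !in_itv/= ht => /andP[h1 h2].
      apply/andP; split.
        by rewrite -(atanK a) ltr_tan ?in_itv//= atan_gtNpi2 atan_ltpi2.
      rewrite -(atanK c) leNgt ltr_tan ?in_itv//= ?atan_gtNpi2 ?atan_ltpi2//.
      by rewrite -leNgt.
    apply/andP; split; rewrite -tK; first exact: lt_atan.
    exact: le_atan.
  rewrite [in LHS]ifF; first by case: ifP.
  apply/negbTE; apply: contra ht; rewrite tan_domP !inE/= in_itv/= => /andP[h1 h2].
  apply/andP; split; first by apply: lt_trans h1; exact: atan_gtNpi2.
  by apply: le_lt_trans h2 _; exact: atan_ltpi2.
have cosP t : (atan a <= t <= atan c)%R -> (0 < cos t)%R.
  move=> /andP[h1 h2]; apply: cos_tan_dom; apply/andP; split.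
    by apply: lt_le_trans h1; exact: atan_gtNpi2.
  by apply: le_lt_trans h2 _; exact: atan_ltpi2.
rewrite (@continuous_FTC2 _ _ tan)//.
- by rewrite !atanK.
- apply: continuous_in_subspaceT => t; rewrite inE/= in_itv/= => /cosP.
  exact: continuous_cosV2.
- split.
  + move=> t; rewrite in_itv/= => /andP[h1 h2]; apply: derivable_tan.
    by rewrite gt_eqF// cosP// !ltW.
  + apply: cvg_at_right_filter; apply: continuous_tan.
    by rewrite gt_eqF// cosP// lexx ltW.
  + apply: cvg_at_left_filter; apply: continuous_tan.
    by rewrite gt_eqF// cosP// lexx ltW.
- move=> t; rewrite in_itv/= => /andP[h1 h2]; rewrite derive1E.
  have c0 : (cos t != 0)%R by rewrite gt_eqF// cosP// !ltW.
  by rewrite (@derive_val _ _ _ _ _ _ _ (is_derive_tan c0)).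
Qed.

(** Used to avoid the line [y = 0], on which the substitution [x = y * tan t] degenerates. *)
Lemma ge0_integral_punctured (f : R -> \bar R) :
  measurable_fun setT f -> \int[mu]_x f x = \int[mu]_(x in [set~ 0%R]) f x.
Proof.
move=> mf; rewrite -(setTD [set 0%R]) integral_setD1//.
  exact: measurableD.
exact: measurable_funS mf.
Qed.

Section tonelli_plane.
Variable F : R * R -> \bar R.
Hypotheses (mF : measurable_fun [set: measurableTypeR R * measurableTypeR R] F)
  (F0 : forall p, 0 <= F p).

Lemma leb2_tonelli : \int[@leb2 R]_p F p = \int[mu]_y \int[mu]_x F (x, y).
Proof. exact: (@fubini_tonelli2 _ _ _ _ _ mu mu F). Qed.

Lemma tonelli_swap : \int[mu]_x \int[mu]_y F (x, y) = \int[mu]_y \int[mu]_x F (x, y).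
Proof. exact: (@fubini_tonelli _ _ _ _ _ mu mu F). Qed.

Lemma measurable_tonelli_fst : measurable_fun setT (fun x => \int[mu]_y F (x, y)).
Proof. exact: (@measurable_fun_fubini_tonelli_F _ _ _ _ _ mu F). Qed.

Lemma measurable_tonelli_snd : measurable_fun setT (fun y => \int[mu]_x F (x, y)).
Proof. exact: (@measurable_fun_fubini_tonelli_G _ _ _ _ _ mu F). Qed.

Lemma measurable_row y : measurable_fun setT (fun x => F (x, y)).
Proof. by apply: (measurableT_comp mF); exact: measurable_fun_pair. Qed.

End tonelli_plane.

(* [x = y * tan t] on each horizontal line, then [y = s * cos t] on each ray:
   lines through the origin at signed distance [s]. *)
Lemma ge0_integral_lines (F : R * R -> \bar R) :
  measurable_fun [set: measurableTypeR R * measurableTypeR R] F ->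
  (forall p, 0 <= F p) ->
  \int[@leb2 R]_p F p =
  \int[mu]_(t in tan_dom) \int[mu]_s (F (s * sin t, s * cos t)%R * `|s|%:E).
Proof.
move=> mF F0; rewrite (leb2_tonelli F)//.
pose H := fun p : R * R => F (p.1 * tan_ext p.2, p.1)%R * (`|p.1| * tan_der p.2)%:E.
have mH : measurable_fun [set: measurableTypeR R * measurableTypeR R] H.
  apply: emeasurable_funM.
    apply: (measurableT_comp mF); apply/measurable_fun_pairP; split => /=.
      apply: measurable_funM => //; exact: (measurableT_comp measurable_tan_ext).
    exact: measurable_fst.
  apply/measurable_EFinP; apply: measurable_funM => //.
    exact: measurableT_comp.
  exact: (measurableT_comp measurable_tan_der).
have H0 p : 0 <= H p by rewrite mule_ge0// lee_fin mulr_ge0// tan_der_ge0.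
have mFy := measurable_row F mF.
have mG := measurable_tonelli_snd F mF F0.
rewrite ge0_integral_punctured//.
transitivity (\int[mu]_(y in [set~ 0%R]) \int[mu]_t H (y, t)).
  apply: eq_integral => y; rewrite inE/= => /eqP y0.
  rewrite (ge0_integral_affine _ 0 _ y0)//.
  have mc : measurable_fun setT (fun x : R => F (y * x + 0, y)%R).
    apply: (measurableT_comp (mFy y) (f := fun x => F (x, y)) (g := fun x => y * x + 0)%R).
    by apply: measurable_funD => //; apply: measurable_funM.
  rewrite -ge0_integralZl ?lee_fin// ge0_integral_tan; last 2 first.
    exact: emeasurable_funM.
    by move=> x; rewrite mule_ge0.
  by apply: eq_integral => t _; rewrite /H/= addr0 EFinM [`|y|%:E * _]muleC muleA.
have mHF := measurable_tonelli_fst H mH H0.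
transitivity (\int[mu]_y \int[mu]_t H (y, t)).
  exact/esym/(ge0_integral_punctured _ mHF).
transitivity (\int[mu]_t \int[mu]_y H (y, t)); first exact: (tonelli_swap H mH H0).
rewrite [RHS]integral_mkcond; apply: eq_integral => t _.
rewrite patchE; case: ifPn => tD; last first.
  by apply: integral0_eq => s _; rewrite /H /= /tan_der (negbTE tD) mulr0 mule0.
have c0 : (0 < cos t)%R by apply: cos_tan_dom; rewrite -tan_domP.
have mHt := measurable_row H mH t.
rewrite (ge0_integral_affine (cos t) 0)//; last by rewrite gt_eqF.
have mc : measurable_fun setT (fun s : R => H (cos t * s + 0, t)%R).
  apply: (measurableT_comp mHt (f := fun y => H (y, t)) (g := fun s => cos t * s + 0)%R).
  by apply: measurable_funD => //; apply: measurable_funM.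
rewrite -ge0_integralZl ?lee_fin//.
apply: eq_integral => s _; rewrite /H/= /tan_ext /tan_der tD addr0.
rewrite muleCA -EFinM /tan gtr0_norm//; congr (F (_, _) * _%:E).
- by field; rewrite gt_eqF.
- by rewrite mulrC.
- by rewrite normrM gtr0_norm//; field; rewrite gt_eqF.
Qed.

Lemma measurable_polar : measurable_fun [set: measurableTypeR R * measurableTypeR R]
  (fun p : measurableTypeR R * measurableTypeR R => polar p.1 p.2 : measurableTypeR R * measurableTypeR R).
Proof.
by apply/measurable_fun_pairP; split => /=; apply: continuous_measurable_prod => p;
  apply: cvgM; [exact: cvg_fst| |exact: cvg_fst| ];
  apply: (@cvg_comp _ _ _ snd _ _ (nbhs p.2)); (exact: cvg_snd || exact: continuous_cos || exact: continuous_sin).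
Qed.

(** The line of parameter [t] in [ge0_integral_lines] consists of two opposite rays, at the angles
    [th = pi / 2 - t] and [th + pi]; as [th] runs through [(0, pi)] these rays fill [(0, 2 pi)] up
    to one angle. *)
Lemma integral_polar (F : R * R -> \bar R) :
  measurable_fun [set: measurableTypeR R * measurableTypeR R] F ->
  (forall p, 0 <= F p) ->
  \int[@leb2 R]_p F p =
  \int[mu]_(rho in `]0%R, +oo[) \int[mu]_(th in `]0%R, (2 * pi)%R[)
    (F (polar rho th) * rho%:E).
Proof.
move=> mF F0.
(* The Jacobian [p.1] changes sign; the indicator of the positive radii makes [K] nonnegative, as
   Tonelli requires. *)
pose K := fun p : R * R => (F (polar p.1 p.2) * p.1%:E) *
  (\1_(`]0%R, +oo[) p.1)%:E.
have mi0 : measurable_fun setT (\1_(`]0%R, +oo[) : R -> R) by exact: measurable_indic.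
have mi1 : measurable_fun setT (\1_(`]0%R, (2 * pi)%R[) : R -> R) by exact: measurable_indic.
have mK : measurable_fun [set: measurableTypeR R * measurableTypeR R] K.
  apply: emeasurable_funM; first apply: emeasurable_funM.
  - exact: (measurableT_comp mF measurable_polar).
  - exact/measurable_EFinP.
  - apply/measurable_EFinP; apply: (measurableT_comp mi0); exact: measurable_fst.
have K0 p : 0 <= K p.
  rewrite /K indicE; case: (boolP (p.1 \in _)); rewrite ?mule0// inE/= in_itv/= andbT => h.
  by rewrite mule1 mule_ge0// lee_fin ltW.
pose k th := \int[mu]_rho K (rho, th).
have kE th : k th = \int[mu]_(rho in `]0%R, +oo[) (F (polar rho th) * rho%:E).
  rewrite [RHS]integral_mkcond; apply: eq_integral => rho _.
  by rewrite patchE /K/= indicE; case: ifP => _; rewrite ?mule1 ?mule0.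
have mk : measurable_fun setT k by exact: (measurable_tonelli_snd K mK).
have k0 th : 0 <= k th by exact: integral_ge0.
transitivity (\int[mu]_(th in `]0%R, (2 * pi)%R[) k th); last first.
  transitivity (\int[mu]_th \int[mu]_rho (K (rho, th) * (\1_(`]0%R, (2 * pi)%R[) th)%:E)).
    rewrite integral_mkcond; apply: eq_integral => th _.
    rewrite patchE indicE; case: ifP => _.
      by apply: eq_integral => rho _; rewrite mule1.
    by apply/esym/integral0_eq => rho _; rewrite mule0.
  rewrite -(@tonelli_swap (fun p : R * R => K p * (\1_(`]0%R, (2 * pi)%R[) p.2)%:E)) /=; last 2 first.
  - apply: emeasurable_funM => //; apply/measurable_EFinP.
    by apply: (measurableT_comp mi1); exact: measurable_snd.
  - by move=> p; rewrite mule_ge0// lee_fin.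
  rewrite [RHS]integral_mkcond; apply: eq_integral => rho _.
  rewrite patchE; case: ifPn => hr; last first.
    by apply: integral0_eq => th _; rewrite /K/= indicE (negbTE hr) mule0 mul0e.
  rewrite [RHS]integral_mkcond; apply: eq_integral => th _.
  by rewrite patchE /K/= !indicE hr mule1; case: ifP => _; rewrite ?mule1 ?mule0.
rewrite (ge0_integral_lines F mF F0).
pose h t := \int[mu]_s (F (s * sin t, s * cos t)%R * `|s|%:E).
have mFs t : measurable_fun setT (fun s : R => F (s * sin t, s * cos t)%R * `|s|%:E).
  apply: emeasurable_funM => //; last exact/measurable_EFinP.
  apply: (measurableT_comp mF); apply/measurable_fun_pairP; split => /=; exact: measurable_funM.
have hE th : h (pi / 2 - th)%R = k th + k (th + pi)%R.
  pose G s := F (s * cos th, s * sin th)%R * `|s|%:E.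
  have mG : measurable_fun setT G.
    apply: emeasurable_funM => //; last exact/measurable_EFinP.
    apply: (measurableT_comp mF); apply/measurable_fun_pairP; split => /=; exact: measurable_funM.
  have G0 s : 0 <= G s by rewrite mule_ge0// lee_fin.
  have -> : h (pi / 2 - th)%R = \int[mu]_s G s.
    by rewrite /h sinB cosB cos_pihalf sin_pihalf !mul0r !mul1r subr0 add0r.
  rewrite (_ : setT = `]-oo, 0%R] `|` `]0%R, +oo[)%classic; last first.
    by rewrite -setCitvl setUv.
  rewrite ge0_integral_setU//; last 2 first.
    by apply: measurable_funS mG.
    by rewrite -setCitvl disj_set2E setICr.
  rewrite addeC !kE; congr (_ + _).
    apply: eq_integral => s; rewrite inE/= in_itv/= andbT => s0.
    by rewrite /G gtr0_norm.
  rewrite [LHS](ge0_integral_affine_set (-1) 0) ?oppr_eq0 ?oner_neq0//.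
  rewrite normrN normr1 mul1e.
  have -> : [set x : R | [set` `]-oo, 0%R]] (-1 * x + 0)%R] = `[0%R, +oo[%classic.
    by apply/seteqP; split => x /=; rewrite !in_itv/= andbT; lra.
  rewrite -integral_itv_obnd_cbnd; last first.
    apply: (@measurable_funS _ _ _ _ setT) => //.
    by apply: (measurableT_comp mG); apply: measurable_funD => //; apply: measurable_funM.
  apply: eq_integral => s; rewrite inE/= in_itv/= andbT => s0.
  rewrite /G addr0 mulN1r normrN gtr0_norm// /polar sinDpi cosDpi !mulrN !mulNr//.
have mh : measurable_fun setT h.
  apply: (@measurable_tonelli_fst (fun p : R * R => F (p.2 * sin p.1, p.2 * cos p.1)%R * `|p.2|%:E)).
    apply: emeasurable_funM => //; last by apply/measurable_EFinP; exact: measurableT_comp.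
    apply: (measurableT_comp mF); apply/measurable_fun_pairP; split => /=; apply: measurable_funM => //;
      apply: measurableT_comp => //; apply: continuous_measurable_fun; [exact: continuous_sin|exact: continuous_cos].
  by move=> p; rewrite mule_ge0// lee_fin.
have h0 t : 0 <= h t by apply: integral_ge0 => s _; rewrite mule_ge0// lee_fin.
have mkpi : measurable_fun setT (fun th : R => k (th + pi)%R).
  by apply: (measurableT_comp mk); exact: measurable_funD.
have pi0 := @pi_gt0 R.
have mtd : measurable tan_dom by exact: open_measurable open_tan_dom.
rewrite [LHS](ge0_integral_affine_set (-1) (pi / 2)) ?oppr_eq0 ?oner_neq0//.
rewrite normrN normr1 mul1e.
have -> : [set x : R | tan_dom (-1 * x + pi / 2)%R] = `]0%R, pi[%classic.
  by apply/seteqP; split => x /=; rewrite /tan_dom /= !in_itv/= => /andP[? ?]; apply/andP; split; lra.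
transitivity (\int[mu]_(th in `]0%R, pi[) (k th + k (th + pi)%R)).
  apply: eq_integral => th _; rewrite -hE /h.
  by have -> : (-1 * th + pi / 2 = pi / 2 - th)%R by ring.
rewrite ge0_integralD//; last 2 first.
  exact: measurable_funS mk.
  exact: measurable_funS mkpi.
have -> : `]0%R, (2 * pi)%R[%classic = (`]0%R, pi] `|` `]pi, (2 * pi)%R[ : set R)%classic.
  apply/seteqP; split => x /=; rewrite !in_itv/=.
    by move=> /andP[h1 h2]; have [?|?] := leP x pi; [left|right]; apply/andP; split; lra.
  by move=> [] /andP[h1 h2]; apply/andP; split; lra.
have disj : [disjoint `]0%R, pi] & `]pi, (2 * pi)%R[ : set R]%classic.
  rewrite disj_set2E; apply/eqP/seteqP; split => x //=; rewrite !in_itv/= => -[/andP[? ?] /andP[? ?]]; lra.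
have mkD (D : set R) : measurable_fun D k.
  exact: (@measurable_funS _ _ _ _ setT).
rewrite [RHS](ge0_integral_setU mu (measurable_itv _) (measurable_itv _) (mkD _) (fun x _ => k0 x) disj).
apply: f_equal2.
  by rewrite integral_itv_bndo_bndc.
rewrite [RHS](ge0_integral_affine_set 1 pi) ?oner_neq0//.
rewrite normr1 mul1e.
have -> : [set x : R | [set` `]pi, (2 * pi)%R[] (1 * x + pi)%R] = `]0%R, pi[%classic.
  by apply/seteqP; split => x /=; rewrite !in_itv/= => /andP[? ?]; apply/andP; split; lra.
by apply: eq_integral => th _; rewrite mul1r.
Qed.

End substitutions.

(** * Monotonicity from the sign of the derivative *)

Section lipschitz_monotone.
Context {R : realType}.
Local Notation mu := (@lebesgue_measure R).

Lemma half_lipschitz_continuous (f : R -> R) :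
  (forall x y, `|f x - f y| <= 2^-1 * `|x - y|) -> continuous f.
Proof.
move=> lf x; apply/cvgrPdist_le => /= e e0; near=> y.
apply: le_trans (lf _ _) _.
have : `|x - y| <= e by near: y; exact: (@cvgr_dist_le _ _ _ _ _ id x).
have := normr_ge0 (x - y); lra.
Unshelve. all: by end_near. Qed.

Section stieltjes.
Variable f : R -> R.
Hypothesis lf : forall x y, `|f x - f y| <= 2^-1 * `|x - y|.

Let plus (x : R) := 2^-1 * x + f x.
Let minus (x : R) := 2^-1 * x - f x.

Let plus_nd : {homo plus : x y / x <= y}.
Proof.
move=> x y xy; have := lf x y; rewrite (distrC x y) (@ger0_norm _ (y - x)) ?subr_ge0// ler_norml /plus.
by move=> /andP[]; lra.
Qed.

Let minus_nd : {homo minus : x y / x <= y}.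
Proof.
move=> x y xy; have := lf x y; rewrite (distrC x y) (@ger0_norm _ (y - x)) ?subr_ge0// ler_norml /minus.
by move=> /andP[]; lra.
Qed.

Let half_cont : continuous (fun x : R => 2^-1 * x).
Proof. by move=> x; apply: cvgM; [exact: cvg_cst|exact: cvg_id]. Qed.

Let plus_rc : right_continuous plus.
Proof.
apply: right_continuousW => x.
by apply: cvgD; [exact: half_cont|exact: half_lipschitz_continuous].
Qed.

Let minus_rc : right_continuous minus.
Proof.
apply: right_continuousW => x.
by apply: cvgB; [exact: half_cont|exact: half_lipschitz_continuous].
Qed.

HB.instance Definition _ := isCumulative.Build R _ R plus plus_nd plus_rc.
HB.instance Definition _ := isCumulative.Build R _ R minus minus_nd minus_rc.

Let nu1 : {measure set (measurableTypeR R) -> \bar R} := lebesgue_stieltjes_measure plus.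
Let nu2 : {measure set (measurableTypeR R) -> \bar R} := lebesgue_stieltjes_measure minus.

Let stieltjes_itv (g : cumulative R R) (a b : R) : a <= b ->
  lebesgue_stieltjes_measure g `]a, b]%classic = (g b - g a)%:E.
Proof.
move=> ab; transitivity (wlength g `]a, b]%classic); last by rewrite wlength_itv_bnd.
by apply: measurable_mu_extE; exact: is_ocitv.
Qed.

Let nu1_itv (a b : R) : a <= b -> nu1 `]a, b]%classic = (plus b - plus a)%:E.
Proof. exact: stieltjes_itv. Qed.

Let nu2_itv (a b : R) : a <= b -> nu2 `]a, b]%classic = (minus b - minus a)%:E.
Proof. exact: stieltjes_itv. Qed.

Let nu12 A : measurable A -> mu A = (nu1 A + nu2 A)%E.
Proof.
move=> mA; rewrite -measure_addE; apply: lebesgue_measure_unique => //.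
move=> _ [[a b] _ <-]; rewrite -[RHS]/(measure_add nu1 nu2 _) measure_addE /=.
have [ab|ba] := leP a b; last by rewrite set_itv_ge ?measure0 ?adde0// bnd_simp -leNgt ltW.
rewrite nu1_itv// nu2_itv// lebesgue_measure_itv/= lte_fin.
rewrite -EFinD; case: ltP => [_|ba]; first by rewrite -EFinD; congr EFin; rewrite /plus /minus; lra.
have -> : a = b by apply/eqP; rewrite eq_le ab ba.
by congr EFin; lra.
Qed.

(* [x / 2 + f x] and [x / 2 - f x] are cumulative functions whose Stieltjes measures add up
   to Lebesgue measure; hence the first one is absolutely continuous, and its
   Radon-Nikodym density is its derivative almost everywhere. *)
Lemma half_lipschitz_ae_derive (b : R) : 0 < b ->
  exists g : R -> R, [/\ (forall x, 0 <= g x), mu.-integrable setT (EFin \o g),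
    (forall x y, 0 <= x -> x <= y -> y <= b ->
       f y - f x + 2^-1 * (y - x) = \int[mu]_(t in `]x, y]) g t) &
    {ae mu, forall x, 0 < x < b -> derivable f x 1 /\ derive1 f x + 2^-1 = g x}].
Proof.
move=> b0.
have mD : measurable (`]0, b] : set (measurableTypeR R)) by exact: measurable_itv.
have Doo : (nu1 `]0%R, b]%classic < +oo)%E by rewrite nu1_itv ?ltW// ltry.
(* Cutting [nu1] down to []0, b]] makes it finite for the Radon-Nikodym theorem. *)
pose nu : {finite_measure set (measurableTypeR R) -> \bar R} := mfrestr mD Doo.
have dom : nu `<< mu.
  apply/null_content_dominatesP => A mA muA0.
  rewrite /nu /mfrestr /mrestr; apply/eqP; rewrite eq_le measure_ge0 andbT.
  have mAD : measurable (A `&` `]0%R, b]%classic) by exact: measurableI.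
  rewrite -muA0; apply: (@le_trans _ _ (mu (A `&` `]0%R, b]%classic))).
    by rewrite nu12// leeDl.
  by apply: le_measure; rewrite ?inE//; exact: subIsetl.
have [h [h0 hfin hint hE]] := radon_nikodym_sigma_finite dom.
pose g := fine \o h.
have gE : EFin \o g = h by apply/funext => x; rewrite /g/= fineK.
have intg : mu.-integrable setT (EFin \o g) by rewrite gE.
have incr x y : 0 <= x -> x <= y -> y <= b ->
    f y - f x + 2^-1 * (y - x) = \int[mu]_(t in `]x, y]) g t.
  move=> x0 xy yb; rewrite /Rintegral.
  have -> : (\int[mu]_(t in `]x, y]) (g t)%:E)%E = nu `]x, y]%classic.
    rewrite hE//; apply: eq_integral => t _; by rewrite -gE.
  have -> : nu `]x, y]%classic = nu1 (`]x, y] `&` `]0, b])%classic by [].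
  rewrite setIidl; last first.
    by move=> t /=; rewrite !in_itv/= => /andP[h1 h2]; apply/andP; split; lra.
  by rewrite nu1_itv//= /plus; lra.
exists g; split => //; first by move=> x; exact: fine_ge0.
have locg : locally_integrable setT g.
  by apply: open_integrable_locally => //; exact: openT.
have intI (i : interval R) : mu.-integrable [set` i] (EFin \o g).
  by apply: integrableS intg => //.
have := @FTC1 _ g (BRight 0) (fun y => intI _) locg.
apply: filterS; first exact: (ae_filter_ringOfSetsType mu).
move=> x H /andP[x0 xb].
have {H}[dG G'] := H x0.
set G := (X in derivable X) in dG G'.
(* [G] is the primitive of [g] from 0, differentiable with derivative [g] at almost every point;
   near [x] it differs from [f] by [t / 2] and a constant. *)
have near_eq : \near x, G x - 2^-1 * x + f 0 = f x.
  near=> t.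
  have t0 : 0 < t by near: t; exact: lt_nbhsr.
  have tb : t < b by near: t; exact: lt_nbhsl.
  rewrite /G -(incr 0 t) ?lexx ?ltW//; lra.
have dfun : is_derive x (1:R) (fun t => G t - 2^-1 * t + f 0) (g x - 2^-1).
  have e1 : is_derive x (1:R) G (g x).
    by split; [exact: dG|rewrite -derive1E].
  have e2 : is_derive x (1:R) (fun t : R => 2^-1 * t) (2^-1).
    have := @is_deriveZ R R R id (2^-1) x 1 1 (is_derive_id _ _).
    by rewrite -[_ *: 1]/(_ * _) mulr1.
  have e3 := is_deriveD (is_deriveB e1 e2) (@is_derive_cst R R R (f 0) x 1).
  by apply: (is_derive_eq e3); rewrite addr0.
have df := near_eq_is_derive near_eq dfun.
split; first by case: df.
by rewrite derive1E (@derive_val _ _ _ _ _ _ _ df) subrK.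
Unshelve. all: by end_near. Qed.

End stieltjes.

(** The sign hypothesis speaks only of points of differentiability; it bites because almost every
    point is one. There the density [g], which is [f' + 1/2], is at most [1/2], so [f + x / 2] grows
    no faster than [x / 2]. *)
Lemma half_lipschitz_nonincreasing (f : R -> R) (a b : R) :
  (forall x y, `|f x - f y| <= 2^-1 * `|x - y|) ->
  0 <= a ->
  {ae mu, forall x, a < x < b -> derivable f x 1 -> derive1 f x <= 0} ->
  forall x y, a <= x -> x <= y -> y <= b -> f y <= f x.
Proof.
move=> lf a0 ae_le x y ax xy yb.
have [yy|y0] := leP y 0.
  have -> : x = y by lra.
  by [].
have y10 : 0 < y + 1 by lra.
have [g [g0 intg incr aeg]] := half_lipschitz_ae_derive f lf _ y10.
have xyE := incr x y (le_trans a0 ax) xy (ltW (ltr_pwDr ltr01 (lexx y))).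
suff : \int[mu]_(t in `]x, y]) g t <= \int[mu]_(t in `]x, y]) (2^-1 : R).
  have -> : \int[mu]_(t in `]x, y]) (2^-1 : R) = 2^-1 * (y - x).
    rewrite Rintegral_cst//= lebesgue_measure_itv/= lte_fin.
    case: ltP => [_|yx]; first by rewrite -EFinD.
    have -> : x = y by lra.
    by rewrite subrr mulr0.
  lra.
have [<-|xy'] := eqVneq x y; first by rewrite set_itvoc0 !Rintegral_set0.
have mg : measurable_fun setT g by apply/measurable_EFinP; case/integrableP: intg.
have intc : mu.-integrable `]x, y] (EFin \o (fun=> 2^-1 : R)).
  apply/integrableP; split; first by apply/measurable_EFinP; exact: measurable_cst.
  by rewrite /= integral_cst//= lebesgue_measure_itv/= lte_fin; case: ifP => _; rewrite ?mule0 -?EFinD -?EFinM ?ltry.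
rewrite /Rintegral fine_le//; last 3 first.
- by apply: integrable_fin_num => //; exact: integrableS intg.
- exact: integrable_fin_num.
- rewrite -!integral_itv_bndo_bndc//; last first.
    by apply/measurable_EFinP; exact: measurable_funS mg.
  apply: ae_ge0_le_integral => //.
  + by move=> t _; rewrite lee_fin.
  + by apply/measurable_EFinP; exact: measurable_funS mg.
  move: aeg ae_le; apply: filterS2; first exact: (ae_filter_ringOfSetsType mu).
  move=> t h1 h2; rewrite /= in_itv/= => /andP[t1 t2].
  have [|dt ft] := h1 _; first by apply/andP; split; lra.
  have := h2 _ dt; rewrite lee_fin -ft => h.
  suff : derive1 f t <= 0 by lra.
  by apply: h; apply/andP; split; lra.
Qed.

Lemma lipschitz_nonincreasing (r : R -> R) (L a b : R) : 0 <= a ->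
  (forall x y, a <= x <= b -> a <= y <= b -> `|r x - r y| <= L * `|x - y|) ->
  {ae mu, forall x, a < x < b -> derivable r x 1 -> derive1 r x <= 0} ->
  forall x y, a <= x -> x <= y -> y <= b -> r y <= r x.
Proof.
move=> a0 lr ae_le x y ax xy yb.
(* Clamping extends [r] from [[a, b]] to the line without raising its Lipschitz constant, and
   division by [2 * (|L| + 1)] brings that constant down to [1/2]. The 1 guards against [L = 0]. *)
pose clamp t := if t <= a then a else if b <= t then b else t.
have ab : a <= b by lra.
have clampP t : a <= clamp t <= b by rewrite /clamp; case: (leP t a) => ?; [|case: (leP b t) => ?]; apply/andP; split; lra.
have clamp_id t : a <= t <= b -> clamp t = t.
  by move=> /andP[h1 h2]; rewrite /clamp; case: (leP t a) => ?; [|case: (leP b t) => ?]; lra.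
have clamp_lip s t : `|clamp s - clamp t| <= `|s - t|.
  rewrite /clamp; case: (leP s a) => ?; case: (leP t a) => ?; case: (leP b s) => ?; case: (leP b t) => ?;
  rewrite ler_norml; (case: (ler0P (s - t)) => ?); apply/andP; split; lra.
have M0 : 0 < 2 * (`|L| + 1) :> R by have := normr_ge0 L; lra.
pose f t := r (clamp t) / (2 * (`|L| + 1)).
have lf s t : `|f s - f t| <= 2^-1 * `|s - t|.
  rewrite /f -mulrBl normrM normfV (gtr0_norm M0) ler_pdivrMr//.
  apply: le_trans (lr _ _ (clampP s) (clampP t)) _.
  apply: (@le_trans _ _ ((`|L| + 1) * `|s - t|)).
    apply: (@le_trans _ _ (`|L| * `|clamp s - clamp t|)).
      by apply: ler_wpM2r => //; exact: ler_norm.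
    by apply: ler_pM => //; first [exact: clamp_lip|lra].
  by rewrite [leRHS]mulrAC [2^-1 * _]mulrA mulVf// mul1r.
have fae : {ae mu, forall t, a < t < b -> derivable f t 1 -> derive1 f t <= 0}.
  move: ae_le; apply: filterS; first exact: (ae_filter_ringOfSetsType mu).
  move=> t h /andP[t1 t2] df.
  have nr : \near t, (2 * (`|L| + 1)) * f t = r t.
    near=> s; rewrite /f mulrC divfK ?gt_eqF// clamp_id//.
    by apply/andP; split; apply/ltW; near: s; [exact: lt_nbhsr|exact: lt_nbhsl].
  have d1 : is_derive t (1:R) (fun s => (2 * (`|L| + 1)) * f s) ((2 * (`|L| + 1)) * derive1 f t).
    have dft : is_derive t (1:R) f (derive1 f t) by split => //; rewrite derive1E.
    exact: (is_deriveZ (2 * (`|L| + 1)) dft).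
  have d2 := near_eq_is_derive nr d1.
  have [dr r'] := d2.
  have := h _ dr; rewrite t1 t2 derive1E r' => /(_ isT).
  by rewrite pmulr_rle0.
have := half_lipschitz_nonincreasing f a b lf a0 fae x y ax xy yb.
by rewrite /f ler_pM2r ?invr_gt0// !clamp_id//; apply/andP; split; lra.
Unshelve. all: by end_near. Qed.

End lipschitz_monotone.

(** * The polar angle *)

Section polar_coordinates.
Context {R : realType}.
Implicit Types p q : R * R.

Definition nrm p : R := Num.sqrt (p.1 ^+ 2 + p.2 ^+ 2).

(* The plane cut along the closed positive half-axis. *)
Definition slit : set (R * R) := [set p | p.1 < nrm p].

(* [cot (arg p / 2) = p.2 / (nrm p - p.1)]: a single formula for the angle in
   [(0, 2 pi)] on the whole slit plane. *)
Definition arg p : R := pi - 2 * atan (p.2 / (nrm p - p.1)).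

Lemma nrm_sqr p : nrm p ^+ 2 = p.1 ^+ 2 + p.2 ^+ 2.
Proof. by rewrite /nrm sqr_sqrtr// addr_ge0// sqr_ge0. Qed.

Lemma nrm_ge0 p : 0 <= nrm p. Proof. exact: sqrtr_ge0. Qed.

Lemma nrm_polar (rho th : R) : nrm (polar rho th) = `|rho|.
Proof. by rewrite /nrm /polar/= !exprMn -mulrDr cos2Dsin2 mulr1 sqrtr_sqr. Qed.

Lemma fst_le_nrm p : p.1 <= nrm p.
Proof.
apply: le_trans (ler_norm _) _; rewrite -sqrtr_sqr /nrm ler_wsqrtr// lerDl sqr_ge0//.
Qed.

Lemma slit_nrm_gt0 p : slit p -> 0 < nrm p.
Proof.
move=> sp; rewrite lt_neqAle nrm_ge0 andbT; apply/negP => /eqP p0.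
move: (sp); rewrite /slit/= -p0 => p1.
have := nrm_sqr p; rewrite -p0 expr0n/=; have := sqr_ge0 p.2; nra.
Qed.

Lemma nonslit p : ~ slit p -> p = (nrm p, 0).
Proof.
move=> /negP; rewrite -leNgt => h.
have e : p.1 = nrm p by apply/eqP; rewrite eq_le h fst_le_nrm.
have := nrm_sqr p; rewrite -e => /eqP; rewrite eq_sym addrC -subr_eq0 addrK sqrf_eq0 => /eqP p2.
by case: p p2 e {h} => x y /= -> ->.
Qed.

Lemma cos_neq1 (th : R) : 0 < th < 2 * pi -> cos th < 1.
Proof.
move=> /andP[h1 h2]; have -> : th = (th / 2) *+ 2 by rewrite -mulr_natr divfK// pnatr_eq0.
rewrite cos_mulr2n; have s0 : 0 < sin (th / 2) by apply: sin_gt0_pi; apply/andP; split; lra.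
have := cos2Dsin2 (th / 2); rewrite mulr2n; nra.
Qed.

Lemma slit_polar (rho th : R) : 0 < rho -> 0 < th < 2 * pi -> slit (polar rho th).
Proof.
move=> r0 /cos_neq1 c1; rewrite /slit/= nrm_polar gtr0_norm//.
by rewrite gtr_pMr.
Qed.

Lemma arg_polar (rho th : R) : 0 < rho -> 0 < th < 2 * pi -> arg (polar rho th) = th.
Proof.
move=> r0 hth; rewrite /arg nrm_polar gtr0_norm//=.
have c1 := cos_neq1 _ hth; move: hth => /andP[h1 h2].
set u := th / 2; have thu : th = u *+ 2 by rewrite /u -mulr_natr divfK// pnatr_eq0.
have s0 : 0 < sin u by apply: sin_gt0_pi; rewrite /u; apply/andP; split; lra.
have -> : rho * sin th / (rho - rho * cos th) = tan (pi / 2 - u).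
  rewrite /tan sinB cosB cos_pihalf sin_pihalf !mul0r !mul1r subr0 add0r.
  have c1' : 1 - cos th != 0 by rewrite gt_eqF// subr_gt0.
  have e : 1 - cos th = 2 * sin u ^+ 2.
    by rewrite thu cos_mulr2n; have := cos2Dsin2 u; rewrite mulr2n; lra.
  have -> : rho - rho * cos th = rho * (1 - cos th) by ring.
  by rewrite e thu sin_mulr2n mulr2n; field; rewrite !gt_eqF.
rewrite tanK; first by rewrite /u; field.
by rewrite in_itv/= /u; apply/andP; split; lra.
Qed.

Lemma arg_bounds p : 0 < arg p < 2 * pi.
Proof.
rewrite /arg; have := atan_gtNpi2 (p.2 / (nrm p - p.1)).
by have := atan_ltpi2 (p.2 / (nrm p - p.1)) => h1 h2; apply/andP; split; lra.
Qed.

Lemma polar_arg p : slit p -> p = polar (nrm p) (arg p).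
Proof.
move=> sp; have n0 := slit_nrm_gt0 p sp.
have d0 : 0 < nrm p - p.1 by rewrite subr_gt0.
rewrite /polar /arg; set q := p.2 / _; set a := atan _.
have c0 : 0 < cos a by apply: cos_gt0_pihalf; rewrite atan_gtNpi2 atan_ltpi2.
have ta : sin a / cos a = q by rewrite -/(tan a) atanK.
have sa : sin a = q * cos a by rewrite -ta divfK// gt_eqF.
have e2 : 2 * a = a *+ 2 by rewrite mulr2n; ring.
have c2 : cos a ^+ 2 * (1 + q ^+ 2) = 1.
  have h := cos2Dsin2 a; rewrite sa in h; rewrite -[RHS]h; ring.
have q2 : 1 + q ^+ 2 = 2 * nrm p / (nrm p - p.1).
  have e : p.2 ^+ 2 = nrm p ^+ 2 - p.1 ^+ 2 by rewrite nrm_sqr; ring.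
  by rewrite /q expr_div_n e; field; rewrite gt_eqF.
have c2' : cos a ^+ 2 = (nrm p - p.1) / (2 * nrm p).
  have q20 : 1 + q ^+ 2 != 0 by rewrite gt_eqF// ltr_pwDl// sqr_ge0.
  have -> : (nrm p - p.1) / (2 * nrm p) = (1 + q ^+ 2)^-1.
    by rewrite q2; field; rewrite !gt_eqF.
  by rewrite -[LHS](mulfK q20) c2 mul1r.
have -> : nrm p * cos (pi - 2 * a) = p.1.
  rewrite cosB cospi sinpi mul0r addr0 mulN1r e2 cos_mulr2n c2' mulr2n.
  by field; rewrite gt_eqF.
have -> : nrm p * sin (pi - 2 * a) = p.2.
  rewrite sinB cospi sinpi mul0r sub0r mulN1r opprK e2 sin_mulr2n mulr2n sa.
  have -> : cos a * (q * cos a) = q * cos a ^+ 2 by ring.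
  by rewrite c2' /q; field; rewrite !gt_eqF.
by case: (p).
Qed.

Lemma continuous_fst2 : continuous (fun p : R * R => p.1).
Proof. by move=> p; exact: cvg_fst. Qed.

Lemma continuous_snd2 : continuous (fun p : R * R => p.2).
Proof. by move=> p; exact: cvg_snd. Qed.

Lemma continuous_nrm : continuous nrm.
Proof.
move=> p; apply: (@continuous_comp _ _ _ (fun p : R * R => p.1 ^+ 2 + p.2 ^+ 2) Num.sqrt); last exact: sqrt_continuous.
by apply: cvgD; apply: cvgM; (exact: continuous_fst2 || exact: continuous_snd2).
Qed.

Lemma continuous_arg p : slit p -> {for p, continuous arg}.
Proof.
move=> sp; rewrite /arg; apply: cvgB; first exact: cvg_cst.
apply: cvgM; first exact: cvg_cst.
apply: (@continuous_comp _ _ _ (fun p : R * R => p.2 / (nrm p - p.1)) atan); last exact: continuous_atan.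
apply: cvgM; first exact: continuous_snd2.
apply: cvgV; first by rewrite gt_eqF// subr_gt0.
by apply: cvgB; [exact: continuous_nrm|exact: continuous_fst2].
Qed.

Lemma open_slit : open slit.
Proof.
have -> : slit = (fun p => nrm p - p.1) @^-1` [set x | 0 < x].
  by apply/seteqP; split => p; rewrite /slit/= subr_gt0.
apply: open_comp => [p _|]; last exact: open_gt.
by apply: cvgB; [exact: continuous_nrm|exact: continuous_fst2].
Qed.

Lemma continuous_polar : continuous (fun p : R * R => polar p.1 p.2).
Proof.
have cM (f : R -> R) : continuous f -> continuous (fun p : R * R => p.1 * f p.2).
  move=> cf p; apply: cvgM; first exact: continuous_fst2.
  by apply: (@continuous_comp _ _ _ snd f); [exact: continuous_snd2|exact: cf].
move=> p; exact: (cvg_pair (cM _ (@continuous_cos R) p) (cM _ (@continuous_sin R) p)).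
Qed.

Lemma is_derive_nrm_fst p : slit p ->
  is_derive p.1 (1 : R) (fun t => nrm (t, p.2)) (p.1 / nrm p).
Proof.
move=> sp; have n0 := slit_nrm_gt0 p sp.
have s0 : 0 < p.1 ^+ 2 + p.2 ^+ 2 by rewrite -nrm_sqr exprn_gt0.
have d1 : is_derive p.1 (1 : R) (fun t : R => t ^+ 2 + p.2 ^+ 2) (2 * p.1).
  have := is_deriveD (@is_deriveM _ _ id id p.1 1 _ _ (is_derive_id _ _) (is_derive_id _ _))
    (@is_derive_cst R R R (p.2 ^+ 2) p.1 1).
  by move=> h; apply: (is_derive_eq h); rewrite -![_ *: 1]/(_ * _); ring.
have d2 := @is_derive1_sqrt _ _ s0.
have := @is_derive1_comp _ Num.sqrt (fun t : R => t ^+ 2 + p.2 ^+ 2) p.1 _ _ d2 d1.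
move=> h; apply: (is_derive_eq h); rewrite -/(nrm p).
by field; rewrite gt_eqF.
Qed.

Lemma is_derive_nrm_snd p : slit p ->
  is_derive p.2 (1 : R) (fun t => nrm (p.1, t)) (p.2 / nrm p).
Proof.
move=> sp; have n0 := slit_nrm_gt0 p sp.
have s0 : 0 < p.1 ^+ 2 + p.2 ^+ 2 by rewrite -nrm_sqr exprn_gt0.
have d1 : is_derive p.2 (1 : R) (fun t : R => p.1 ^+ 2 + t ^+ 2) (2 * p.2).
  have := is_deriveD (@is_derive_cst R R R (p.1 ^+ 2) p.2 1)
    (@is_deriveM _ _ id id p.2 1 _ _ (is_derive_id _ _) (is_derive_id _ _)).
  by move=> h; apply: (is_derive_eq h); rewrite -![_ *: 1]/(_ * _); ring.
have d2 := @is_derive1_sqrt _ _ s0.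
have := @is_derive1_comp _ Num.sqrt (fun t : R => p.1 ^+ 2 + t ^+ 2) p.2 _ _ d2 d1.
move=> h; apply: (is_derive_eq h); rewrite -/(nrm p).
by field; rewrite gt_eqF.
Qed.

Lemma is_derive_ln_nrm_fst p : slit p ->
  is_derive p.1 (1 : R) (fun t => ln (nrm (t, p.2))) (p.1 / nrm p ^+ 2).
Proof.
move=> sp; have n0 := slit_nrm_gt0 p sp.
have dl : is_derive (nrm (p.1, p.2)) (1 : R) (@ln R) (nrm p)^-1.
  by rewrite -surjective_pairing; exact: is_derive1_ln.
have h := @is_derive1_comp _ (@ln R) (fun t : R => nrm (t, p.2)) p.1 _ _ dl (is_derive_nrm_fst p sp).
by apply: (is_derive_eq h); field; rewrite gt_eqF.
Qed.

Lemma is_derive_ln_nrm_snd p : slit p ->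
  is_derive p.2 (1 : R) (fun t => ln (nrm (p.1, t))) (p.2 / nrm p ^+ 2).
Proof.
move=> sp; have n0 := slit_nrm_gt0 p sp.
have dl : is_derive (nrm (p.1, p.2)) (1 : R) (@ln R) (nrm p)^-1.
  by rewrite -surjective_pairing; exact: is_derive1_ln.
have h := @is_derive1_comp _ (@ln R) (fun t : R => nrm (p.1, t)) p.2 _ _ dl (is_derive_nrm_snd p sp).
by apply: (is_derive_eq h); field; rewrite gt_eqF.
Qed.

Let is_derive_arg_aux (q dq : R) (f : R -> R) (x : R) :
  is_derive x (1 : R) f dq -> f x = q ->
  is_derive x (1 : R) (fun t => pi - 2 * atan (f t)) (- 2 * (dq / (1 + q ^+ 2))).
Proof.
move=> df fx.
have da := @is_derive1_comp _ atan f x _ _ (is_derive1_atan (f x)) df.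
have h := is_deriveB (@is_derive_cst R R R pi x 1) (is_deriveZ 2 da).
apply: (is_derive_eq h); rewrite -[_ *: (_ * _)]/(_ * (_ * _)) fx; ring.
Qed.

Lemma is_derive_arg_fst p : slit p ->
  is_derive p.1 (1 : R) (fun t => arg (t, p.2)) (- (p.2 / nrm p ^+ 2)).
Proof.
move=> sp; have n0 := slit_nrm_gt0 p sp.
have d0 : 0 < nrm p - p.1 by rewrite subr_gt0.
have n0' : nrm p != 0 by rewrite gt_eqF.
have d0' : nrm p - p.1 != 0 by rewrite gt_eqF.
have dd := is_deriveB (is_derive_nrm_fst p sp) (is_derive_id p.1 (1 : R)).
have ep : (p.1, p.2) = p by rewrite -surjective_pairing.
have dne : (nrm (p.1, p.2) - p.1) != 0 by rewrite ep.
have dv := @is_deriveV R (fun t => nrm (t, p.2) - t) p.1 _ 1 dne dd.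
have dq := is_deriveZ p.2 dv.
have h := is_derive_arg_aux (p.2 / (nrm p - p.1)) _ _ _ dq _.
have h' := h ltac:(by rewrite /= ep).
apply: (is_derive_eq h'); rewrite /= ep.
rewrite -!/(_ * _).
have e : p.2 ^+ 2 = nrm p ^+ 2 - p.1 ^+ 2 by rewrite nrm_sqr; ring.
have q2 : 1 + (p.2 / (nrm p - p.1)) ^+ 2 = 2 * nrm p / (nrm p - p.1).
  by rewrite expr_div_n e; field.
rewrite q2; rewrite -![_ *: _]/(_ * _); field.
by rewrite n0' d0'.
Qed.

Lemma is_derive_arg_snd p : slit p ->
  is_derive p.2 (1 : R) (fun t => arg (p.1, t)) (p.1 / nrm p ^+ 2).
Proof.
move=> sp; have n0 := slit_nrm_gt0 p sp.
have d0 : 0 < nrm p - p.1 by rewrite subr_gt0.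
have n0' : nrm p != 0 by rewrite gt_eqF.
have d0' : nrm p - p.1 != 0 by rewrite gt_eqF.
have dd := is_deriveB (is_derive_nrm_snd p sp) (@is_derive_cst R R R p.1 p.2 1).
have ep : (p.1, p.2) = p by rewrite -surjective_pairing.
have dne : (nrm (p.1, p.2) - p.1) != 0 by rewrite ep.
have dv := @is_deriveV R (fun t => nrm (p.1, t) - p.1) p.2 _ 1 dne dd.
have dq := is_deriveM (is_derive_id p.2 (1 : R)) dv.
have h := is_derive_arg_aux (p.2 / (nrm p - p.1)) _ _ _ dq _.
have h' := h ltac:(by rewrite -[LHS]/(p.2 * (nrm (p.1, p.2) - p.1)^-1) ep).
apply: (is_derive_eq h'); rewrite /= ep.
have e : p.2 ^+ 2 = nrm p ^+ 2 - p.1 ^+ 2 by rewrite nrm_sqr; ring.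
have q2 : 1 + (p.2 / (nrm p - p.1)) ^+ 2 = 2 * nrm p / (nrm p - p.1).
  by rewrite expr_div_n e; field.
rewrite q2 -![_ *: _]/(_ * _) subr0.
have -> : p.2 * (- (nrm p - p.1) ^- 2 * (p.2 / nrm p)) + (nrm p - p.1)^-1 * 1 =
  - (nrm p - p.1) ^- 2 * (p.2 ^+ 2 / nrm p) + (nrm p - p.1)^-1 by ring.
by rewrite e; field; rewrite n0' d0'.
Qed.

End polar_coordinates.

(** * Distance to the boundary of a sector *)

Section distance_to_sets.
Context {R : realType}.
Implicit Types (p q : R * R) (S : set (R * R)).
Local Notation edist := Defs.edist.

Lemma edist_ge0 p q : 0 <= edist p q. Proof. exact: sqrtr_ge0. Qed.

Lemma edist_sqr p q : edist p q ^+ 2 = (p.1 - q.1) ^+ 2 + (p.2 - q.2) ^+ 2.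
Proof. by rewrite /edist sqr_sqrtr// addr_ge0// sqr_ge0. Qed.

Lemma edistC p q : edist p q = edist q p.
Proof. by rewrite /edist -[(p.1 - _) ^+ 2]sqrrN -[(p.2 - _) ^+ 2]sqrrN !opprB. Qed.

Lemma edist_nrm p : edist p (0, 0) = nrm p.
Proof. by rewrite /edist /nrm/= !subr0. Qed.

Lemma edist_triangle p q s : edist p s <= edist p q + edist q s.
Proof.
rewrite -(@ler_pXn2r _ 2)// ?nnegrE ?addr_ge0 ?edist_ge0//.
have := edist_sqr p q; have := edist_sqr q s; have := edist_sqr p s.
have := edist_ge0 p q; have := edist_ge0 q s.
set a := edist p q; set b := edist q s; set c := edist p s => b0 a0 ec eb ea.
set x := p.1 - q.1 in ea *; set y := p.2 - q.2 in ea *.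
set z := q.1 - s.1 in eb *; set w := q.2 - s.2 in eb *.
have ec' : c ^+ 2 = (x + z) ^+ 2 + (y + w) ^+ 2 by rewrite ec /x /y /z /w; congr (_ ^+ 2 + _ ^+ 2); ring.
have cs : x * z + y * w <= a * b.
  apply: le_trans (ler_norm _) _.
  rewrite -(@ler_pXn2r _ 2)// ?nnegrE ?mulr_ge0//.
  rewrite real_normK ?num_real// exprMn ea eb.
  have -> : (x ^+ 2 + y ^+ 2) * (z ^+ 2 + w ^+ 2) = (x * z + y * w) ^+ 2 + (x * w - y * z) ^+ 2 by ring.
  by rewrite lerDl sqr_ge0.
have -> : (a + b) ^+ 2 = a ^+ 2 + b ^+ 2 + 2 * (a * b) by ring.
have e : (x + z) ^+ 2 + (y + w) ^+ 2 =
  x ^+ 2 + y ^+ 2 + (z ^+ 2 + w ^+ 2) + 2 * (x * z + y * w) by ring.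
rewrite ec' ea eb e; lra.
Qed.

Lemma edist_polar (rho t th phi : R) :
  edist (polar rho th) (polar t phi) =
  Num.sqrt (rho ^+ 2 + t ^+ 2 - 2 * (rho * t) * cos (th - phi)).
Proof.
rewrite /edist /polar/=; congr Num.sqrt; rewrite cosB.
have h1 : sin th ^+ 2 = 1 - cos th ^+ 2 by rewrite sin2cos2.
have h2 : sin phi ^+ 2 = 1 - cos phi ^+ 2 by rewrite sin2cos2.
have -> : (rho * cos th - t * cos phi) ^+ 2 + (rho * sin th - t * sin phi) ^+ 2 =
  rho ^+ 2 * (cos th ^+ 2 + sin th ^+ 2) + t ^+ 2 * (cos phi ^+ 2 + sin phi ^+ 2)
  - 2 * (rho * t) * (cos th * cos phi + sin th * sin phi) by ring.
by rewrite !cos2Dsin2; ring.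
Qed.

Lemma dist_set_has_lbound p S : has_lbound [set edist p q | q in S].
Proof. by exists 0 => _ [q _ <-]; exact: edist_ge0. Qed.

Lemma dist_set_le p q S : S q -> dist_set p S <= edist p q.
Proof. by move=> Sq; apply: ge_inf; [exact: dist_set_has_lbound|exists q]. Qed.

Lemma le_dist_set p S (m : R) : S !=set0 -> (forall q, S q -> m <= edist p q) ->
  m <= dist_set p S.
Proof.
move=> [q0 Sq0] h; apply: lb_le_inf; first by exists (edist p q0), q0.
by move=> _ [q Sq <-]; exact: h.
Qed.

Lemma dist_setS p S S' : S !=set0 -> S `<=` S' -> dist_set p S' <= dist_set p S.
Proof. by move=> S0 SS'; apply: le_dist_set => // q /SS'; exact: dist_set_le. Qed.

(** Serves both symmetries of the sector: dilations by [k] and, with [k = 1], the reflection in the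
    bisector. Equality then comes from applying it to the inverse map as well. *)
Lemma dist_set_scale p p' S S' (k : R) : 0 < k -> S !=set0 ->
  (forall q, S q -> exists2 q', S' q' & edist p' q' <= k * edist p q) ->
  dist_set p' S' <= k * dist_set p S.
Proof.
move=> k0 S0 h; rewrite -ler_pdivrMl//; apply: le_dist_set => // q /h [q' Sq' le].
by rewrite ler_pdivrMl//; apply: le_trans le; exact: dist_set_le.
Qed.

Lemma dist_set_lip p p' S : S !=set0 -> dist_set p S <= edist p p' + dist_set p' S.
Proof.
move=> S0; rewrite -lerBlDl; apply: le_dist_set => // q Sq.
by rewrite lerBlDl; apply: le_trans (edist_triangle p p' q); exact: dist_set_le.
Qed.

Lemma edist_le_norms p q : edist p q <= `|p.1 - q.1| + `|p.2 - q.2|.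
Proof.
rewrite -(@ler_pXn2r _ 2)// ?nnegrE ?addr_ge0 ?edist_ge0//.
rewrite edist_sqr -(real_normK (num_real (p.1 - q.1))) -(real_normK (num_real (p.2 - q.2))).
have := normr_ge0 (p.1 - q.1); have := normr_ge0 (p.2 - q.2); nra.
Qed.

Lemma continuous_dist_set S : S !=set0 -> continuous (fun p => dist_set p S).
Proof.
move=> S0 p; apply/cvgrPdist_le => /= e e0; near=> q.
have h : edist p q <= e.
  apply: le_trans (edist_le_norms _ _) _.
  have h1 : `|p.1 - q.1| <= e / 2.
    near: q; apply: (@cvgr_dist_le _ _ _ _ _ (fun q : R * R => q.1) p.1); [exact: continuous_fst2|lra].
  have h2 : `|p.2 - q.2| <= e / 2.
    near: q; apply: (@cvgr_dist_le _ _ _ _ _ (fun q : R * R => q.2) p.2); [exact: continuous_snd2|lra].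
  lra.
have := dist_set_lip p q _ S0; have := dist_set_lip q p _ S0; rewrite (edistC q p) => h1 h2.
by rewrite ler_norml; apply/andP; split; lra.
Unshelve. all: by end_near. Qed.

Lemma dist_set_gt0 (A S : set (R * R)) p : open A -> A p -> S !=set0 ->
  (forall q, S q -> ~ A q) -> 0 < dist_set p S.
Proof.
move=> oA Ap S0 dis.
have /nbhs_ballP[e /= e0 sub] : nbhs p A by exact: open_nbhs_nbhs.
apply: lt_le_trans e0 _; apply: le_dist_set => // q Sq; rewrite leNgt; apply/negP => lt.
apply: (dis q Sq); apply: sub.
(* Neighbourhoods are given by max-norm balls, which contain the Euclidean balls of the same
   radius. *)
have h1 : `|p.1 - q.1| <= edist p q by rewrite -sqrtr_sqr ler_wsqrtr// lerDl sqr_ge0.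
have h2 : `|p.2 - q.2| <= edist p q by rewrite -sqrtr_sqr ler_wsqrtr// lerDr sqr_ge0.
by split; rewrite /ball/=; [exact: le_lt_trans h1 lt|exact: le_lt_trans h2 lt].
Qed.

End distance_to_sets.

(** * The sector, its boundary rays and its symmetries *)

Section sector.
Context {R : realType}.
Variable beta : R.
Hypothesis hbeta : pi < beta <= 2 * pi.
Implicit Types p q : R * R.
Local Notation edist := Defs.edist.

Let beta_bounds : [/\ 0 < pi :> R, 0 < beta & beta <= 2 * pi].
Proof. by have := hbeta; have := @pi_gt0 R; move=> ? /andP[? ?]; split; lra. Qed.

Lemma LambdaE : Lambda beta = [set p | slit p /\ arg p < beta].
Proof.
have [hpi hb0 hb2] := beta_bounds.
apply/seteqP; split => p /=.
  move=> [rho [th [r0 [/andP[h1 h2] ->]]]].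
  have hth : 0 < th < 2 * pi by rewrite h1; exact: lt_le_trans h2 hb2.
  by split; [exact: slit_polar|rewrite arg_polar].
move=> [sp ap]; exists (nrm p), (arg p); split; first exact: slit_nrm_gt0.
split; last exact: polar_arg.
by have /andP[-> _] := arg_bounds p.
Qed.

Lemma open_Lambda : open (Lambda beta).
Proof.
rewrite LambdaE openE => p [sp ap]; near=> q; split.
  by near: q; apply: open_nbhs_nbhs; split => //; exact: open_slit.
near: q; have := continuous_arg p sp; move=> /(_ [set x | x < beta]); apply.
exact: lt_nbhsl.
Unshelve. all: by end_near. Qed.

Definition rays : set (R * R) :=
  [set polar t 0 | t in [set t | 0 <= t]] `|` [set polar t beta | t in [set t | 0 <= t]].

Lemma polar_axis_nonslit (t : R) : 0 <= t -> ~ slit (polar t 0).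
Proof. by move=> t0; rewrite /slit/= nrm_polar cos0 mulr1 ger0_norm// ltxx. Qed.

Lemma rays_notin_Lambda q : rays q -> ~ Lambda beta q.
Proof.
have [hpi hb0 hb2] := beta_bounds.
rewrite LambdaE => -[[t /= t0 <-] [sp _]|[t /= t0 <-] [sp ab]].
  exact: polar_axis_nonslit sp.
have tp : 0 < t.
  by have := slit_nrm_gt0 _ sp; rewrite nrm_polar ger0_norm.
have [b2|b2] := ltP beta (2 * pi).
  by move: ab; rewrite arg_polar ?ltxx// hb0.
(* For [beta = 2 * pi] the second ray falls on the first, which is off the slit plane. *)
have be : beta = pi *+ 2 by rewrite mulr2n; lra.
apply: (polar_axis_nonslit t t0); move: sp.
by rewrite /polar be cos2pi sin2pi cos0 sin0.
Qed.

(** Here [s], which will be 1 or -1, points from the ray into the sector. The radius moves together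
    with the angle so that the vertex [t = 0] is covered too. *)
Lemma closure_Lambda_polar (t th s : R) : 0 <= t ->
  (forall e, 0 < e -> e < beta -> 0 < th + s * e < beta) ->
  closure (Lambda beta) (polar t th).
Proof.
have [hpi hb0 hb2] := beta_bounds.
move=> t0 H B nB.
have cf : continuous (fun e : R => polar (t + e) (th + s * e)).
  move=> e; apply: (@continuous_comp _ _ _ (fun e : R => (t + e, th + s * e)) (fun p => polar p.1 p.2)); last exact: continuous_polar.
  have c1 : {for e, continuous (fun e : R => t + e)}.
    by apply: cvgD; [exact: cvg_cst|exact: cvg_id].
  have c2 : {for e, continuous (fun e : R => th + s * e)}.
    apply: cvgD; first exact: cvg_cst.
    by apply: cvgM; [exact: cvg_cst|exact: cvg_id].
  exact: (cvg_pair c1 c2).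
have nB' : nbhs (0 : R) ((fun e : R => polar (t + e) (th + s * e)) @^-1` B).
  by apply: (cf 0); rewrite addr0 mulr0 addr0.
have [e /= e0 sub] := (nbhs_ballP _ _).1 nB'.
pose e1 := Num.min (e / 2) (beta / 2).
have e10 : 0 < e1 by rewrite lt_min !divr_gt0.
have e1e : e1 < e by rewrite /e1 gt_min; apply/orP; left; lra.
have e1b : e1 < beta by rewrite /e1 gt_min; apply/orP; right; lra.
exists (polar (t + e1) (th + s * e1)); split.
  exists (t + e1), (th + s * e1); split; first lra.
  by split => //; exact: H.
by apply: sub; rewrite /ball/= sub0r normrN gtr0_norm.
Qed.

(** A limit point of the sector outside it either misses the slit plane, hence lies on the positive
    half-axis, or has angle exactly [beta], since angles beyond [beta] form an open condition. *)
Lemma bdry_Lambda : bdry (Lambda beta) = rays.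
Proof.
have [hpi hb0 hb2] := beta_bounds.
have -> : bdry (Lambda beta) = closure (Lambda beta) `\` Lambda beta.
  by rewrite /bdry; have /interior_id -> := open_Lambda.
apply/seteqP; split => p; last first.
  move=> rp; split; last exact: rays_notin_Lambda.
  case: rp => [[t /= t0 <-]|[t /= t0 <-]].
    by apply: (closure_Lambda_polar t 0 1 t0) => e e0 eb; rewrite mul1r add0r e0.
  apply: (closure_Lambda_polar t beta (-1) t0) => e e0 eb; rewrite mulN1r.
  by apply/andP; split; lra.
move=> [cp nL].
have [sp|nsp] := pselect (slit p); last first.
  left; exists (nrm p); first exact: nrm_ge0.
  by rewrite [RHS](nonslit p nsp) /polar cos0 sin0 mulr1 mulr0.
have [ab|ab|ab] := ltgtP (arg p) beta.
- by exfalso; apply: nL; rewrite LambdaE.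
- exfalso.
  have nb : nbhs p [set q | slit q /\ beta < arg q].
    near=> q; split.
      by near: q; apply: open_nbhs_nbhs; split => //; exact: open_slit.
    near: q; have := continuous_arg p sp; move=> /(_ [set x | beta < x]); apply.
    exact: lt_nbhsr.
  have [q [Lq [_ bq]]] := cp _ nb.
  by move: Lq; rewrite LambdaE => -[_]; rewrite ltNge ltW.
- right; exists (nrm p); first exact: nrm_ge0.
  by rewrite -ab -polar_arg.
Unshelve. all: by end_near. Qed.

Let S := bdry (Lambda beta).

Lemma bdry_Lambda0 : S (0, 0).
Proof. by rewrite /S bdry_Lambda; left; exists 0 => //=; rewrite /polar !mul0r. Qed.

Lemma bdry_Lambda_neq0 : S !=set0.
Proof. by exists (0, 0); exact: bdry_Lambda0. Qed.

Lemma dist_Lambda_gt0 p : Lambda beta p -> 0 < dist_set p S.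
Proof.
move=> Lp; apply: (dist_set_gt0 _ _ _ open_Lambda Lp bdry_Lambda_neq0) => q.
by rewrite /S bdry_Lambda; exact: rays_notin_Lambda.
Qed.

Lemma dist_Lambda_polar (rho th : R) : 0 < rho ->
  dist_set (polar rho th) S = rho * dist_set (polar 1 th) S.
Proof.
have half (k rho1 th1 : R) : 0 < k -> 0 < rho1 ->
    dist_set (polar (k * rho1) th1) S <= k * dist_set (polar rho1 th1) S.
  move=> k0 rho0; apply: dist_set_scale => //; first exact: bdry_Lambda_neq0.
  rewrite /S bdry_Lambda => q qr.
  have [t [phi [t0 hphi ->]]] : exists t phi, [/\ 0 <= t, (phi = 0 \/ phi = beta) & q = polar t phi].
    by case: qr => [[t t0 <-]|[t t0 <-]]; [exists t, 0|exists t, beta]; split => //; [left|right].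
  exists (polar (k * t) phi).
    by case: hphi => ->; [left|right]; exists (k * t) => //=; rewrite mulr_ge0// ltW.
  rewrite !edist_polar.
  have -> : (k * rho1) ^+ 2 + (k * t) ^+ 2 - 2 * (k * rho1 * (k * t)) * cos (th1 - phi) =
    k ^+ 2 * (rho1 ^+ 2 + t ^+ 2 - 2 * (rho1 * t) * cos (th1 - phi)) by ring.
  by rewrite sqrtrM ?sqr_ge0// sqrtr_sqr gtr0_norm.
move=> r0; apply/eqP; rewrite eq_le; apply/andP; split.
  by have := half rho 1 th r0 ltr01; rewrite mulr1.
have := half rho^-1 rho th; rewrite invr_gt0 mulVf ?gt_eqF// => /(_ r0 r0).
by rewrite ler_pdivlMl.
Qed.

Lemma dist_Lambda_sym (rho th : R) :
  dist_set (polar rho (beta - th)) S = dist_set (polar rho th) S.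
Proof.
have half th1 : dist_set (polar rho (beta - th1)) S <= dist_set (polar rho th1) S.
  rewrite -[leRHS]mul1r; apply: dist_set_scale => //; first exact: bdry_Lambda_neq0.
  rewrite /S bdry_Lambda => q [[t t0 <-]|[t t0 <-]].
    exists (polar t beta); first by right; exists t.
    rewrite mul1r !edist_polar; have -> : beta - th1 - beta = - th1 by ring.
    by rewrite cosN subr0.
  exists (polar t 0); first by left; exists t.
  rewrite mul1r !edist_polar subr0; have -> : beta - th1 = - (th1 - beta) by ring.
  by rewrite cosN.
apply/eqP; rewrite eq_le half/=.
by have := half (beta - th); have -> : beta - (beta - th) = th by ring.
Qed.

Lemma dist_Lambda_le_nrm p : dist_set p S <= nrm p.
Proof. by rewrite -edist_nrm; apply: dist_set_le; exact: bdry_Lambda0. Qed.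

Section truncated.
Variable r : R -> R.
Hypotheses (r0 : 0 < r 0) (rb : 0 < r beta).

Lemma Gamma0_origin : Gamma0 beta r (0, 0).
Proof. by left; exists 0 => //=; rewrite lexx ltW. Qed.

Lemma Gamma0_neq0 : Gamma0 beta r !=set0.
Proof. by exists (0, 0); exact: Gamma0_origin. Qed.

Lemma Gamma0_sub_bdry : Gamma0 beta r `<=` S.
Proof.
rewrite /S bdry_Lambda => q [[t /= /andP[t0 _] <-]|[t /= /andP[t0 _] <-]].
  by left; exists t => //; rewrite /polar cos0 sin0 mulr1 mulr0.
by right; exists t.
Qed.

Lemma dist_Lambda_le_Gamma0 p : dist_set p S <= dist_set p (Gamma0 beta r).
Proof. by apply: dist_setS; [exact: Gamma0_neq0|exact: Gamma0_sub_bdry]. Qed.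

(* Points of the rays outside [Gamma0] are farther from [p] than the origin is. *)
Lemma dist_Gamma0_near0 p : 2 * nrm p < Num.min (r 0) (r beta) ->
  dist_set p (Gamma0 beta r) = dist_set p S.
Proof.
rewrite lt_min => /andP[p0 pb]; apply/eqP; rewrite eq_le dist_Lambda_le_Gamma0 andbT.
apply: le_dist_set; first exact: bdry_Lambda_neq0.
have far t th m : 0 <= t -> m < t -> 2 * nrm p < m ->
    dist_set p (Gamma0 beta r) <= edist p (polar t th).
  move=> t0 mt pm; apply: (@le_trans _ _ (nrm p)).
    by rewrite -edist_nrm; apply: dist_set_le; exact: Gamma0_origin.
  have := edist_triangle (polar t th) p (0, 0).
  by rewrite !edist_nrm nrm_polar ger0_norm// edistC; lra.
rewrite /S bdry_Lambda => q [[t /= t0 <-]|[t /= t0 <-]].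
  have [tr|tr] := leP t (r 0); last exact: far tr p0.
  apply: dist_set_le; left; exists t; first by rewrite /= t0.
  by rewrite /polar cos0 sin0 mulr1 mulr0.
have [tr|tr] := leP t (r beta); last exact: far tr pb.
by apply: dist_set_le; right; exists t; rewrite //= t0.
Qed.

End truncated.
End sector.

(** * Test functions in separated variables *)

Section smooth2_theory.
Context {R : realType}.
Implicit Types (u : R * R -> R) (p : R * R).

Lemma iter_partial_rcons s b u :
  iter_partial (rcons s b) u = iter_partial s ((if b then @dx R else @dy R) u).
Proof. by elim: s => [|c s IH] //=; rewrite IH. Qed.

Lemma smooth2_dx u : smooth2 u -> smooth2 (dx u).
Proof. by move=> su s; have := su (rcons s true); rewrite iter_partial_rcons. Qed.

Lemma smooth2_dy u : smooth2 u -> smooth2 (dy u).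
Proof. by move=> su s; have := su (rcons s false); rewrite iter_partial_rcons. Qed.

Lemma smooth2_continuous u : smooth2 u -> continuous u.
Proof. by move=> /(_ [::])[]. Qed.

Lemma smooth2_is_derive_fst u p : smooth2 u ->
  is_derive p.1 (1 : R) (fun t => u (t, p.2)) (dx u p).
Proof. by move=> /(_ [::])[_ /(_ p)[h _]]; split => //; rewrite /dx derive1E. Qed.

Lemma smooth2_is_derive_snd u p : smooth2 u ->
  is_derive p.2 (1 : R) (fun t => u (p.1, t)) (dy u p).
Proof. by move=> /(_ [::])[_ /(_ p)[_ h]]; split => //; rewrite /dy derive1E. Qed.

Lemma is_derive_continuous_at (f : R -> R) (x l : R) :
  is_derive x (1 : R) f l -> {for x, continuous f}.
Proof. by move=> [df _]; apply/differentiable_continuous/derivable1_diffP. Qed.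

(** Completing the quotient by the partial derivative at [x = x0] makes [slopeE] hold without
    exception, in particular where the curve has a stationary abscissa. *)
Let slope u (x0 x y : R) : R :=
  if x == x0 then dx u (x0, y) else (u (x, y) - u (x0, y)) / (x - x0).

Let slopeE u x0 x y : u (x, y) - u (x0, y) = slope u x0 x y * (x - x0).
Proof.
rewrite /slope; case: eqP => [->|/eqP xx]; first by rewrite !subrr mulr0.
by rewrite divfK// subr_eq0.
Qed.

Let slope_mvt u (x0 x y : R) : smooth2 u ->
  exists2 xi, `|xi - x0| <= `|x - x0| & slope u x0 x y = dx u (xi, y).
Proof.
move=> su; rewrite /slope; case: eqP => [->|/eqP xx]; first by exists x0; rewrite ?subrr.
have der z : is_derive z (1 : R) (fun t => u (t, y)) (dx u (z, y)).
  exact: (smooth2_is_derive_fst u (z, y) su).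
have cont (a b : R) : {within `[a, b], continuous (fun t => u (t, y))}.
  by apply: continuous_subspaceT => z; exact: is_derive_continuous_at (der z).
have xx0 : x - x0 != 0 by rewrite subr_eq0.
have [lt|gt|e] := ltgtP x x0; last by rewrite e eqxx in xx.
- have [c] := MVT lt (fun z _ => der z) (cont _ _).
  rewrite in_itv/= => /andP[c1 c2] e; exists c.
    by rewrite !ltr0_norm ?subr_lt0//; lra.
  have -> : u (x, y) - u (x0, y) = dx u (c, y) * (x - x0) by move: e => /=; lra.
  by rewrite mulfK.
- have [c] := MVT gt (fun z _ => der z) (cont _ _).
  rewrite in_itv/= => /andP[c1 c2] e; exists c.
    by rewrite !gtr0_norm ?subr_gt0//; lra.
  have -> : u (x, y) - u (x0, y) = dx u (c, y) * (x - x0) by move: e => /=; lra.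
  by rewrite mulfK.
Qed.

(** [smooth2] provides continuous partial derivatives but no differential. The increment is
    therefore split: the vertical part is a chain rule in one variable, the horizontal one is a
    [slope], controlled by the mean value theorem and the continuity of [dx u]. *)
Lemma is_derive_curve u (X Y : R -> R) (t X' Y' : R) : smooth2 u ->
  is_derive t (1 : R) X X' -> is_derive t (1 : R) Y Y' ->
  is_derive t (1 : R) (fun s => u (X s, Y s))
    (dx u (X t, Y t) * X' + dy u (X t, Y t) * Y').
Proof.
move=> su dX dY.
have cX := is_derive_continuous_at _ _ _ dX.
have cY := is_derive_continuous_at _ _ _ dY.
have d2 : is_derive t (1 : R) (fun s => u (X t, Y s)) (dy u (X t, Y t) * Y').
  exact: (@is_derive1_comp _ (fun y => u (X t, y)) Y t _ _ (smooth2_is_derive_snd u (X t, Y t) su) dY).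
have cslope : slope u (X t) (X s) (Y s) @[s --> t] --> dx u (X t, Y t).
  apply/cvgrPdist_lt => /= e e0.
  have /nbhs_ballP[d /= d0 sub] :
      nbhs (X t, Y t) [set q | `|dx u (X t, Y t) - dx u q| < e].
    exact: ((cvgrPdist_lt _ _).1 (smooth2_continuous _ (smooth2_dx _ su) (X t, Y t))).
  near=> s.
  have [xi xile ->] := slope_mvt u (X t) (X s) (Y s) su.
  apply: sub; split; rewrite /ball/=.
    rewrite distrC; apply: le_lt_trans xile _.
    by rewrite distrC; near: s; exact: ((cvgrPdist_lt _ _).1 cX).
  by near: s; exact: ((cvgrPdist_lt _ _).1 cY).
have shift (f : R -> R) (l : R) : f s @[s --> t] --> l -> f (h *: (1 : R) + t) @[h --> 0^'] --> l.
  move=> fl; apply: (@cvg_comp _ _ _ (fun h : R => h *: (1 : R) + t) f _ (nbhs t)) => //.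
  apply/cvgrPdist_lt => /= e e0; near=> h.
  rewrite -[h%:A]/(h * 1) mulr1 opprD addrCA subrr addr0 normrN.
  by near: h; exact: dnbhs0_lt.
have q1 : slope u (X t) (X (h *: (1 : R) + t)) (Y (h *: (1 : R) + t)) *
   (h^-1 *: (X (h *: (1 : R) + t) - X t)) @[h --> 0^'] --> dx u (X t, Y t) * X'.
  apply: cvgM; first exact: (shift _ _ cslope).
  by case: dX => dX <-; exact: dX.
have q2 : h^-1 *: (u (X t, Y (h *: (1 : R) + t)) - u (X t, Y t)) @[h --> 0^'] --> dy u (X t, Y t) * Y'.
  by case: d2 => d2 <-; exact: d2.
have key : h^-1 *: (u (X (h *: (1 : R) + t), Y (h *: (1 : R) + t)) - u (X t, Y t)) @[h --> 0^'] -->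
    dx u (X t, Y t) * X' + dy u (X t, Y t) * Y'.
  refine (cvg_trans (near_eq_cvg _) (cvgD q1 q2)); near=> h.
  rewrite -[LHS]/(slope u (X t) (X (h * 1 + t)) (Y (h * 1 + t)) * (h^-1 * (X (h * 1 + t) - X t)) +
    h^-1 * (u (X t, Y (h * 1 + t)) - u (X t, Y t))).
  rewrite -[RHS]/(h^-1 * (u (X (h * 1 + t), Y (h * 1 + t)) - u (X t, Y t))).
  set a := X (h * 1 + t); set b := Y (h * 1 + t).
  have -> : u (a, b) - u (X t, Y t) = slope u (X t) a b * (a - X t) + (u (X t, b) - u (X t, Y t)).
    by rewrite -slopeE; ring.
  ring.
by split; [apply/cvg_ex; exists (dx u (X t, Y t) * X' + dy u (X t, Y t) * Y')|exact/cvg_lim].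
Unshelve. all: by end_near. Qed.

Lemma Cn_curve n u (X Y : R -> R) : smooth2 u -> smooth1 X -> smooth1 Y ->
  Cn n (fun s => u (X s, Y s)).
Proof.
elim: n u => [//|n IH] u su sX sY.
have [X' dX sX'] := smooth1_derive _ sX; have [Y' dY sY'] := smooth1_derive _ sY.
exists (fun t => dx u (X t, Y t) * X' t + dy u (X t, Y t) * Y' t); split => [t|].
  exact: is_derive_curve.
apply: CnD; apply: CnM => //.
- by apply: IH => //; exact: smooth2_dx.
- by apply: IH => //; exact: smooth2_dy.
Qed.

(** The gradient splits orthogonally into a tangential part, which is [g' / rho], and the radial
    part [a * cos th + b * sin th], whose square is dropped. *)
Lemma angular_slice u (rho : R) : smooth2 u ->
  exists g', [/\ smooth1 (fun th => u (polar rho th)), smooth1 g',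
    (forall th, is_derive th (1 : R) (fun th => u (polar rho th)) (g' th)) &
    (forall th, g' th ^+ 2 <= rho ^+ 2 * grad_sq u (polar rho th))].
Proof.
move=> su.
have sX : smooth1 (fun th : R => rho * cos th).
  by move=> n; apply: CnM; [exact: Cn_cst|exact: Cn_cos].
have sY : smooth1 (fun th : R => rho * sin th).
  by move=> n; apply: CnM; [exact: Cn_cst|exact: Cn_sin].
have sg : smooth1 (fun th => u (polar rho th)) by move=> n; exact: Cn_curve.
have [g' dg sg'] := smooth1_derive _ sg; exists g'; split => // th.
have dX : is_derive th (1 : R) (fun th => rho * cos th) (rho * - sin th).
  exact: (is_deriveZ rho (is_derive_cos th)).
have dY : is_derive th (1 : R) (fun th => rho * sin th) (rho * cos th).
  exact: (is_deriveZ rho (is_derive_sin th)).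
have -> : g' th = dx u (polar rho th) * (rho * - sin th) + dy u (polar rho th) * (rho * cos th).
  have d1 := dg th; have d2 := is_derive_curve _ _ _ _ _ _ su dX dY.
  by rewrite -(@derive_val _ _ _ _ _ _ _ d1) -(@derive_val _ _ _ _ _ _ _ d2).
rewrite /grad_sq; set a := dx u _; set b := dy u _.
have -> : (a * (rho * - sin th) + b * (rho * cos th)) ^+ 2 =
  rho ^+ 2 * ((a ^+ 2 + b ^+ 2) * (cos th ^+ 2 + sin th ^+ 2) - (a * cos th + b * sin th) ^+ 2) by ring.
rewrite cos2Dsin2 mulr1; apply: ler_wpM2l; first exact: sqr_ge0.
by rewrite lerBlDr lerDl sqr_ge0.
Qed.

End smooth2_theory.

(** * Smoothness and support of products in polar coordinates *)

Section polar_prod.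
Context {R : realType}.
Variables (beta N delta : R).
Hypotheses (hbeta : pi < beta <= 2 * pi) (delta0 : 0 < delta).
Implicit Types (a b : R -> R) (p : R * R).

(* [a] is a function of the logarithm of the radius: [exp(-t)] is then smooth on
   the whole line, so products [a(t) b(th)] are stable under [dx] and [dy]. *)
Definition polar_prod a b p : R :=
  if p \in Lambda beta then a (ln (nrm p)) * b (arg p) else 0.

Definition log_supported a := forall t, N < `|t| -> a t = 0.
Definition angle_supported b :=
  forall th, 0 < th < beta -> th < delta \/ beta - delta < th -> b th = 0.

(** A partial derivative of one product is a sum of two products, so it is the class of sums that is
    stable under [dx] and [dy]; this yields all iterated derivatives at once. *)
Inductive separated_span : (R * R -> R) -> Prop :=
| span_separated a b : smooth1 a -> smooth1 b -> log_supported a ->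
    angle_supported b -> separated_span (polar_prod a b)
| span_add f g : separated_span f -> separated_span g ->
    separated_span (fun p => f p + g p).

Definition log_box : set (R * R) :=
  [set polar (expR q.1) q.2 | q in `[- N, N] `*` `[delta, beta - delta]].

Lemma compact_log_box : compact log_box.
Proof.
apply: continuous_compact; last by apply: compact_setX; exact: segment_compact.
apply: continuous_subspaceT => q.
have c1 : {for q, continuous (fun q : R * R => expR q.1)}.
  by apply: (@continuous_comp _ _ _ fst expR); [exact: continuous_fst2|exact: continuous_expR].
have c2 := continuous_snd2 q.
apply: (@continuous_comp _ _ _ (fun q : R * R => (expR q.1, q.2)) (fun p => polar p.1 p.2)).
  exact: (cvg_pair c1 c2).
exact: continuous_polar.
Qed.

Lemma log_box_sub : log_box `<=` Lambda beta.
Proof.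
move=> _ [[t th] [/= _ +] <-]; rewrite in_itv/= => /andP[h1 h2].
exists (expR t), th; split; first exact: expR_gt0.
by split => //; have d0 := delta0; apply/andP; split; lra.
Qed.

Lemma separated_eq0 a b p : log_supported a -> angle_supported b ->
  ~ log_box p -> polar_prod a b p = 0.
Proof.
move=> sa sb np; rewrite /polar_prod; case: ifPn => //; rewrite inE LambdaE// => -[sp ab].
have [Nt|tN] := ltP N `|ln (nrm p)|; first by rewrite sa// mul0r.
have /andP[a0 _] := arg_bounds p.
have habs : 0 < arg p < beta by rewrite a0.
have [ad|ad] := ltP (arg p) delta; first by rewrite sb ?mulr0//; left.
have [bd|bd] := ltP (beta - delta) (arg p); first by rewrite sb ?mulr0//; right.
exfalso; apply: np; exists (ln (nrm p), arg p).
  by split; rewrite /= in_itv/= ?ad// -ler_norml.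
by rewrite /= lnK ?posrE ?slit_nrm_gt0// -polar_arg.
Qed.

(** By compactness the complement of [log_box] is a neighbourhood of every point outside the sector,
    including the vertex and the slit, where [ln (nrm p)] and [arg p] are not smooth. *)
Lemma near_separated0 a b p : log_supported a -> angle_supported b ->
  ~ Lambda beta p -> \forall q \near p, polar_prod a b q = 0.
Proof.
move=> sa sb nL; have op : open (~` log_box).
  by rewrite openC; apply: compact_closed; [exact: norm_hausdorff|exact: compact_log_box].
have np : (~` log_box) p by move=> /log_box_sub.
have : nbhs p (~` log_box) by exact: open_nbhs_nbhs.
by apply: filterS => q nq; exact: separated_eq0.
Qed.

Lemma near_fst (P : R * R -> Prop) p : (\forall q \near p, P q) ->
  \forall t \near p.1, P (t, p.2).
Proof.
move=> nP; have c : {for p.1, continuous (fun t : R => (t, p.2))}.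
  by apply: (cvg_pair (@cvg_id _ (nbhs p.1)) (cvg_cst p.2)).
by apply: c; rewrite /= -surjective_pairing.
Qed.

Lemma near_snd (P : R * R -> Prop) p : (\forall q \near p, P q) ->
  \forall t \near p.2, P (p.1, t).
Proof.
move=> nP; have c : {for p.2, continuous (fun t : R => (p.1, t))}.
  by apply: (cvg_pair (cvg_cst p.1) (@cvg_id _ (nbhs p.2))).
by apply: c; rewrite /= -surjective_pairing.
Qed.

Lemma near_Lambda p : Lambda beta p -> \forall q \near p, Lambda beta q.
Proof. by move=> Lp; apply: open_nbhs_nbhs; split => //; exact: open_Lambda. Qed.

Lemma continuous_separated a b : smooth1 a -> smooth1 b -> log_supported a ->
  angle_supported b -> continuous (polar_prod a b).
Proof.
move=> sa sb la ab p.
have [Lp|nL] := pselect (Lambda beta p); last first.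
  have e : polar_prod a b p = 0 by rewrite /polar_prod ifF//; apply/negbTE; rewrite notin_setE.
  have := near_separated0 a b p la ab nL; rewrite /continuous_at e => h.
  by apply/cvgrPdist_lt => /= eps eps0; apply: filterS h => q ->; rewrite subrr normr0.
have [sp _] : slit p /\ arg p < beta by move: Lp; rewrite LambdaE.
have e : polar_prod a b p = a (ln (nrm p)) * b (arg p) by rewrite /polar_prod mem_set.
rewrite /continuous_at e.
have c : a (ln (nrm q)) * b (arg q) @[q --> p] --> a (ln (nrm p)) * b (arg p).
  apply: cvgM.
    apply: (@continuous_comp _ _ _ (fun q => ln (nrm q)) a); last exact: smooth1_continuous.
    apply: (@continuous_comp _ _ _ nrm (@ln R)); first exact: continuous_nrm.
    by apply: continuous_ln; exact: slit_nrm_gt0.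
  apply: (@continuous_comp _ _ _ arg b); last exact: smooth1_continuous.
  exact: continuous_arg.
apply: cvg_trans c; apply: near_eq_cvg; apply: filterS (near_Lambda p Lp) => q Lq.
by rewrite /polar_prod mem_set.
Qed.

(** With [t = ln rho], the derivative along the first axis is [exp(-t)] times [cos th] times the
    [t]-derivative minus [sin th] times the [th]-derivative; [polar_dy] is its companion. *)
Definition polar_dx a a' b b' : R * R -> R := fun p =>
  polar_prod (fun t => a' t * expR (- t)) (fun th => b th * cos th) p +
  polar_prod (fun t => - (a t * expR (- t))) (fun th => b' th * sin th) p.

Definition polar_dy a a' b b' : R * R -> R := fun p =>
  polar_prod (fun t => a' t * expR (- t)) (fun th => b th * sin th) p +
  polar_prod (fun t => a t * expR (- t)) (fun th => b' th * cos th) p.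

Let polar_nrm_arg p : slit p ->
  [/\ p.1 = nrm p * cos (arg p), p.2 = nrm p * sin (arg p) & expR (- ln (nrm p)) = (nrm p)^-1].
Proof.
move=> sp; have e := polar_arg p sp; split.
- by rewrite {1}e.
- by rewrite {1}e.
- by rewrite expRN lnK// posrE slit_nrm_gt0.
Qed.

Let separated_out a b p : ~ Lambda beta p -> polar_prod a b p = 0.
Proof. by move=> nL; rewrite /polar_prod ifF//; apply/negbTE; rewrite notin_setE. Qed.

Lemma is_derive_separated_fst a a' b b' p :
  (forall t, is_derive t (1 : R) a (a' t)) -> (forall t, is_derive t (1 : R) b (b' t)) ->
  log_supported a -> angle_supported b ->
  is_derive p.1 (1 : R) (fun t => polar_prod a b (t, p.2)) (polar_dx a a' b b' p).
Proof.
move=> da db la ab.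
have [Lp|nL] := pselect (Lambda beta p); last first.
  rewrite /polar_dx !separated_out// addr0.
  apply: (near_eq_is_derive _ (@is_derive_cst R R R 0 p.1 1)).
  by apply: filterS (near_fst _ p (near_separated0 a b p la ab nL)) => t ->.
have [sp _] : slit p /\ arg p < beta by move: Lp; rewrite LambdaE.
have [e1 e2 e3] := polar_nrm_arg p sp; have n0 := slit_nrm_gt0 p sp.
have ep : (p.1, p.2) = p by rewrite -surjective_pairing.
have d1 := @is_derive1_comp _ a (fun t => ln (nrm (t, p.2))) p.1 _ _ (da _) (is_derive_ln_nrm_fst p sp).
have d2 := @is_derive1_comp _ b (fun t => arg (t, p.2)) p.1 _ _ (db _) (is_derive_arg_fst p sp).
have d := is_deriveM d1 d2.
apply: (near_eq_is_derive _ (is_derive_eq d _)).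
  by apply: filterS (near_fst _ p (near_Lambda p Lp)) => t Lt; rewrite /polar_prod mem_set.
rewrite /= ep /polar_dx /polar_prod mem_set// -![_ *: _]/(_ * _) e3.
rewrite {1}e1 {1}e2; field; by rewrite gt_eqF.
Qed.

Lemma is_derive_separated_snd a a' b b' p :
  (forall t, is_derive t (1 : R) a (a' t)) -> (forall t, is_derive t (1 : R) b (b' t)) ->
  log_supported a -> angle_supported b ->
  is_derive p.2 (1 : R) (fun t => polar_prod a b (p.1, t)) (polar_dy a a' b b' p).
Proof.
move=> da db la ab.
have [Lp|nL] := pselect (Lambda beta p); last first.
  rewrite /polar_dy !separated_out// addr0.
  apply: (near_eq_is_derive _ (@is_derive_cst R R R 0 p.2 1)).
  by apply: filterS (near_snd _ p (near_separated0 a b p la ab nL)) => t ->.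
have [sp _] : slit p /\ arg p < beta by move: Lp; rewrite LambdaE.
have [e1 e2 e3] := polar_nrm_arg p sp; have n0 := slit_nrm_gt0 p sp.
have ep : (p.1, p.2) = p by rewrite -surjective_pairing.
have d1 := @is_derive1_comp _ a (fun t => ln (nrm (p.1, t))) p.2 _ _ (da _) (is_derive_ln_nrm_snd p sp).
have d2 := @is_derive1_comp _ b (fun t => arg (p.1, t)) p.2 _ _ (db _) (is_derive_arg_snd p sp).
have d := is_deriveM d1 d2.
apply: (near_eq_is_derive _ (is_derive_eq d _)).
  by apply: filterS (near_snd _ p (near_Lambda p Lp)) => t Lt; rewrite /polar_prod mem_set.
rewrite /= ep /polar_dy /polar_prod mem_set// -![_ *: _]/(_ * _) e3.
rewrite {1}e1 {1}e2; field; by rewrite gt_eqF.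
Qed.

Let log_supported_derive a a' : (forall t, is_derive t (1 : R) a (a' t)) ->
  log_supported a -> log_supported a'.
Proof.
move=> da la t Nt; apply: (derive_eq0_on_open a a' [set t | N < `|t|] t) => //.
have -> : [set t : R | N < `|t|] = Num.norm @^-1` [set x | N < x] by [].
by apply: open_comp => [x _|]; [exact: norm_continuous|exact: open_gt].
Qed.

Let angle_supported_derive b b' : (forall t, is_derive t (1 : R) b (b' t)) ->
  angle_supported b -> angle_supported b'.
Proof.
move=> db ab th /andP[h1 h2] h.
pose A : set R := `]0, beta[ `&` (`]-oo, delta[ `|` `]beta - delta, +oo[).
apply: (derive_eq0_on_open b b' A th) => //.
- by apply: openI; [exact: interval_open|apply: openU; exact: interval_open].
- split; first by rewrite /= in_itv/= h1.
  by case: h => h; [left|right]; rewrite /= in_itv/= ?andbT.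
- move=> y [/=]; rewrite !in_itv/= => hy [|]; rewrite ?andbT => h'; apply: ab => //; [left|right] => //.
Qed.

Lemma separated_span_derive f : separated_span f ->
  [/\ continuous f, (exists2 f1, separated_span f1 &
        forall p, is_derive p.1 (1 : R) (fun t => f (t, p.2)) (f1 p)) &
      (exists2 f2, separated_span f2 &
        forall p, is_derive p.2 (1 : R) (fun t => f (p.1, t)) (f2 p))].
Proof.
elim => [a b sa sb la ab|g h sg [cg [g1 sg1 dg1] [g2 sg2 dg2]] sh [ch [h1 sh1 dh1] [h2 sh2 dh2]]].
  have [a' da sa'] := smooth1_derive _ sa; have [b' db sb'] := smooth1_derive _ sb.
  have la' := log_supported_derive _ _ da la.
  have ab' := angle_supported_derive _ _ db ab.
  have sE (c : R -> R) : smooth1 c -> smooth1 (fun t => c t * expR (- t)).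
    move=> sc n; apply: CnM => //; apply: (Cn_comp n expR (fun t => - t)); first exact: Cn_expR.
    by apply: CnN; exact: Cn_id.
  have lE (c : R -> R) : log_supported c -> log_supported (fun t => c t * expR (- t)).
    by move=> lf t Nt; rewrite lf// mul0r.
  have aE (d c : R -> R) : angle_supported d -> angle_supported (fun t => d t * c t).
    by move=> lf t h1 h2; rewrite lf// mul0r.
  split; first exact: continuous_separated.
    exists (polar_dx a a' b b'); last by move=> p; exact: is_derive_separated_fst.
    apply: span_add; apply: span_separated.
    - exact: sE.
    - by move=> n; apply: CnM => //; exact: Cn_cos.
    - exact: lE.
    - exact: aE.
    - by move=> n; apply: CnN; exact: sE.
    - by move=> n; apply: CnM => //; exact: Cn_sin.
    - by move=> t Nt; rewrite (lE _ la)// oppr0.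
    - exact: aE.
  exists (polar_dy a a' b b'); last by move=> p; exact: is_derive_separated_snd.
  apply: span_add; apply: span_separated.
  - exact: sE.
  - by move=> n; apply: CnM => //; exact: Cn_sin.
  - exact: lE.
  - exact: aE.
  - exact: sE.
  - by move=> n; apply: CnM => //; exact: Cn_cos.
  - exact: lE.
  - exact: aE.
split.
- by move=> p; apply: cvgD; [exact: cg|exact: ch].
- exists (fun p => g1 p + h1 p); first exact: span_add.
  by move=> p; have := is_deriveD (dg1 p) (dh1 p).
- exists (fun p => g2 p + h2 p); first exact: span_add.
  by move=> p; have := is_deriveD (dg2 p) (dh2 p).
Qed.

Lemma dx_eq (f f1 : R * R -> R) :
  (forall p, is_derive p.1 (1 : R) (fun t => f (t, p.2)) (f1 p)) -> dx f = f1.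
Proof. by move=> d; apply/funext => p; rewrite /dx derive1E (@derive_val _ _ _ _ _ _ _ (d p)). Qed.

Lemma dy_eq (f f1 : R * R -> R) :
  (forall p, is_derive p.2 (1 : R) (fun t => f (p.1, t)) (f1 p)) -> dy f = f1.
Proof. by move=> d; apply/funext => p; rewrite /dy derive1E (@derive_val _ _ _ _ _ _ _ (d p)). Qed.

Lemma smooth2_separated_span f : separated_span f -> smooth2 f.
Proof.
move=> sf s; have : separated_span (iter_partial s f).
  elim: s => [//|b s IH] /=.
  have [_ [f1 s1 d1] [f2 s2 d2]] := separated_span_derive _ IH.
  by case: b; [rewrite (dx_eq _ _ d1)|rewrite (dy_eq _ _ d2)].
move=> /separated_span_derive[c [f1 _ d1] [f2 _ d2]]; by split => // p.
Qed.

Lemma Cc_infty_separated a b : smooth1 a -> smooth1 b -> log_supported a ->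
  angle_supported b -> Cc_infty (Lambda beta) (polar_prod a b).
Proof.
move=> sa sb la ab; split; first exact/smooth2_separated_span/span_separated.
exists log_box; split; first exact: compact_log_box.
by split; [exact: log_box_sub|move=> p; exact: separated_eq0].
Qed.

Lemma separated_polar a b (rho th : R) : 0 < rho -> 0 < th < beta ->
  polar_prod a b (polar rho th) = a (ln rho) * b th.
Proof.
move=> r0 /andP[h1 h2]; have /andP[_ b2] := hbeta.
have hth : 0 < th < 2 * pi by rewrite h1; exact: lt_le_trans h2 b2.
rewrite /polar_prod mem_set; last by exists rho, th; rewrite h1 h2.
by rewrite nrm_polar gtr0_norm// arg_polar.
Qed.

Lemma grad_sq_separated a a' b b' (rho th : R) :
  (forall t, is_derive t (1 : R) a (a' t)) -> (forall t, is_derive t (1 : R) b (b' t)) ->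
  log_supported a -> angle_supported b -> 0 < rho -> 0 < th < beta ->
  grad_sq (polar_prod a b) (polar rho th) =
  rho ^- 2 * (a' (ln rho) ^+ 2 * b th ^+ 2 + a (ln rho) ^+ 2 * b' th ^+ 2).
Proof.
move=> da db la ab r0 hth; rewrite /grad_sq.
rewrite (dx_eq _ _ (fun p => is_derive_separated_fst _ _ _ _ p da db la ab)).
rewrite (dy_eq _ _ (fun p => is_derive_separated_snd _ _ _ _ p da db la ab)).
rewrite /polar_dx /polar_dy !separated_polar// expRN lnK ?posrE//.
have h1 : sin th ^+ 2 = 1 - cos th ^+ 2 by rewrite sin2cos2.
set A' := a' _; set A := a _; set B := b _; set B' := b' _.
have -> : forall r s c : R, (A' * r * (B * c) + - (A * r) * (B' * s)) ^+ 2 +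
  (A' * r * (B * s) + A * r * (B' * c)) ^+ 2 =
  r ^+ 2 * (A' ^+ 2 * B ^+ 2 + A ^+ 2 * B' ^+ 2) * (c ^+ 2 + s ^+ 2).
  by move=> r s c; ring.
by rewrite cos2Dsin2 mulr1 exprVn.
Qed.

End polar_prod.

(** * Integrals over the sector and the radial cutoff *)

Section sector_integrals.
Context {R : realType}.
Local Notation mu := (@lebesgue_measure R).

Lemma measurable_invr : measurable_fun setT (fun x : R => x^-1).
Proof.
have o0 : open [set~ (0 : R)] by rewrite openC; exact: closed_eq.
have m0 : measurable [set~ (0 : R)] by exact: open_measurable.
rewrite -(setUv [set (0 : R)]); apply/measurable_funU; [exact: measurable_set1|by []|split].
  exact: measurable_fun_set1.
apply: open_continuous_measurable_fun => // x; rewrite inE/= => /eqP x0.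
exact: inv_continuous.
Qed.

Lemma integral_prod_fun (D1 D2 : set R) (f g : R -> R) : measurable D1 -> measurable D2 ->
  measurable_fun setT f -> measurable_fun setT g ->
  (forall x, 0 <= f x) -> (forall x, 0 <= g x) ->
  (\int[mu]_(x in D1) \int[mu]_(y in D2) (f x * g y)%:E =
   (\int[mu]_(x in D1) (f x)%:E) * (\int[mu]_(y in D2) (g y)%:E))%E.
Proof.
move=> mD1 mD2 mf mg f0 g0.
have mg' : measurable_fun D2 (EFin \o g) by apply/measurable_EFinP; exact: measurable_funS mg.
have mf' : measurable_fun D1 (EFin \o f) by apply/measurable_EFinP; exact: measurable_funS mf.
under eq_integral => x _.
  under eq_integral => y _ do rewrite EFinM.
  rewrite ge0_integralZl//; last 2 first.
    by move=> y _; rewrite lee_fin.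
    by rewrite lee_fin.
  over.
rewrite ge0_integralZr//.
- by move=> x _; rewrite lee_fin.
- by apply: integral_ge0 => y _; rewrite lee_fin.
Qed.

(** [X] may be infinite. If the supremum is positive, some positive [c] in [H] already forces [Y] to
    be infinite; if it is 0, the product is 0 by convention. *)
Lemma sup_mule_le (H : set R) (X Y : \bar R) : has_sup H -> (forall c, H c -> 0 <= c) ->
  (0 <= X)%E -> (0 <= Y)%E ->
  (forall c, H c -> (c%:E * X <= Y)%E) -> ((sup H)%:E * X <= Y)%E.
Proof.
move=> hs H0 X0 Y0 le.
have s0 : 0 <= sup H.
  have [[c Hc] _] := hs; apply: le_trans (H0 c Hc) _; exact: ub_le_sup hs.2 _ Hc.
case: X X0 le => [x| |]//= x0 le; last first.
  have [s1|s1] := ltP 0 (sup H); last first.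
    have -> : sup H = 0 by apply/eqP; rewrite eq_le s0 s1.
    by rewrite mul0e.
  have [c Hc c1] := sup_adherent s1 hs.
  rewrite subrr in c1.
  by have := le c Hc; rewrite !gt0_muley ?lte_fin.
case: Y Y0 le => [y| |]//= y0 le; last by rewrite leey.
rewrite -EFinM lee_fin; rewrite lee_fin in x0.
have [x1|x1] := ltP 0 x; last first.
  have -> : x = 0 by apply/eqP; rewrite eq_le x0 x1.
  by rewrite mulr0 -lee_fin.
rewrite -ler_pdivlMr//; apply: ge_sup; first by case: hs.
by move=> c Hc; rewrite ler_pdivlMr// -lee_fin EFinM; exact: le.
Qed.

Section sector.
Variable beta : R.
Hypothesis hbeta : pi < beta <= 2 * pi.

Let beta_bounds : [/\ 0 < pi :> R, 0 < beta & beta <= 2 * pi].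
Proof. by have := hbeta; have := @pi_gt0 R; move=> ? /andP[? ?]; split; lra. Qed.

(** The Jacobian is written [|rho|] so that the density is nonnegative for all real parameters,
    which lets Tonelli and measurability be used without restricting the domain. *)
Definition sector_density (E : set (R * R)) (F : R * R -> R) (rho th : R) : R :=
  F (polar rho th) * \1_E (polar rho th) * `|rho|.

Lemma measurable_sector_density (E : set (R * R)) (F : R * R -> R) : measurable (E : set (measurableTypeR R * measurableTypeR R)) ->
  measurable_fun [set: measurableTypeR R * measurableTypeR R] F ->
  measurable_fun [set: measurableTypeR R * measurableTypeR R]
    (fun p => sector_density E F p.1 p.2).
Proof.
move=> mE mF; apply: measurable_funM; last first.
  by apply: measurableT_comp => //; exact: measurable_fst.
apply: measurable_funM; first exact: (measurableT_comp mF measurable_polar).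
have mI : measurable_fun [set: measurableTypeR R * measurableTypeR R] (\1_E : R * R -> R).
  exact: measurable_indic.
exact: (measurableT_comp mI measurable_polar).
Qed.

Lemma sector_density_ge0 E F rho th : (forall p, 0 <= F p) -> 0 <= sector_density E F rho th.
Proof. by move=> F0; rewrite /sector_density !mulr_ge0. Qed.

Lemma measurable_sector_slice (E : set (R * R)) (F : R * R -> R) : measurable (E : set (measurableTypeR R * measurableTypeR R)) ->
  measurable_fun [set: measurableTypeR R * measurableTypeR R] F -> (forall p, 0 <= F p) ->
  measurable_fun setT (fun rho => \int[mu]_(th in `]0%R, beta[) (sector_density E F rho th)%:E)%E.
Proof.
move=> mE mF F0.
have -> : (fun rho => \int[mu]_(th in `]0%R, beta[) (sector_density E F rho th)%:E)%E =
  (fun rho => \int[mu]_th ((sector_density E F rho th * \1_(`]0%R, beta[) th)%:E))%E.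
  apply/funext => rho; rewrite integral_mkcond; apply: eq_integral => th _.
  by rewrite patchE indicE; case: ifP => _; rewrite ?mulr1 ?mulr0.
apply: (measurable_tonelli_fst (fun p : R * R => (sector_density E F p.1 p.2 * \1_(`]0%R, beta[) p.2)%:E)).
  apply/measurable_EFinP; apply: measurable_funM; first exact: measurable_sector_density.
  have mi : measurable_fun setT (\1_(`]0%R, beta[) : R -> R) by exact: measurable_indic.
  by apply: (measurableT_comp mi); exact: measurable_snd.
by move=> p; rewrite lee_fin mulr_ge0// sector_density_ge0.
Qed.

Lemma integral_sector (E : set (R * R)) (F : R * R -> R) : measurable (E : set (measurableTypeR R * measurableTypeR R)) ->
  E `<=` Lambda beta ->
  measurable_fun [set: measurableTypeR R * measurableTypeR R] F -> (forall p, 0 <= F p) ->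
  (\int[@leb2 R]_(p in E) (F p)%:E =
   \int[mu]_(rho in `]0%R, +oo[) \int[mu]_(th in `]0%R, beta[) (sector_density E F rho th)%:E)%E.
Proof.
move=> mE EL mF F0; have [hpi hb0 hb2] := beta_bounds.
rewrite integral_mkcond integral_polar; last 2 first.
- apply/(measurable_restrictT _ _).1 => //; apply/measurable_EFinP.
  exact: measurable_funS mF.
- by move=> p; rewrite patchE; case: ifP => // _; rewrite lee_fin.
apply: eq_integral => rho; rewrite inE/= in_itv/= andbT => rho0.
rewrite [LHS]integral_mkcond [RHS]integral_mkcond; apply: eq_integral => th _.
rewrite !patchE /sector_density indicE gtr0_norm//.
case: (boolP (th \in _)) => h1; case: (boolP (th \in `]0%R, beta[%classic)) => h2 //.
- by case: ifP => _; rewrite ?mulr1 ?mulr0 ?mul0r ?mul0e// EFinM.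
- rewrite ifF ?mul0e//; apply/negbTE; apply: contra h2; rewrite !inE/= => /EL.
  rewrite LambdaE// => -[_]; rewrite arg_polar//; last by move: h1; rewrite inE/= in_itv.
  by move: h1; rewrite inE/= !in_itv/= => /andP[-> _] ->.
- exfalso; move/negP: h1; apply; move: h2; rewrite !inE/= !in_itv/= => /andP[-> h]/=.
  exact: lt_le_trans h hb2.
Qed.

End sector.

(** In [t = ln rho] the measure [rho^-1 d rho] becomes [dt]. Stretching a bump by [n] multiplies its
    mass by [n] and its energy by [1 / n], while a translation changes neither and pushes the
    support below [ln R0]. *)
Lemma radial_profile (R0 eps : R) : 0 < R0 -> 0 < eps ->
  exists a a' N alpha, [/\ smooth1 a, (forall t, is_derive t (1 : R) a (a' t)),
    (forall t, N < `|t| -> a t = 0), (forall t, ln R0 <= t -> a t = 0) &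
    [/\ 0 < alpha, smooth1 a',
      (\int[mu]_(rho in `]0%R, +oo[) (a (ln rho) ^+ 2 * `|rho|^-1)%:E = alpha%:E)%E &
      (\int[mu]_(rho in `]0%R, +oo[) (a' (ln rho) ^+ 2 * `|rho|^-1)%:E <= (eps * alpha)%:E)%E]].
Proof.
move=> R00 eps0; have [chi [schi chi01 chi1 chi0]] := @cutoff_bump R.
have [chi' dchi schi'] := smooth1_derive _ schi.
have chi'0 x : 2 < `|x| -> chi' x = 0.
  move=> hx; apply: (derive_eq0_on_open chi chi' [set t | 2 < `|t|] x) => //.
    have -> : [set t : R | 2 < `|t|] = Num.norm @^-1` [set x | 2 < x] by [].
    by apply: open_comp => [y _|]; [exact: norm_continuous|exact: open_gt].
  by move=> y /= /ltW; exact: chi0.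
have [M M0 HM] : exists2 M, 0 < M & forall x, chi' x ^+ 2 <= M.
  have [c _ hc] := @EVT_max R (fun x => chi' x ^+ 2) (-2) 2 ltac:(by lra)
    ltac:(apply: continuous_subspaceT => x; apply: cvgM; exact: smooth1_continuous).
  exists (chi' c ^+ 2 + 1); first by rewrite ltr_wpDl// sqr_ge0.
  move=> x; have [hx|hx] := ltP 2 `|x|; first by rewrite chi'0// expr0n/= addr_ge0// sqr_ge0.
  by apply: le_trans (hc x _) _; [rewrite in_itv/= -ler_norml|rewrite lerDl].
(* energy over mass is at most [(M / n^2 * 4 n) / (2 n)] *)
pose n := 2 * M / eps + 1.
have n1 : 1 <= n by rewrite /n lerDr divr_ge0 ?mulr_ge0 ?ltW.
have n0 : 0 < n by exact: lt_le_trans ltr01 n1.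
(* With this shift [t >= ln R0] gives [(t + T) / n >= 2], where [chi] vanishes. *)
pose T := 2 * n - ln R0.
pose a t := chi ((t + T) / n).
pose a' t := chi' ((t + T) / n) / n.
have sarg : smooth1 (fun t : R => (t + T) / n).
  by move=> k; apply: CnM; [apply: CnD; [exact: Cn_id|exact: Cn_cst]|exact: Cn_cst].
have darg t : is_derive t (1 : R) (fun t : R => (t + T) / n) n^-1.
  have := is_deriveM (is_deriveD (is_derive_id t (1:R)) (@is_derive_cst R R R T t 1)) (@is_derive_cst R R R n^-1 t 1).
  by move=> h; apply: (is_derive_eq h); rewrite -![_ *: _]/(_ * _) /= addr0 mulr0 add0r mulr1.
have sa : smooth1 a by move=> k; exact: (Cn_comp k chi).
have da t : is_derive t (1 : R) a (a' t).
  exact: (@is_derive1_comp _ chi (fun t => (t + T) / n) t _ _ (dchi _) (darg t)).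
have sa' : smooth1 a'.
  by move=> k; apply: CnM; [exact: (Cn_comp k chi')|exact: Cn_cst].
have a01 t : 0 <= a t ^+ 2 <= 1.
  by have /andP[h1 h2] := chi01 ((t + T) / n); rewrite sqr_ge0/= expr_le1.
have far t : 2 * n < `|t + T| -> 2 < `|(t + T) / n|.
  by move=> h; rewrite normrM normfV (gtr0_norm n0) ltr_pdivlMr.
have mu_inv (x y : R) : x <= y ->
    (\int[mu]_(rho in `[expR x, expR y]) (`|rho|^-1)%:E = (y - x)%:E)%E.
  rewrite le_eqVlt => /predU1P[->|xy].
    by rewrite set_itv1 integral_set1 subrr.
  have exy : expR x < expR y by rewrite ltr_expR.
  have pos rho : expR x <= rho -> 0 < rho by apply: lt_le_trans; exact: expR_gt0.
  transitivity (\int[mu]_(rho in `[expR x, expR y]) (rho^-1)%:E)%E.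
    apply: eq_integral => rho; rewrite inE/= in_itv/= => /andP[h _].
    by rewrite gtr0_norm// pos.
  rewrite (@continuous_FTC2 _ _ (@ln R))//.
  - by rewrite !expRK.
  - apply: continuous_in_subspaceT => rho; rewrite inE/= in_itv/= => /andP[h _].
    by apply: inv_continuous; rewrite gt_eqF// pos.
  - split.
    + move=> rho; rewrite in_itv/= => /andP[h _].
      by case: (is_derive1_ln (pos _ (ltW h))).
    + by apply: cvg_at_right_filter; apply: continuous_ln; exact: expR_gt0.
    + by apply: cvg_at_left_filter; apply: continuous_ln; exact: expR_gt0.
  - move=> rho; rewrite in_itv/= => /andP[h _]; rewrite derive1E.
    by rewrite (@derive_val _ _ _ _ _ _ _ (is_derive1_ln (pos _ (ltW h)))).
have mln (f : R -> R) : smooth1 f -> measurable_fun setT (fun rho : R => f (ln rho) ^+ 2 * `|rho|^-1).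
  move=> sf; apply: measurable_funM.
    apply: measurable_funX; apply: (measurableT_comp (f := f)); last exact: measurable_ln.
    by apply: continuous_measurable_fun; exact: smooth1_continuous.
  by apply: (measurableT_comp measurable_invr).
have minvD (D : set R) : measurable_fun D (fun rho : R => (`|rho|^-1)%:E).
  apply/measurable_EFinP; apply: (@measurable_funS _ _ _ _ setT) => //.
  exact: (measurableT_comp measurable_invr).
have fge0 (f : R -> R) rho : 0 <= f (ln rho) ^+ 2 * `|rho|^-1.
  by rewrite mulr_ge0 ?sqr_ge0// invr_ge0.
(* both integrands are supported in [[exp(-T - 2n), exp(-T + 2n)]] *)
have upper (f : R -> R) (K : R) : smooth1 f -> 0 <= K -> (forall t, f t ^+ 2 <= K) ->
    (forall t, 2 * n < `|t + T| -> f t = 0) ->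
    (\int[mu]_(rho in `]0%R, +oo[) (f (ln rho) ^+ 2 * `|rho|^-1)%:E <= (K * (4 * n))%:E)%E.
  move=> sf K0 fK fsupp.
  have -> : (K * (4 * n))%:E = (\int[mu]_(rho in `[expR (- T - 2 * n), expR (- T + 2 * n)]) (K%:E * (`|rho|^-1)%:E))%E.
    rewrite ge0_integralZl ?lee_fin//; last exact: minvD.
    by rewrite mu_inv ?EFinM; [congr (_ * _%:E)%E; ring|lra].
  rewrite [X in (X <= _)%E]integral_mkcond [X in (_ <= X)%E]integral_mkcond.
  apply: ge0_le_integral => //.
  - by move=> rho _; rewrite patchE; case: ifP => // _; rewrite lee_fin.
  - apply/(measurable_restrictT _ _).1 => //; apply/measurable_EFinP.
    by apply: measurable_funS (mln f sf).
  - apply/(measurable_restrictT _ _).1 => //; apply: emeasurable_funM => //.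
    exact: minvD.
  - move=> rho _; rewrite !patchE; case: (boolP (rho \in _)) => h1; last first.
      by case: ifP => // _; rewrite -EFinM lee_fin mulr_ge0// invr_ge0.
    have rho0 : 0 < rho by move: h1; rewrite inE/= in_itv/= andbT.
    case: (boolP (rho \in _)) => h2; first by rewrite -EFinM lee_fin ler_wpM2r// invr_ge0.
    rewrite fsupp ?expr0n ?mul0r//; rewrite ltNge; apply: contra h2.
    rewrite ler_norml => /andP[k1 k2]; rewrite inE/= in_itv/= -{1 2}(lnK rho0) !ler_expR.
    by apply/andP; split; lra.
have asupp t : 2 * n < `|t + T| -> a t = 0.
  by move=> /far h; rewrite /a chi0// ltW.
have a'supp t : 2 * n < `|t + T| -> a' t = 0.
  by move=> /far h; rewrite /a' chi'0// mul0r.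
have mass_ub : (\int[mu]_(rho in `]0%R, +oo[) (a (ln rho) ^+ 2 * `|rho|^-1)%:E <= (1 * (4 * n))%:E)%E.
  by apply: upper => // t; have /andP[] := a01 t.
have energy_ub : (\int[mu]_(rho in `]0%R, +oo[) (a' (ln rho) ^+ 2 * `|rho|^-1)%:E <= (M / n ^+ 2 * (4 * n))%:E)%E.
  apply: upper => //; first by rewrite divr_ge0 ?sqr_ge0// ltW.
  by move=> t; rewrite /a' expr_div_n ler_wpM2r// invr_ge0 sqr_ge0.
have mass_lb : ((2 * n)%:E <= \int[mu]_(rho in `]0%R, +oo[) (a (ln rho) ^+ 2 * `|rho|^-1)%:E)%E.
  have -> : (2 * n)%:E = (\int[mu]_(rho in `[expR (- T - n), expR (- T + n)]) (`|rho|^-1)%:E)%E.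
    by rewrite mu_inv; [congr EFin; ring|lra].
  rewrite [X in (X <= _)%E]integral_mkcond [X in (_ <= X)%E]integral_mkcond.
  apply: ge0_le_integral => //.
  - by move=> rho _; rewrite patchE; case: ifP => // _; rewrite lee_fin invr_ge0.
  - apply/(measurable_restrictT _ _).1; [exact: measurable_itv|exact: minvD].
  - apply/(measurable_restrictT _ _).1 => //; apply/measurable_EFinP.
    by apply: measurable_funS (mln a sa).
  - move=> rho _; rewrite !patchE; case: (boolP (rho \in _)) => h1; last first.
      by case: ifP => // _; rewrite lee_fin.
    have [r1 r2] : expR (- T - n) <= rho /\ rho <= expR (- T + n).
      by move: h1; rewrite inE/= in_itv/= => /andP.
    have rho0 : 0 < rho by apply: lt_le_trans r1; exact: expR_gt0.
    rewrite mem_set; last by rewrite /= in_itv/= rho0.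
    rewrite -{1}(lnK rho0) ler_expR in r1; rewrite -{1}(lnK rho0) ler_expR in r2.
    rewrite /a chi1 ?expr1n ?mul1r//.
    rewrite normrM normfV (gtr0_norm n0) ler_pdivrMr// mul1r ler_norml.
    by apply/andP; split; lra.
set I0 := (\int[mu]_(rho in _) (a (ln rho) ^+ 2 * _)%:E)%E in mass_ub mass_lb *.
have I0fin : I0 \is a fin_num.
  rewrite ge0_fin_numE; first by apply: le_lt_trans mass_ub _; rewrite ltry.
  by apply: le_trans mass_lb; rewrite lee_fin mulr_ge0// ltW.
have al : 2 * n <= fine I0 by rewrite -lee_fin fineK.
exists a, a', (2 * n + `|T|), (fine I0); split => //.
- move=> t ht; apply: asupp.
  have := ler_normB (t + T) T; rewrite addrK; lra.
- move=> t ht; rewrite /a chi0// ler_normr; apply/orP; left.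
  by rewrite ler_pdivlMr// /T; lra.
- split => //; [lra|by rewrite fineK|].
  apply: le_trans energy_ub _; rewrite lee_fin.
  apply: (@le_trans _ _ (eps * (2 * n))); last by rewrite ler_wpM2l// ltW.
  have -> : M / n ^+ 2 * (4 * n) = 2 * M / n * 2 by field; rewrite gt_eqF.
  have -> : eps * (2 * n) = eps * n * 2 by ring.
  rewrite ler_pM2r// ler_pdivrMr//.
  (* [n] is at least [2 * M / eps] and at least 1: the first bound gives this inequality, the second
     absorbs the remaining factor [n]. *)
  have h : 2 * M <= eps * n by have -> : eps * n = 2 * M + eps by [rewrite /n; field; rewrite gt_eqF]; rewrite lerDl ltW.
  apply: le_trans h _; rewrite ler_peMr// mulr_ge0// ltW//.
Qed.

End sector_integrals.

(** * The angular inequality *)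

Section angular_inequality.
Context {R : realType}.
Variable beta : R.
Hypothesis hbeta : pi < beta <= 2 * pi.
Local Notation mu := (@lebesgue_measure R).
Local Notation dL p := (dist_set p (bdry (Lambda beta))).
Implicit Types w g : R -> R.

Let beta_bounds : [/\ 0 < pi :> R, 0 < beta & beta <= 2 * pi].
Proof. by have := hbeta; have := @pi_gt0 R; move=> ? /andP[? ?]; split; lra. Qed.

Definition potential (th : R) : R := (dL (polar 1 th)) ^- 2.

Lemma measurable_dist_Lambda :
  measurable_fun [set: measurableTypeR R * measurableTypeR R] (fun p : R * R => dL p).
Proof.
apply: continuous_measurable_prod; apply: continuous_dist_set.
exact: bdry_Lambda_neq0.
Qed.

Lemma measurable_potential : measurable_fun setT potential.
Proof.
apply: (measurableT_comp measurable_invr); apply: measurable_funX.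
apply: continuous_measurable_fun => th.
have c1 : {for th, continuous (fun th : R => (1 : R, th))}.
  exact: (cvg_pair (cvg_cst (1 : R)) (@cvg_id _ (nbhs th))).
have c2 := continuous_comp c1 (@continuous_polar R (1 : R, th)).
exact: (continuous_comp c2 (continuous_dist_set _ (bdry_Lambda_neq0 beta hbeta) _)).
Qed.

Lemma potential_ge0 th : 0 <= potential th.
Proof. by rewrite invr_ge0 sqr_ge0. Qed.

Lemma potential_sym th : potential (beta - th) = potential th.
Proof. by rewrite /potential dist_Lambda_sym. Qed.

(** The vertex belongs to the boundary, so the distance from the unit circle is at most 1. This
    lower bound on the potential is what makes the set of Hardy constants bounded. *)
Lemma potential_ge1 th : 0 < th < beta -> 1 <= potential th.
Proof.
move=> /andP[h1 h2]; have d0 : 0 < dL (polar 1 th).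
  by apply: dist_Lambda_gt0 => //; exists 1, th; rewrite h1 h2.
rewrite /potential -[leLHS]invr1 lef_pV2 ?posrE ?exprn_gt0// expr_le1 ?(ltW d0)//.
have := dist_Lambda_le_nrm beta hbeta (polar 1 th).
by rewrite nrm_polar normr1.
Qed.

Lemma hardy_weight_polar (rho th : R) : 0 < rho ->
  (dL (polar rho th)) ^- 2 = potential th * rho ^- 2.
Proof. by move=> r0; rewrite dist_Lambda_polar// exprMn invfM mulrC. Qed.

(* By homogeneity of the distance, the Hardy inequality on [Lambda beta] with constant [c]
   is equivalent to this one-dimensional inequality. *)
Definition angular_hardy (c : R) := forall w w' (delta : R),
  smooth1 w -> (forall t, is_derive t (1 : R) w (w' t)) -> 0 < delta ->
  (forall th, 0 < th < beta -> th < delta \/ beta - delta < th -> w th = 0) ->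
  (c%:E * \int[mu]_(th in `]0%R, beta[) (potential th * w th ^+ 2)%:E <=
   \int[mu]_(th in `]0%R, beta[) (w' th ^+ 2)%:E)%E.

Lemma measurable_smooth1 g : smooth1 g -> measurable_fun setT g.
Proof. by move=> sg; apply: continuous_measurable_fun; exact: smooth1_continuous. Qed.

Lemma smooth1_bounded g (a b : R) : a <= b -> smooth1 g ->
  exists2 M, 0 <= M & forall x, a <= x <= b -> g x ^+ 2 <= M.
Proof.
move=> ab sg.
have [c _ hc] := @EVT_max R (fun x => g x ^+ 2) a b ab
  ltac:(apply: continuous_subspaceT => x; apply: cvgM; exact: smooth1_continuous).
by exists (g c ^+ 2); [exact: sqr_ge0|move=> x hx; apply: hc; rewrite in_itv].
Qed.

Lemma smooth1_integral_fin g : smooth1 g ->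
  (\int[mu]_(th in `]0%R, beta[) (g th ^+ 2)%:E \is a fin_num)%E.
Proof.
move=> sg; have [_ b0 _] := beta_bounds.
have [M M0 hM] := smooth1_bounded g 0 beta (ltW b0) sg.
rewrite ge0_fin_numE; last by apply: integral_ge0 => th _; rewrite lee_fin sqr_ge0.
apply: (@le_lt_trans _ _ (\int[mu]_(th in `]0%R, beta[) (M%:E))%E).
  apply: ge0_le_integral => //.
  - by move=> th _; rewrite lee_fin sqr_ge0.
  - apply/measurable_EFinP; apply: (@measurable_funS _ _ _ _ setT) => //.
    by apply: measurable_funX; exact: measurable_smooth1.
  - by move=> th /=; rewrite in_itv/= => /andP[h1 h2]; rewrite lee_fin hM// !ltW.
by rewrite integral_cst//= lebesgue_measure_itv/= lte_fin b0 -EFinD -EFinM ltry.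
Qed.

Lemma measurable_potential_sqr w : measurable_fun setT w ->
  measurable_fun setT (fun th => potential th * w th ^+ 2).
Proof. by move=> mw; apply: measurable_funM; [exact: measurable_potential|exact: measurable_funX]. Qed.

Section test_function.
Variables (a a' w w' : R -> R) (N delta : R).
Hypotheses (sa : smooth1 a) (da : forall t, is_derive t (1 : R) a (a' t))
  (la : log_supported N a) (sa' : smooth1 a')
  (sw : smooth1 w) (dw : forall t, is_derive t (1 : R) w (w' t))
  (sw' : smooth1 w') (delta0 : 0 < delta) (aw : angle_supported beta delta w).

Let u := polar_prod beta a w.

Lemma measurable_Lambda :
  measurable (Lambda beta : set (measurableTypeR R * measurableTypeR R)).
Proof. by apply: open_measurable_prod; exact: open_Lambda. Qed.

Lemma measurable_hardy_density (v : R * R -> R) : continuous v ->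
  measurable_fun [set: measurableTypeR R * measurableTypeR R]
    (fun p : R * R => v p ^+ 2 / (dL p) ^+ 2).
Proof.
move=> cv; apply: measurable_funM.
  by apply: measurable_funX; exact: continuous_measurable_prod.
apply: (measurableT_comp measurable_invr); apply: measurable_funX.
exact: measurable_dist_Lambda.
Qed.

Lemma measurable_grad_sq (v : R * R -> R) : smooth2 v ->
  measurable_fun [set: measurableTypeR R * measurableTypeR R] (grad_sq v).
Proof.
move=> sv; apply: measurable_funD; apply: measurable_funX; apply: continuous_measurable_prod.
  exact: (smooth2_continuous _ (smooth2_dx _ sv)).
exact: (smooth2_continuous _ (smooth2_dy _ sv)).
Qed.

Let su : smooth2 u.
Proof.
apply: (smooth2_separated_span beta N delta) => //.
exact: span_separated.
Qed.

Lemma grad_sq_ge0 (v : R * R -> R) p : 0 <= grad_sq v p.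
Proof. by rewrite addr_ge0 ?sqr_ge0. Qed.

Lemma sqr_div_ge0 (x y : R) : 0 <= x ^+ 2 / y ^+ 2.
Proof. by rewrite divr_ge0 ?sqr_ge0. Qed.

(** [rho^-1] is what the Jacobian leaves of the factor [rho^-2] common to the Hardy term and to the
    squared gradient. *)
Let radial (f : R -> R) : R -> R := fun rho => f (ln rho) ^+ 2 * `|rho|^-1.

Let measurable_radial f : smooth1 f -> measurable_fun setT (radial f).
Proof.
move=> sf; apply: measurable_funM.
  apply: measurable_funX; apply: (measurableT_comp (f := f)); last exact: measurable_ln.
  exact: measurable_smooth1.
by apply: (measurableT_comp measurable_invr).
Qed.

Let radial_ge0 f rho : 0 <= radial f rho.
Proof. by rewrite mulr_ge0 ?sqr_ge0// invr_ge0. Qed.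

Let mEF (D : set R) (f : R -> R) : measurable_fun setT f -> measurable_fun D (EFin \o f).
Proof.
by move=> mf; apply/measurable_EFinP; exact: (@measurable_funS _ _ _ _ setT).
Qed.

Lemma hardy_term_separated :
  (\int[@leb2 R]_(p in Lambda beta) (u p ^+ 2 / (dL p) ^+ 2)%:E =
   (\int[mu]_(rho in `]0%R, +oo[) (radial a rho)%:E) *
   (\int[mu]_(th in `]0%R, beta[) (potential th * w th ^+ 2)%:E))%E.
Proof.
rewrite (integral_sector beta hbeta) //; last 3 first.
- exact: measurable_Lambda.
- by apply: measurable_hardy_density; exact: smooth2_continuous.
- by move=> p; exact: sqr_div_ge0.
rewrite -integral_prod_fun//; last 3 first.
- exact: measurable_radial.
- by apply: measurable_potential_sqr; exact: measurable_smooth1.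
- by move=> th; rewrite mulr_ge0 ?potential_ge0 ?sqr_ge0.
apply: eq_integral => rho; rewrite inE/= in_itv/= andbT => rho0.
apply: eq_integral => th; rewrite inE/= in_itv/= => hth; congr EFin.
rewrite /sector_density /u separated_polar// hardy_weight_polar//.
rewrite indicE mem_set; last by exists rho, th.
rewrite /radial gtr0_norm//.
have alg (A W P s : R) : 0 < s -> (A * W) ^+ 2 * (P * s ^- 2) * 1 * s = A ^+ 2 * s^-1 * (P * W ^+ 2).
  by move=> s0; field; rewrite gt_eqF.
exact: (alg _ _ _ rho).
Qed.

Lemma energy_separated :
  (\int[@leb2 R]_(p in Lambda beta) (grad_sq u p)%:E =
   (\int[mu]_(rho in `]0%R, +oo[) (radial a' rho)%:E) *
     (\int[mu]_(th in `]0%R, beta[) (w th ^+ 2)%:E) +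
   (\int[mu]_(rho in `]0%R, +oo[) (radial a rho)%:E) *
     (\int[mu]_(th in `]0%R, beta[) (w' th ^+ 2)%:E))%E.
Proof.
have mw2 : measurable_fun setT (fun th => w th ^+ 2).
  by apply: measurable_funX; exact: measurable_smooth1.
have mw'2 : measurable_fun setT (fun th => w' th ^+ 2).
  by apply: measurable_funX; exact: measurable_smooth1.
rewrite (integral_sector beta hbeta) //; last 3 first.
- exact: measurable_Lambda.
- exact: measurable_grad_sq.
- by move=> p; exact: grad_sq_ge0.
have sector_eq (rho : R) : rho \in `]0%R, +oo[%classic ->
    (\int[mu]_(th in `]0%R, beta[) (sector_density (Lambda beta) (grad_sq u) rho th)%:E =
     (radial a' rho)%:E * (\int[mu]_(th in `]0%R, beta[) (w th ^+ 2)%:E) +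
     (radial a rho)%:E * (\int[mu]_(th in `]0%R, beta[) (w' th ^+ 2)%:E))%E.
  rewrite inE/= in_itv/= andbT => rho0.
  have m1 : measurable_fun `]0%R, beta[ (EFin \o (fun th => w th ^+ 2)) by exact: mEF.
  have m2 : measurable_fun `]0%R, beta[ (EFin \o (fun th => w' th ^+ 2)) by exact: mEF.
  have Zl (k : R) (f : R -> R) : 0 <= k -> measurable_fun setT f ->
      (k%:E * \int[mu]_(th in `]0%R, beta[) (f th ^+ 2)%:E =
       \int[mu]_(th in `]0%R, beta[) (k * f th ^+ 2)%:E)%E.
    move=> k0 mf; rewrite -ge0_integralZl//.
    - by apply: mEF; exact: measurable_funX.
    - by move=> th _; rewrite lee_fin sqr_ge0.
  rewrite !Zl//; try exact: measurable_smooth1.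
  rewrite -ge0_integralD//; last 4 first.
  - by move=> th _; rewrite lee_fin mulr_ge0 ?sqr_ge0.
  - by apply: mEF; apply: measurable_funM => //; exact: measurable_cst.
  - by move=> th _; rewrite lee_fin mulr_ge0 ?sqr_ge0.
  - by apply: mEF; apply: measurable_funM => //; exact: measurable_cst.
  apply: eq_integral => th; rewrite inE/= in_itv/= => hth.
  rewrite -EFinD; congr EFin.
  rewrite /sector_density (grad_sq_separated beta N delta hbeta delta0 a a' w w')//.
  rewrite indicE mem_set; last by exists rho, th.
  rewrite /radial gtr0_norm//.
  have alg (A W P Q s : R) : 0 < s ->
      s ^- 2 * (A * W + P * Q) * 1 * s = A * s^-1 * W + P * s^-1 * Q.
    by move=> s0; field; rewrite gt_eqF.
  exact: (alg _ _ _ _ rho).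
under eq_integral => rho hrho do rewrite (sector_eq rho hrho).
have mr (f : R -> R) : smooth1 f -> measurable_fun (`]0, +oo[ : set R) (EFin \o radial f).
  by move=> sf; apply: mEF; exact: measurable_radial.
have i0 (f : R -> R) : (0 <= \int[mu]_(th in `]0%R, beta[) (f th ^+ 2)%:E)%E.
  by apply: integral_ge0 => th _; rewrite lee_fin sqr_ge0.
rewrite ge0_integralD//; last 4 first.
- by move=> rho _; rewrite mule_ge0// lee_fin.
- by apply: emeasurable_funM; [exact: mr|exact: measurable_cst].
- by move=> rho _; rewrite mule_ge0// lee_fin.
- by apply: emeasurable_funM; [exact: mr|exact: measurable_cst].
rewrite !ge0_integralZr//.
- exact: mr.
- by move=> rho _; rewrite lee_fin.
- exact: mr.
- by move=> rho _; rewrite lee_fin.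
Qed.

End test_function.

(* Radially spread test functions [a(ln rho) w(th)] have a negligible radial energy. *)
Lemma test_function_profile (w w' : R -> R) (delta R0 eps : R) :
  smooth1 w -> (forall t, is_derive t (1 : R) w (w' t)) -> smooth1 w' -> 0 < delta ->
  angle_supported beta delta w -> 0 < R0 -> 0 < eps ->
  exists a N alpha, [/\ smooth1 a, log_supported N a, (forall t, ln R0 <= t -> a t = 0), 0 < alpha &
    (\int[@leb2 R]_(p in Lambda beta) (polar_prod beta a w p ^+ 2 / (dL p) ^+ 2)%:E =
       alpha%:E * \int[mu]_(th in `]0%R, beta[) (potential th * w th ^+ 2)%:E)%E /\
    (\int[@leb2 R]_(p in Lambda beta) (grad_sq (polar_prod beta a w) p)%:E <=
       alpha%:E * (eps%:E * \int[mu]_(th in `]0%R, beta[) (w th ^+ 2)%:E +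
                   \int[mu]_(th in `]0%R, beta[) (w' th ^+ 2)%:E))%E].
Proof.
move=> sw dw sw' d0 aw R00 e0.
have [a [a' [N [alpha [sa da la hR0 [al0 sa' ha ha']]]]]] := @radial_profile R R0 eps R00 e0.
exists a, N, alpha; split => //; split.
  by rewrite (hardy_term_separated a w N delta sa la sw d0 aw) ha.
rewrite (energy_separated a a' w w' N delta sa da la sa' sw dw sw' d0 aw) ha.
have i0 (f : R -> R) : (0 <= \int[mu]_(th in `]0%R, beta[) (f th ^+ 2)%:E)%E.
  by apply: integral_ge0 => th _; rewrite lee_fin sqr_ge0.
have eW : (0 <= eps%:E * \int[mu]_(th in `]0%R, beta[) (w th ^+ 2)%:E)%E.
  by apply: mule_ge0; [rewrite lee_fin ltW|exact: i0].
rewrite (ge0_muleDr _ eW (i0 w')).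
rewrite leeD2r// muleA -EFinM (mulrC alpha); apply: lee_wpmul2r => //.
Qed.

Lemma hardy_angular c : 0 <= c -> hardy_ineq (Lambda beta) c -> angular_hardy c.
Proof.
move=> c0 hc w w' delta sw dw d0 aw.
have sw' : smooth1 w'.
  have [w1 dw1 sw1] := smooth1_derive _ sw.
  by rewrite (is_derive_unique_fun _ _ _ dw dw1).
set W0 := (\int[mu]_(th in `]0%R, beta[) (w th ^+ 2)%:E)%E.
have W0fin : (W0 \is a fin_num)%E by exact: smooth1_integral_fin.
have W00 : (0 <= W0)%E by apply: integral_ge0 => th _; rewrite lee_fin sqr_ge0.
apply/lee_addgt0Pr => e e0; rewrite addeC.
have W1 : 0 < fine W0 + 1 by rewrite ltr_wpDl// fine_ge0.
(* With this ratio the radial energy, relative to the mass [alpha], is at most [e]; the 1 covers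
   [W0 = 0]. *)
have ee0 : 0 < e / (fine W0 + 1) by exact: divr_gt0.
have [a [N [alpha [sa la _ al0 [h1 h2]]]]] :=
  test_function_profile w w' delta 1 _ sw dw sw' d0 aw ltr01 ee0.
have := hc _ (Cc_infty_separated beta N delta hbeta d0 a w sa sw la aw).
rewrite h1 => /le_trans /(_ h2).
rewrite muleCA lee_pmul2l// => /le_trans; apply.
rewrite leeD2r// -/W0 -(fineK W0fin) -EFinM lee_fin mulrAC ler_pdivrMr// ler_pM2l//.
by rewrite lerDl.
Qed.

End angular_inequality.

(** * Hardy inequality on initial arcs *)

Section domination.
Context {d : measure_display} {T : measurableType d} {R : realType}.
Variable mu : {measure set T -> \bar R}.

Lemma ge0_le_integral_sub (A B : set T) (f h : T -> R) : measurable A -> measurable B ->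
  measurable_fun setT f -> measurable_fun setT h -> (forall x, 0 <= f x) -> (forall x, 0 <= h x) ->
  (forall x, A x -> 0 < f x -> B x /\ f x <= h x) ->
  (\int[mu]_(x in A) (f x)%:E <= \int[mu]_(x in B) (h x)%:E)%E.
Proof.
move=> mA mB mf mh f0 h0 le.
rewrite [X in (X <= _)%E]integral_mkcond [X in (_ <= X)%E]integral_mkcond.
have mE (D : set T) (k : T -> R) : measurable D -> measurable_fun setT k ->
    measurable_fun setT ((EFin \o k) \_ D).
  move=> mD mk; apply/(measurable_restrictT _ _).1 => //.
  by apply/measurable_EFinP; exact: (@measurable_funS _ _ _ _ setT).
have p0 (D : set T) (k : T -> R) x : (forall x, 0 <= k x) -> (0 <= ((EFin \o k) \_ D) x)%E.
  by move=> k0; rewrite patchE; case: ifP => // _; rewrite lee_fin.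
apply: ge0_le_integral => //.
- by move=> x _; exact: p0.
- exact: mE.
- exact: mE.
- move=> x _; rewrite patchE; case: (boolP (x \in A)) => [|_]; last exact: p0.
  rewrite inE => xA; have [fx0|fx0] := ltP 0 (f x).
    by have [xB fh] := le x xA fx0; rewrite patchE mem_set// lee_fin.
  apply: (@le_trans _ _ 0%E); [by rewrite lee_fin|exact: p0].
Qed.

End domination.

Section half_interval.
Context {R : realType}.
Local Notation mu := (@lebesgue_measure R).

Variable beta : R.
Hypothesis hbeta : pi < beta <= 2 * pi.
Let beta_bounds : [/\ 0 < pi :> R, 0 < beta & beta <= 2 * pi].
Proof. by have := hbeta; have := @pi_gt0 R; move=> ? /andP[? ?]; split; lra. Qed.

Lemma integral_itv_reflect (f : R -> R) : measurable_fun setT f -> (forall x, 0 <= f x) ->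
  (\int[mu]_(th in `](beta / 2)%R, beta[) (f th)%:E =
   \int[mu]_(th in `]0%R, (beta / 2)%R[) (f (beta - th))%:E)%E.
Proof.
move=> mf f0; have [_ b0 _] := beta_bounds.
have n1 : -1 != 0 :> R by rewrite oppr_eq0 oner_eq0.
have mf' : measurable_fun setT (EFin \o f) by exact/measurable_EFinP.
have f0' x : (0 <= (EFin \o f) x)%E by rewrite lee_fin.
rewrite (ge0_integral_affine_set (-1) beta _ _ n1 (measurable_itv _) mf' f0').
rewrite normrN1 mul1e.
have -> : [set x | `](beta / 2)%R, beta[%classic (-1 * x + beta)] = `]0, (beta / 2)[%classic.
  by apply/seteqP; split=> x /=; rewrite !in_itv/= => /andP[h1 h2]; apply/andP; split; lra.
by apply: eq_integral => x _; rewrite mulN1r addrC.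
Qed.

Lemma integral_split_half (f : R -> R) : measurable_fun setT f -> (forall x, 0 <= f x) ->
  (\int[mu]_(th in `]0%R, beta[) (f th)%:E =
   \int[mu]_(th in `]0%R, (beta / 2)%R[) (f th)%:E + \int[mu]_(th in `]0%R, (beta / 2)%R[) (f (beta - th))%:E)%E.
Proof.
move=> mf f0; have [_ b0 _] := beta_bounds; rewrite -integral_itv_reflect//.
have mE (D : set R) : measurable D -> measurable_fun D (EFin \o f).
  by move=> mD; apply/measurable_EFinP; exact: (@measurable_funS _ _ _ _ setT).
have -> : (`]0, beta[%classic : set R) = `]0, (beta / 2)[ `|` `[(beta / 2), beta[.
  apply/seteqP; split=> x /=; rewrite !in_itv/=.
    by move=> /andP[h1 h2]; have [h|h] := ltP x (beta / 2); [left|right]; rewrite ?h1 ?h ?h2.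
  by case=> /andP[h1 h2]; apply/andP; split; lra.
have disj : [disjoint (`]0, (beta / 2)[%classic : set R) & `[(beta / 2), beta[%classic].
  by apply/disj_setPS => x [] /=; rewrite !in_itv/= => /andP[_ h1] /andP[h2 _]; lra.
rewrite (ge0_integral_setU mu (measurable_itv _) (measurable_itv _) (mE _ (measurableU _ _ (measurable_itv _) (measurable_itv _))) _ disj); last first.
  by move=> x _; rewrite lee_fin.
congr (_ + _)%E.
by rewrite -[LHS]integral_itv_obnd_cbnd//; exact: mE.
Qed.

Lemma adde_self (x : \bar R) : (0 <= x -> x + x = 2%:E * x)%E.
Proof. by move=> x0; rewrite -[in LHS](mul1e x) -ge0_muleDl ?lee_fin// -EFinD. Qed.

(* [g] is frozen smoothly at the value [g a] beyond [a] and reflected about [beta / 2]: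
   on the half interval this costs [O(eps)] in energy and keeps the potential term of [g]
   on [(0, a - eps)]. *)
Lemma angular_freeze c g g' (delta a : R) : 0 <= c -> angular_hardy beta c -> smooth1 g ->
  (forall t, is_derive t (1 : R) g (g' t)) -> smooth1 g' -> 0 < delta ->
  (forall th, 0 < th < delta -> g th = 0) -> 0 < a <= beta / 2 ->
  exists2 K, 0 <= K & forall eps, 0 < eps < a ->
    (c%:E * \int[mu]_(th in `]0%R, (a - eps)%R[) (potential beta th * g th ^+ 2)%:E <=
     \int[mu]_(th in `]0%R, a[) (g' th ^+ 2)%:E + (K * eps)%:E)%E.
Proof.
move=> c0 hc sg dg sg' d0 g0 /andP[a0 ab]; have [_ b0 _] := beta_bounds.
have [Phi [sPhi Phi1 Phi0]] := @freezing_function R.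
have [Phi' dPhi sPhi'] := smooth1_derive _ sPhi.
have Phi'1 s : s < -1 -> Phi' s = 1.
  move=> s1; apply/eqP; rewrite -subr_eq0; apply/eqP.
  apply: (derive_eq0_on_open (fun s => Phi s - s) (fun s => Phi' s - 1) [set x | x < -1] s) => //.
  by move=> y /= y1; rewrite Phi1 ?subrr// ltW.
have Phi'0 s : 0 < s -> Phi' s = 0.
  move=> s0; apply: (derive_eq0_on_open Phi Phi' [set x | 0 < x] s) => //.
  by move=> y /= y1; rewrite Phi0// ltW.
have lt10 : -1 <= 0 :> R by lra.
have [M M0 hM] := smooth1_bounded Phi (-1) 0 lt10 sPhi.
have [M' M'0 hM'] := smooth1_bounded Phi' (-1) 0 lt10 sPhi'.
(* [M] bounds the square of [Phi], hence [|Phi| <= M + 1]. As [e < a], the reparametrisation [phi]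
   stays within [a * (M + 1)] of [a] on the transition window, and [M2] bounds [g'^2] there
   uniformly in [e]. *)
have aM : 0 <= a * (M + 1) by apply: mulr_ge0; [exact: ltW|rewrite addr_ge0].
have [M2 M20 hM2] := smooth1_bounded g' (a - a * (M + 1)) (a + a * (M + 1)) ltac:(lra) sg'.
exists (M2 * M'); first exact: mulr_ge0.
move=> e /andP[e0 ea].
pose phi (th : R) := a + e * Phi ((th - a) / e).
pose phi' (th : R) := Phi' ((th - a) / e).
(* A symmetric extension in one formula: for [th <= beta / 2] the reflected angle is at least
   [beta / 2 >= a], so the second term equals [g a] and cancels the third. No smoothness question
   arises at the bisector. *)
pose w (th : R) := g (phi th) + g (phi (beta - th)) - g a.
pose w' (th : R) := g' (phi th) * phi' th - g' (phi (beta - th)) * phi' (beta - th).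
have sphi : smooth1 phi.
  move=> n; apply: CnD; [exact: Cn_cst|apply: CnM; [exact: Cn_cst|apply: (Cn_comp n Phi) => //]].
  by apply: CnM; [apply: CnB; [exact: Cn_id|exact: Cn_cst]|exact: Cn_cst].
have dphi th : is_derive th (1 : R) phi (phi' th).
  have d1 : is_derive th (1 : R) (fun th : R => (th - a) / e) e^-1.
    have := is_deriveM (is_deriveB (is_derive_id th (1:R)) (@is_derive_cst R R R a th 1)) (@is_derive_cst R R R e^-1 th 1).
    by move=> h; apply: (is_derive_eq h); rewrite -![_ *: _]/(_ * _) /= subr0 mulr0 add0r mulr1.
  have d2 := @is_derive1_comp _ Phi (fun th => (th - a) / e) th _ _ (dPhi _) d1.
  have := is_deriveD (@is_derive_cst R R R a th 1) (is_deriveM (@is_derive_cst R R R e th 1) d2).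
  move=> h; apply: (is_derive_eq h); rewrite -![_ *: _]/(_ * _) /= mulr0 addr0 add0r /phi'.
  by rewrite mulrCA mulfV ?gt_eqF// mulr1.
have sw : smooth1 w.
  move=> n; apply: CnB; last exact: Cn_cst.
  apply: CnD; first by apply: (Cn_comp n g).
  apply: (Cn_comp n g) => //; apply: (Cn_comp n phi) => //.
  by apply: CnB; [exact: Cn_cst|exact: Cn_id].
have dw th : is_derive th (1 : R) w (w' th).
  have d1 : is_derive th (1 : R) (fun th : R => beta - th) (-1).
    by have h := is_deriveB (@is_derive_cst R R R beta th 1) (is_derive_id th (1:R)); apply: (is_derive_eq h); rewrite sub0r.
  have d2 := @is_derive1_comp _ phi (fun th => beta - th) th _ _ (dphi _) d1.
  have d3 := @is_derive1_comp _ g (fun th => phi (beta - th)) th _ _ (dg _) d2.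
  have d4 := @is_derive1_comp _ g phi th _ _ (dg _) (dphi th).
  have h := is_deriveB (is_deriveD d4 d3) (@is_derive_cst R R R (g a) th 1).
  by apply: (is_derive_eq h); rewrite /w'; ring.
have phi_id th : th <= a - e -> phi th = th.
  by move=> h; rewrite /phi Phi1; [field; rewrite gt_eqF|rewrite ler_pdivrMr//; lra].
have phi_a th : a <= th -> phi th = a.
  by move=> h; rewrite /phi Phi0 ?mulr0 ?addr0// divr_ge0 ?subr_ge0// ltW.
have wE th : 0 < th < a - e -> w th = g th.
  move=> /andP[h1 h2]; rewrite /w (phi_id th) ?(phi_a (beta - th)); [ring|lra|lra].
have w_sym th : w (beta - th) = w th by rewrite /w subKr; ring.
have w'_sym th : w' (beta - th) ^+ 2 = w' th ^+ 2 by rewrite /w' subKr; ring.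
have ww' := hc w w' (Num.min delta (a - e)) sw dw.
have {}ww' : (c%:E * \int[mu]_(th in `]0%R, beta[) (potential beta th * w th ^+ 2)%:E <=
   \int[mu]_(th in `]0%R, beta[) (w' th ^+ 2)%:E)%E.
  apply: ww'; first by rewrite lt_min d0 subr_gt0.
  have wz th : 0 < th -> th < Num.min delta (a - e) -> w th = 0.
    by move=> h1; rewrite lt_min => /andP[h2 h3]; rewrite wE ?h1// g0 ?h1.
  move=> th /andP[h1 h2] [h3|h3]; first exact: wz.
  by rewrite -w_sym wz//; [lra|move: h3; set m := Num.min _ _ => h3; lra].
have sw' : smooth1 w'.
  have [w1 dw1 sw1] := smooth1_derive _ sw.
  by rewrite (is_derive_unique_fun _ _ _ dw dw1).
have mw'2 : measurable_fun setT (fun th => w' th ^+ 2) by apply: measurable_funX; exact: measurable_smooth1.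
have mVw : measurable_fun setT (fun th => potential beta th * w th ^+ 2).
  by apply: measurable_potential_sqr => //; exact: measurable_smooth1.
have Vw0 th : 0 <= potential beta th * w th ^+ 2 by rewrite mulr_ge0 ?potential_ge0 ?sqr_ge0.
have mVg : measurable_fun setT (fun th => potential beta th * g th ^+ 2).
  by apply: measurable_potential_sqr => //; exact: measurable_smooth1.
have Vg0 th : 0 <= potential beta th * g th ^+ 2 by rewrite mulr_ge0 ?potential_ge0 ?sqr_ge0.
have half : (c%:E * \int[mu]_(th in `]0%R, (beta / 2)%R[) (potential beta th * w th ^+ 2)%:E <=
   \int[mu]_(th in `]0%R, (beta / 2)%R[) (w' th ^+ 2)%:E)%E.
  move: ww'; rewrite !integral_split_half//; last by move=> th; exact: sqr_ge0.
  under [X in (c%:E * (_ + X))%E]eq_integral => th _ do rewrite potential_sym// w_sym.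
  under [X in (_ <= _ + X)%E]eq_integral => th _ do rewrite w'_sym.
  rewrite adde_self; last by apply: integral_ge0 => th _; rewrite lee_fin.
  rewrite adde_self; last by apply: integral_ge0 => th _; rewrite lee_fin sqr_ge0.
  by rewrite muleCA lee_pmul2l// lte_fin.
apply: (@le_trans _ _ (c%:E * \int[mu]_(th in `]0%R, (beta / 2)%R[) (potential beta th * w th ^+ 2)%:E)%E).
  apply: lee_wpmul2l; first by rewrite lee_fin.
  apply: ge0_le_integral_sub => // th /=; rewrite in_itv/= => /andP[h1 h2] _.
  by rewrite wE ?h1//; split => //; rewrite in_itv/= h1/=; lra.
apply: le_trans half _.
(* Before the transition window [w'] is [g'] and after it [w'] is 0; on the window, of length [e], a
   constant bounds its square. This is the origin of the error [K * eps]. *)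
pose h1 (th : R) := g' th ^+ 2 * \1_(`]0, a[%classic : set R) th.
pose h2 (th : R) := M2 * M' * \1_(`[a - e, a]%classic : set R) th.
have mh1 : measurable_fun setT h1.
  by apply: measurable_funM; [apply: measurable_funX; exact: measurable_smooth1|exact: measurable_indic].
have mh2 : measurable_fun setT h2.
  by apply: measurable_funM; [exact: measurable_cst|exact: measurable_indic].
have h10 th : 0 <= h1 th by rewrite mulr_ge0 ?sqr_ge0.
have h20 th : 0 <= h2 th by rewrite !mulr_ge0.
have w'_le th : 0 < th < beta / 2 -> w' th ^+ 2 <= h1 th + h2 th.
  move=> /andP[t1 t2].
  have -> : w' th = g' (phi th) * phi' th.
    rewrite /w' [phi' (beta - th)]Phi'0 ?mulr0 ?subr0// divr_gt0//; lra.
  have [ta|ta] := ltP th (a - e).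
    rewrite phi_id ?(ltW ta)// /phi' Phi'1; last by rewrite ltr_pdivrMr//; lra.
    rewrite mulr1 /h1 indicE mem_set; last by rewrite /= in_itv/= t1; lra.
    by rewrite mulr1 lerDl.
  have [ta'|ta'] := ltP a th.
    by rewrite /phi' Phi'0 ?mulr0 ?expr0n ?addr_ge0// divr_gt0// subr_gt0.
  rewrite -[leLHS]add0r lerD// /h2 indicE mem_set; last by rewrite /= in_itv/= ta ta'.
  rewrite mulr1 exprMn.
  have hs : -1 <= (th - a) / e <= 0.
    by apply/andP; split; [rewrite ler_pdivlMr//; lra|rewrite ler_pdivrMr//; lra].
  have hPhi : `|Phi ((th - a) / e)| <= M + 1.
    rewrite -ler_sqr ?nnegrE ?addr_ge0// real_normK ?num_real//.
    apply: le_trans (hM _ hs) _; nra.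
  apply: ler_pM; rewrite ?sqr_ge0//; last exact: hM'.
  apply: hM2; rewrite -ler_distl /phi addrC addKr normrM gtr0_norm//.
  by apply: ler_pM => //; exact: ltW.
apply: (@le_trans _ _ (\int[mu]_(th in `]0%R, (beta / 2)%R[) ((h1 th)%:E + (h2 th)%:E))%E).
  under [X in (_ <= X)%E]eq_integral => th _ do rewrite -EFinD.
  apply: ge0_le_integral_sub => //.
  - exact: measurable_funD.
  - by move=> th; exact: sqr_ge0.
  - by move=> th; exact: addr_ge0.
  - by move=> th hth _; split=> //; apply: w'_le; move: hth; rewrite /= in_itv.
rewrite ge0_integralD//; last 4 first.
- by move=> th _; rewrite lee_fin.
- by apply/measurable_EFinP; exact: (@measurable_funS _ _ _ _ setT).
- by move=> th _; rewrite lee_fin.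
- by apply/measurable_EFinP; exact: (@measurable_funS _ _ _ _ setT).
apply: leeD.
  apply: ge0_le_integral_sub => //.
  - by apply: measurable_funX; exact: measurable_smooth1.
  - by move=> th; exact: sqr_ge0.
  - move=> th _; rewrite /h1 indicE; case: (boolP (th \in _)); last by rewrite mulr0 ltxx.
    by rewrite inE mulr1.
apply: (@le_trans _ _ (\int[mu]_(th in `[(a - e)%R, a]) (cst (M2 * M') th)%:E)%E).
  apply: ge0_le_integral_sub => //.
  - by move=> th; rewrite /= mulr_ge0.
  - move=> th _; rewrite /h2 indicE; case: (boolP (th \in _)); last by rewrite mulr0 ltxx.
    by rewrite inE mulr1.
have -> : (\int[mu]_(th in `[(a - e)%R, a]) (cst (M2 * M') th)%:E = (M2 * M')%:E * mu `[(a - e)%R, a])%E.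
  by rewrite -(@integral_cst _ _ R mu _ (measurable_itv `[a - e, a])).
rewrite lebesgue_measure_itv/= lte_fin.
have -> : a - e < a by lra.
by rewrite -EFinB -EFinM subKr.
Qed.

(** Two limits: on a fixed interval ending at [a - eta] the error [K * eps] tends to 0, and then
    monotone convergence lets [eta] tend to 0. *)
Lemma half_hardy c g g' (delta a : R) : 0 <= c -> angular_hardy beta c -> smooth1 g ->
  (forall t, is_derive t (1 : R) g (g' t)) -> smooth1 g' -> 0 < delta ->
  (forall th, 0 < th < delta -> g th = 0) -> 0 < a <= beta / 2 ->
  (c%:E * \int[mu]_(th in `]0%R, a[) (potential beta th * g th ^+ 2)%:E <=
     \int[mu]_(th in `]0%R, a[) (g' th ^+ 2)%:E)%E.
Proof.
move=> c0 hc sg dg sg' d0 g0 hab.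
have [K K0 hK] := angular_freeze c g g' delta a c0 hc sg dg sg' d0 g0 hab.
have /andP[a0 ab] := hab.
have mVg : measurable_fun setT (fun th => potential beta th * g th ^+ 2).
  by apply: measurable_potential_sqr => //; exact: measurable_smooth1.
have Vg0 th : 0 <= potential beta th * g th ^+ 2 by rewrite mulr_ge0 ?potential_ge0 ?sqr_ge0.
have mE (D : set R) (f : R -> R) : measurable D -> measurable_fun setT f -> measurable_fun D (EFin \o f).
  by move=> mD mf; apply/measurable_EFinP; exact: (@measurable_funS _ _ _ _ setT).
set G := (\int[mu]_(th in _) (g' th ^+ 2)%:E)%E in hK *.
have below eta : 0 < eta < a ->
    (c%:E * \int[mu]_(th in `]0%R, (a - eta)%R[) (potential beta th * g th ^+ 2)%:E <= G)%E.
  move=> /andP[eta0 etaa]; apply/lee_addgt0Pr => s s0.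
  have K1 : 0 < K + 1 by rewrite ltr_wpDl.
  pose e := Num.min eta (s / (K + 1)).
  have e0 : 0 < e by rewrite lt_min eta0 divr_gt0.
  have ee : e <= eta by rewrite ge_min lexx.
  have es : K * e <= s.
    apply: (@le_trans _ _ (K * (s / (K + 1)))); first by rewrite ler_wpM2l// ge_min lexx orbT.
    by rewrite mulrA ler_pdivrMr// mulrDr mulr1 mulrC lerDl ltW.
  have ea : 0 < e < a by rewrite e0; exact: le_lt_trans ee etaa.
  apply: (@le_trans _ _ (c%:E * \int[mu]_(th in `]0%R, (a - e)%R[) (potential beta th * g th ^+ 2)%:E)%E).
    apply: lee_wpmul2l; first by rewrite lee_fin.
    apply: ge0_le_integral_sub => // th /=; rewrite !in_itv/= => /andP[-> h2] _; split => //=.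
    by apply: lt_le_trans h2 _; rewrite lerD2l lerN2.
  by apply: le_trans (hK e ea) _; rewrite leeD2l// lee_fin.
rewrite -ge0_integralZl//; last 2 first.
- exact: mE.
- by move=> th _; rewrite lee_fin.
(* The shift to [n.+2] keeps [a / n.+2] strictly below [a], as [below] requires. *)
pose F (n : nat) : set R := `]0, (a - a / n.+2%:R)[%classic.
have a_n (n : nat) : 0 < a / n.+2%:R < a.
  rewrite divr_gt0// ltr_pdivrMr// -[ltLHS]mulr1 ltr_pM2l// -[ltLHS]/(1%:R) ltr_nat//.
have nF : {homo F : n m / (n <= m)%N >-> (n <= m)%O}.
  move=> n m nm; apply/subsetPset => th; rewrite /F /= !in_itv/= => /andP[-> h]/=.
  apply: lt_le_trans h _; rewrite lerD2l lerN2 ler_pM2l// lef_pV2 ?posrE// ler_nat.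
  by rewrite !ltnS.
have UF : `]0, a[%classic = \bigcup_n F n.
  apply/seteqP; split=> th /=; last first.
    move=> [n _]; rewrite /F /= !in_itv/= => /andP[-> h]/=.
    by have /andP[] := a_n n; move: h; set z := a / _; lra.
  rewrite in_itv/= => /andP[t0 ta].
  have ta' : 0 < (a - th) / a by rewrite divr_gt0// subr_gt0.
  have [n _ hn] := near_infty_natSinv_lt (PosNum ta').
  exists n => //; rewrite /F /= in_itv/= t0/=.
  have h1 := hn n (leqnn n); rewrite /= in h1.
  have h2 : n.+2%:R^-1 < (a - th) / a.
    by apply: le_lt_trans h1; rewrite lef_pV2 ?posrE// ler_nat.
  by move: h2; rewrite ltr_pdivlMr// mulrC => h2; rewrite ltrBrDr addrC -ltrBrDr.
have f0 th : (0 <= c%:E * (potential beta th * g th ^+ 2)%:E)%E by rewrite mule_ge0// lee_fin.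
have mf (D : set R) : measurable D -> measurable_fun D (fun th => (c%:E * (potential beta th * g th ^+ 2)%:E)%E).
  by move=> mD; apply: emeasurable_funM; [exact: measurable_cst|exact: mE].
have cv : (\int[mu]_(th in F i) (c%:E * (potential beta th * g th ^+ 2)%:E))%E @[i --> \oo] -->
    (\int[mu]_(th in \bigcup_i F i) (c%:E * (potential beta th * g th ^+ 2)%:E))%E.
  apply: ge0_nondecreasing_set_cvg_integral => //.
  - by move=> i; exact: measurable_itv.
  - by move=> i; apply: mf; exact: measurable_itv.
rewrite UF -(cvg_lim _ cv)//.
apply: lime_le; first by apply/cvg_ex; eexists; exact: cv.
apply: nearW => n; rewrite ge0_integralZl//.
- exact: below.
- exact: measurable_itv.
- by apply: mE => //; exact: measurable_itv.
- by move=> th _; rewrite lee_fin.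
Qed.

End half_interval.

(** * From arcs to plane sets *)

Section sector_inequality.
Context {R : realType}.
Local Notation mu := (@lebesgue_measure R).
Variable beta : R.
Hypothesis hbeta : pi < beta <= 2 * pi.
Let beta_bounds : [/\ 0 < pi :> R, 0 < beta & beta <= 2 * pi].
Proof. by have := hbeta; have := @pi_gt0 R; move=> ? /andP[? ?]; split; lra. Qed.
Local Notation dL p := (dist_set p (bdry (Lambda beta))).
Implicit Types (E : set (R * R)) (u : R * R -> R) (p : R -> R * R).

(* The curve [p] meets [E] exactly along an initial arc (up to its end point), and [u]
   vanishes along [p] near its start. *)
Definition initial_arc E u p := exists a delta : R, [/\ 0 <= a <= beta / 2, 0 < delta,
  forall th, 0 < th < a -> E (p th), forall th, 0 < th < beta / 2 -> E (p th) -> th <= a &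
  0 < a -> forall th, 0 < th < delta -> u (p th) = 0].

Lemma arc_hardy c E u p g' : 0 <= c -> angular_hardy beta c ->
  measurable_fun setT (fun th => \1_E (p th) : R) -> smooth1 (fun th => u (p th)) ->
  (forall t, is_derive t (1 : R) (fun th => u (p th)) (g' t)) -> smooth1 g' ->
  initial_arc E u p ->
  (c%:E * \int[mu]_(th in `]0%R, (beta / 2)%R[) (potential beta th * u (p th) ^+ 2 * \1_E (p th))%:E <=
   \int[mu]_(th in `]0%R, (beta / 2)%R[) (g' th ^+ 2 * \1_E (p th))%:E)%E.
Proof.
move=> c0 hc mE sg dg sg' [a [delta [/andP[a0 ab] d0 sub sup van]]].
have mg'2 : measurable_fun setT (fun th => g' th ^+ 2).
  by apply: measurable_funX; exact: measurable_smooth1.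
have mVg : measurable_fun setT (fun th => potential beta th * u (p th) ^+ 2).
  by apply: measurable_potential_sqr => //; exact: measurable_smooth1.
have Vg0 th : 0 <= potential beta th * u (p th) ^+ 2 by rewrite mulr_ge0 ?potential_ge0 ?sqr_ge0.
have indP (x : R) th : 0 < x * \1_E (p th) -> E (p th).
  by rewrite indicE; case: (boolP (p th \in E)); [rewrite inE|rewrite mulr0 ltxx].
have up : (\int[mu]_(th in `]0%R, (beta / 2)%R[) (potential beta th * u (p th) ^+ 2 * \1_E (p th))%:E <=
    \int[mu]_(th in `]0%R, a]) (potential beta th * u (p th) ^+ 2)%:E)%E.
  apply: ge0_le_integral_sub => //.
  - exact: measurable_funM.
  - by move=> th; rewrite mulr_ge0.
  - move=> th /=; rewrite !in_itv/= => hth /indP hE; split.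
      by have /andP[-> _] := hth; exact: sup.
    by rewrite indicE mem_set// mulr1.
apply: (@le_trans _ _ (c%:E * \int[mu]_(th in `]0%R, a]) (potential beta th * u (p th) ^+ 2)%:E)%E).
  by apply: lee_wpmul2l => //; rewrite lee_fin.
(* An empty arc: nothing is known about [u] at its start, but the bound on the potential term is an
   integral over an empty interval. *)
move: a0; rewrite le_eqVlt => /predU1P[<-|a0].
  rewrite set_itvoc0 ?integral_set0 ?mule0.
  by apply: integral_ge0 => th _; rewrite lee_fin mulr_ge0 ?sqr_ge0.
rewrite -integral_itv_bndo_bndc; last first.
  by apply/measurable_EFinP; exact: (@measurable_funS _ _ _ _ setT).
have a0b : 0 < a <= beta / 2 by rewrite a0.
apply: le_trans (half_hardy beta hbeta c _ g' delta a c0 hc sg dg sg' d0 (van a0) a0b) _.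
apply: ge0_le_integral_sub => //.
- exact: measurable_funM.
- by move=> th; exact: sqr_ge0.
- by move=> th; rewrite mulr_ge0 ?sqr_ge0.
- move=> th /=; rewrite !in_itv/= => hth _; split.
    by have /andP[-> h] := hth; exact: lt_le_trans h ab.
  by rewrite indicE mem_set ?mulr1//; exact: sub.
Qed.

Lemma measurable_circle (rho : R) (F : R * R -> R) :
  measurable_fun [set: measurableTypeR R * measurableTypeR R] F ->
  measurable_fun setT (fun th => F (polar rho th)).
Proof.
move=> mF; have m1 : measurable_fun [set: measurableTypeR R] (fun th : R => (rho, th)).
  exact: measurable_fun_pair.
exact: (measurableT_comp (measurableT_comp mF measurable_polar) m1).
Qed.

Lemma sector_hardy c E u : 0 <= c -> angular_hardy beta c ->
  measurable (E : set (measurableTypeR R * measurableTypeR R)) -> E `<=` Lambda beta -> smooth2 u ->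
  (forall rho, 0 < rho -> initial_arc E u (polar rho)) ->
  (forall rho, 0 < rho -> initial_arc E u (fun th => polar rho (beta - th))) ->
  (c%:E * \int[@leb2 R]_(q in E) (u q ^+ 2 / (dL q) ^+ 2)%:E <= \int[@leb2 R]_(q in E) (grad_sq u q)%:E)%E.
Proof.
move=> c0 hc mE EL su arc1 arc2; have [_ b0 _] := beta_bounds.
pose H (q : R * R) : R := u q ^+ 2 / (dL q) ^+ 2.
have mH : measurable_fun [set: measurableTypeR R * measurableTypeR R] H.
  by apply: measurable_hardy_density => //; exact: smooth2_continuous.
have H0 q : 0 <= H q by exact: sqr_div_ge0.
change (c%:E * \int[@leb2 R]_(q in E) (H q)%:E <= \int[@leb2 R]_(q in E) (grad_sq u q)%:E)%E.
have mG : measurable_fun [set: measurableTypeR R * measurableTypeR R] (grad_sq u).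
  exact: measurable_grad_sq.
have G0 q : 0 <= grad_sq u q by exact: grad_sq_ge0.
rewrite (integral_sector beta hbeta E H mE EL mH H0) (integral_sector beta hbeta E _ mE EL mG G0).
have mS (F : R * R -> R) : measurable_fun [set: measurableTypeR R * measurableTypeR R] F -> (forall q, 0 <= F q) ->
    measurable_fun (`]0, +oo[ : set R) (fun rho => \int[mu]_(th in `]0%R, beta[) (sector_density E F rho th)%:E)%E.
  by move=> mF F0; apply: (@measurable_funS _ _ _ _ setT) => //; exact: measurable_sector_slice.
have S0 (F : R * R -> R) rho : (forall q, 0 <= F q) -> (0 <= \int[mu]_(th in `]0%R, beta[) (sector_density E F rho th)%:E)%E.
  by move=> F0; apply: integral_ge0 => th _; rewrite lee_fin sector_density_ge0.
rewrite -ge0_integralZl//; last 2 first.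
- exact: mS.
- by move=> rho _; exact: S0.
apply: ge0_le_integral => //.
- by move=> rho _; rewrite mule_ge0 ?lee_fin//; exact: S0.
- by apply: emeasurable_funM; [exact: measurable_cst|exact: mS].
- exact: mS.
move=> rho /=; rewrite in_itv/= andbT => rho0.
have mI : measurable_fun [set: measurableTypeR R * measurableTypeR R] (\1_E : R * R -> R).
  exact: measurable_indic.
have msd (F : R * R -> R) : measurable_fun [set: measurableTypeR R * measurableTypeR R] F ->
    measurable_fun setT (fun th => sector_density E F rho th).
  move=> mF; apply: measurable_funM => //; apply: measurable_funM; exact: measurable_circle.
have sd0 (F : R * R -> R) th : (forall q, 0 <= F q) -> 0 <= sector_density E F rho th.
  by move=> F0; exact: sector_density_ge0.
have split (F : R * R -> R) mF F0 := integral_split_half beta hbeta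
  (fun th => sector_density E F rho th) (msd F mF) (fun th => sd0 F th F0).
rewrite (split _ mH H0) (split _ mG G0).
have [g' [sg sg' dg hg']] := angular_slice u rho su.
have mrefl : measurable_fun setT (fun th : R => beta - th).
  by apply: measurable_funB.
have rhoV0 : 0 <= rho^-1 by rewrite invr_ge0 ltW.
(* [s] will be the identity or the reflection, so that each half of the circle is run through from
   its own side towards the bisector. *)
have half (s h' : R -> R) : (forall th, 0 < th < beta -> 0 < s th < beta) ->
    (forall th, potential beta (s th) = potential beta th) ->
    measurable_fun setT s -> (forall th, h' th ^+ 2 = g' (s th) ^+ 2) ->
    smooth1 (fun th => u (polar rho (s th))) ->
    (forall t, is_derive t (1 : R) (fun th => u (polar rho (s th))) (h' t)) -> smooth1 h' ->
    initial_arc E u (fun th => polar rho (s th)) ->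
    (c%:E * \int[mu]_(th in `]0%R, (beta / 2)%R[) (sector_density E H rho (s th))%:E <=
     \int[mu]_(th in `]0%R, (beta / 2)%R[) (sector_density E (grad_sq u) rho (s th))%:E)%E.
  move=> s_b Vs ms h'E ss ds sh' arc.
  have mE' : measurable_fun setT (fun th => \1_E (polar rho (s th)) : R).
    exact: (measurableT_comp (measurable_circle rho _ mI) ms).
  have key := arc_hardy c E u _ h' c0 hc mE' ss ds sh' arc.
  have mh'2 : measurable_fun setT (fun th => h' th ^+ 2 * \1_E (polar rho (s th))).
    by apply: measurable_funM => //; apply: measurable_funX; exact: measurable_smooth1.
  have mVg : measurable_fun setT (fun th => potential beta th * u (polar rho (s th)) ^+ 2 * \1_E (polar rho (s th))).
    by apply: measurable_funM => //; apply: measurable_potential_sqr => //; exact: measurable_smooth1.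
  have p1 th : 0 <= potential beta th * u (polar rho (s th)) ^+ 2 * \1_E (polar rho (s th)).
    by apply: mulr_ge0 => //; apply: mulr_ge0; [exact: potential_ge0|exact: sqr_ge0].
  have p2 th : 0 <= h' th ^+ 2 * \1_E (polar rho (s th)) by rewrite mulr_ge0 ?sqr_ge0.
  have Zl (f : R -> R) : measurable_fun setT f -> (forall x, 0 <= f x) ->
      (\int[mu]_(th in `]0%R, (beta / 2)%R[) (rho^-1 * f th)%:E = (rho^-1)%:E * \int[mu]_(th in `]0%R, (beta / 2)%R[) (f th)%:E)%E.
    move=> mf f0; rewrite -ge0_integralZl//.
    - by apply/measurable_EFinP; exact: (@measurable_funS _ _ _ _ setT).
    - by move=> th _; rewrite lee_fin.
  have -> : (\int[mu]_(th in `]0%R, (beta / 2)%R[) (sector_density E H rho (s th))%:E =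
      (rho^-1)%:E * \int[mu]_(th in `]0%R, (beta / 2)%R[) (potential beta th * u (polar rho (s th)) ^+ 2 * \1_E (polar rho (s th)))%:E)%E.
    rewrite -Zl//; apply: eq_integral => th _; congr EFin.
    rewrite /sector_density /H hardy_weight_polar// Vs gtr0_norm//.
    have alg (A P I r : R) : 0 < r -> A * (P * r ^- 2) * I * r = r^-1 * (P * A * I).
      by move=> r0; field; rewrite gt_eqF.
    exact: (alg _ _ _ rho rho0).
  rewrite muleCA; apply: (@le_trans _ _ ((rho^-1)%:E * \int[mu]_(th in `]0%R, (beta / 2)%R[) (h' th ^+ 2 * \1_E (polar rho (s th)))%:E)%E).
    by apply: lee_wpmul2l => //; rewrite lee_fin.
  rewrite -Zl//; apply: ge0_le_integral_sub => //.
  - exact: measurable_funM.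
  - exact: (measurableT_comp (msd _ mG) ms).
  - by move=> th; rewrite mulr_ge0.
  - by move=> th; exact: sd0.
  - move=> th hth _; split=> //; rewrite /sector_density h'E gtr0_norm//.
    have alg (A G I r : R) : 0 < r -> 0 <= I -> A <= r ^+ 2 * G -> r^-1 * (A * I) <= G * I * r.
      move=> r0 I0 AG; rewrite mulrC ler_pdivrMr//.
      by apply: le_trans (ler_wpM2r I0 AG) _; rewrite le_eqVlt; apply/orP; left; apply/eqP; ring.
    by apply: alg => //; exact: hg'.
rewrite ge0_muleDr; last 2 first.
- by apply: integral_ge0 => th _; rewrite lee_fin sd0.
- by apply: integral_ge0 => th _; rewrite lee_fin sd0.
apply: leeD.
- by apply: (half id g') => //; exact: arc1.
- apply: (half (fun th => beta - th) (fun th => - g' (beta - th))) => //.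
  + by move=> th /andP[h1 h2]; apply/andP; split; lra.
  + by move=> th; exact: potential_sym.
  + by move=> th; rewrite sqrrN.
  + by move=> n; apply: (Cn_comp n (fun th => u (polar rho th))) => //; apply: CnB; [exact: Cn_cst|exact: Cn_id].
  + move=> th; have d1 : is_derive th (1 : R) (fun th : R => beta - th) (-1).
      by have h := is_deriveB (@is_derive_cst R R R beta th 1) (is_derive_id th (1:R)); apply: (is_derive_eq h); rewrite sub0r.
    have h := @is_derive1_comp _ (fun th => u (polar rho th)) (fun th => beta - th) th _ _ (dg _) d1.
    by apply: (is_derive_eq h); rewrite mulrN1.
  + by move=> n; apply: CnN; apply: (Cn_comp n g') => //; apply: CnB; [exact: Cn_cst|exact: Cn_id].
  + exact: arc2.
Qed.

End sector_inequality.

(** * The full sector and the truncated sector *)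

Section domains.
Context {R : realType}.
Local Notation mu := (@lebesgue_measure R).
Variable beta : R.
Hypothesis hbeta : pi < beta <= 2 * pi.
Let beta_bounds : [/\ 0 < pi :> R, 0 < beta & beta <= 2 * pi].
Proof. by have := hbeta; have := @pi_gt0 R; move=> ? /andP[? ?]; split; lra. Qed.
Local Notation dL p := (dist_set p (bdry (Lambda beta))).
Implicit Types (E K : set (R * R)) (u : R * R -> R) (p : R -> R * R).

Lemma continuous_circle (rho : R) : continuous (fun th : R => polar rho th).
Proof.
move=> th; have c1 : {for th, continuous (fun th : R => (rho, th))}.
  exact: (cvg_pair (cvg_cst rho) (@cvg_id _ (nbhs th))).
exact: (continuous_comp c1 (@continuous_polar R (rho, th))).
Qed.

Lemma continuous_circle_rev (rho : R) : continuous (fun th : R => polar rho (beta - th)).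
Proof.
move=> th; have c1 : {for th, continuous (fun th : R => beta - th)}.
  by apply: continuousB; [exact: cvg_cst|exact: cvg_id].
exact: (continuous_comp c1 (@continuous_circle rho _)).
Qed.

Lemma curve_near_start (A : set (R * R)) p : continuous p -> nbhs (p 0) A ->
  exists2 delta : R, 0 < delta & forall th, 0 < th < delta -> A (p th).
Proof.
move=> cp nA; have [d /= d0 hd] := cp 0 A nA.
exists d => // th /andP[h1 h2]; apply: hd => /=.
by rewrite sub0r normrN gtr0_norm.
Qed.

(** Converse of [hardy_angular]. Here both arcs are full halves, [a = beta / 2], and compactness of
    the support keeps [u] zero near the sides. *)
Lemma angular_hardy_sector c : 0 <= c -> angular_hardy beta c -> hardy_ineq (Lambda beta) c.
Proof.
move=> c0 hc u [su [K [cK [KL uK]]]]; have [_ b0 _] := beta_bounds.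
have clK : closed K by apply: compact_closed => //; exact: norm_hausdorff.
have arc p : continuous p -> ~ Lambda beta (p 0) ->
    (forall th, 0 < th < beta -> Lambda beta (p th)) -> initial_arc beta (Lambda beta) u p.
  move=> cp p0 pL; have nK : nbhs (p 0) (~` K).
    by apply: open_nbhs_nbhs; split; [rewrite openC|move=> /KL].
  have [delta d0 hd] := curve_near_start _ _ cp nK.
  exists (beta / 2), delta; split => //.
  - by apply/andP; split; lra.
  - by move=> th /andP[h1 h2]; apply: pL; apply/andP; split; lra.
  - by move=> th /andP[h1 h2] _; exact: ltW.
  - by move=> _ th /hd; exact: uK.
apply: (sector_hardy beta hbeta) => //.
- exact: measurable_Lambda.
- move=> rho r0; apply: arc.
  + exact: continuous_circle.
  + by apply: rays_notin_Lambda => //; left; exists rho => //=; exact: ltW.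
  + by move=> th hth; exists rho, th.
- move=> rho r0; apply: arc.
  + exact: continuous_circle_rev.
  + by rewrite subr0; apply: rays_notin_Lambda => //; right; exists rho => //=; exact: ltW.
  + by move=> th /andP[h1 h2]; exists rho, (beta - th); split => //; split => //; apply/andP; split; lra.
Qed.

Section truncated_sector.
Variables (r : R -> R) (L : R).
Hypotheses (r0 : forall th, 0 <= th <= beta -> 0 < r th)
  (rL : forall x y, 0 <= x <= beta -> 0 <= y <= beta -> `|r x - r y| <= L * `|x - y|)
  (r_dec : forall x y, 0 <= x -> x <= y -> y <= beta / 2 -> r y <= r x)
  (r_inc : forall x y, beta / 2 <= x -> x <= y -> y <= beta -> r x <= r y).
Local Notation D := (Dom beta r).
Local Notation dG q := (dist_set q (Gamma0 beta r)).

Lemma Dom_sub_Lambda : D `<=` Lambda beta.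
Proof. by move=> q [rho [th [hth [/andP[h1 h2] ->]]]]; exists rho, th. Qed.

Lemma Dom_polar (rho th : R) : 0 < rho -> 0 < th < beta -> D (polar rho th) <-> rho < r th.
Proof.
move=> rho0 hth; have /andP[_ b2] := hbeta; split; last first.
  by move=> h; exists rho, th; rewrite rho0 h.
have lt2pi t : 0 < t < beta -> 0 < t < 2 * pi.
  by move=> /andP[-> h]/=; exact: lt_le_trans h b2.
move=> [s [t [ht [/andP[s0 st] e]]]].
have e1 : rho = s by have := congr1 nrm e; rewrite !nrm_polar !gtr0_norm.
have e2 : th = t by have := congr1 arg e; rewrite !arg_polar//; exact: lt2pi.
by rewrite e1 e2.
Qed.

Lemma open_Dom : open D.
Proof.
rewrite openE => q Dq; have Lq := Dom_sub_Lambda _ Dq.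
have sq : slit q by move: Lq; rewrite LambdaE// => -[].
move: (Lq); rewrite LambdaE// => -[_ aq].
have /andP[a0 _] := arg_bounds q.
have q0 := slit_nrm_gt0 _ sq.
have rq : nrm q < r (arg q).
  by apply/(Dom_polar _ _ q0); [rewrite a0|rewrite -polar_arg].
(* For [q'] in the sector the Lipschitz bound makes [gap q'] at most [r (arg q') - nrm q']; its
   continuity at [q] involves no value of [r] other than [r (arg q)]. *)
pose gap (q' : R * R) := r (arg q) - L * `|arg q - arg q'| - nrm q'.
have cgap : {for q, continuous gap}.
  apply: continuousB; last exact: continuous_nrm.
  apply: continuousB; first exact: cvg_cst.
  apply: continuousM; first exact: cvg_cst.
  apply: continuous_comp; last exact: norm_continuous.
  by apply: continuousB; [exact: cvg_cst|exact: continuous_arg].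
have gq : 0 < gap q by rewrite /gap subrr normr0 mulr0 subr0 subr_gt0.
have ng : nbhs q (gap @^-1` [set x | 0 < x]) by apply: cgap; apply: open_nbhs_nbhs; split; [exact: open_gt|].
have nL : nbhs q (Lambda beta) by apply: open_nbhs_nbhs; split => //; exact: open_Lambda.
near=> q'.
have gq' : 0 < gap q' by near: q'.
have Lq' : Lambda beta q' by near: q'.
have sq' : slit q' by move: Lq'; rewrite LambdaE// => -[].
move: (Lq'); rewrite LambdaE// => -[_ aq'].
have /andP[a0' _] := arg_bounds q'.
rewrite (polar_arg _ sq'); apply/Dom_polar; first exact: slit_nrm_gt0.
  by rewrite a0'.
have := rL (arg q) (arg q') ltac:(by rewrite !ltW) ltac:(by rewrite !ltW).
move: gq'; rewrite /gap; have := ler_norm (r (arg q) - r (arg q')); lra.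
Unshelve. all: by end_near. Qed.

Lemma measurable_Dom : measurable (D : set (measurableTypeR R * measurableTypeR R)).
Proof. by apply: open_measurable_prod; exact: open_Dom. Qed.

Lemma initial_arc_nonincreasing E u p (rho : R) (f : R -> R) :
  (forall x y, 0 <= x -> x <= y -> y <= beta / 2 -> f y <= f x) ->
  (forall th, 0 < th < beta / 2 -> E (p th) <-> rho < f th) ->
  (rho < f 0 -> exists2 delta : R, 0 < delta & forall th, 0 < th < delta -> u (p th) = 0) ->
  initial_arc beta E u p.
Proof.
move=> f_dec Ef u0; have [_ b0 _] := beta_bounds.
(* Adjoining 0 keeps [A] nonempty; [sup A = 0] is the case of a curve that misses [E]. *)
pose A := [set th : R | 0 <= th <= beta / 2 /\ (th = 0 \/ rho < f th)].
have A0 : A 0 by split; [apply/andP; split; lra|left].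
have ubA : ubound A (beta / 2) by move=> th [/andP[]].
have hA : has_sup A by split; [exists 0|exists (beta / 2)].
have a0 : 0 <= sup A by exact: (sup_upper_bound hA).
have ab : sup A <= beta / 2 by apply: ge_sup => //; exists 0.
have below th : 0 <= th -> th < sup A -> rho < f th.
  move=> th0 tha; have t0 : 0 < sup A - th by rewrite subr_gt0.
  have [s [/andP[s0 sb] sf]] := sup_adherent t0 hA; rewrite subKr => ths.
  case: sf => [s00|sf]; first by move: ths; rewrite s00 ltNge th0.
  by apply: lt_le_trans sf _; apply: f_dec => //; exact: ltW.
have [delta d0 hd] : exists2 delta : R, 0 < delta &
    0 < sup A -> forall th, 0 < th < delta -> u (p th) = 0.
  have [sA|sA] := ltP 0 (sup A); last by exists 1.
  by have [delta d0 hd] := u0 (below 0 (lexx _) sA); exists delta.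
exists (sup A), delta; split => //.
- by rewrite a0.
- move=> th /andP[h1 h2]; apply/Ef; first by rewrite h1; exact: lt_le_trans h2 ab.
  by apply: below => //; exact: ltW.
- move=> th hth /(Ef _ hth) h; apply: (sup_upper_bound hA).
  by split; [have /andP[h1 h2] := hth; rewrite !ltW|right].
Qed.

Lemma r_end_gt0 : 0 < r 0 /\ 0 < r beta.
Proof. by have [_ b0 _] := beta_bounds; split; apply: r0; rewrite lexx ltW. Qed.

Lemma Dom_hardy c u eps : 0 <= c -> angular_hardy beta c -> smooth2 u -> 0 < eps ->
  (forall q, dG q < eps -> u q = 0) ->
  (c%:E * \int[@leb2 R]_(q in D) (u q ^+ 2 / (dG q) ^+ 2)%:E <= \int[@leb2 R]_(q in D) (grad_sq u q)%:E)%E.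
Proof.
move=> c0 hc su e0 ue; have [_ b0 _] := beta_bounds; have [r00 rb0] := r_end_gt0.
have cG : continuous (fun q => dG q) by apply: continuous_dist_set; exact: Gamma0_neq0.
(* A circle of radius below [r 0] (or [r beta], from the other side) starts on [Gamma0], so it stays
   for a while in the zone [dG q < eps]. *)
have vanish p : continuous p -> Gamma0 beta r (p 0) ->
    exists2 delta : R, 0 < delta & forall th, 0 < th < delta -> u (p th) = 0.
  move=> cp p0; have nA : nbhs (p 0) [set q | dG q < eps].
    have := cG (p 0) [set x | x < eps]; apply; apply: lt_nbhsl.
    apply: le_lt_trans e0; apply: le_trans (dist_set_le _ _ _ p0) _.
    by rewrite /Defs.edist !subrr expr0n/= addr0 sqrtr0.
  have [delta d0 hd] := curve_near_start _ _ cp nA.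
  by exists delta => // th /hd /ue.
apply: (@le_trans _ _ (c%:E * \int[@leb2 R]_(q in D) (u q ^+ 2 / (dL q) ^+ 2)%:E)%E).
  apply: lee_wpmul2l; first by rewrite lee_fin.
  apply: ge0_le_integral_sub.
  - exact: measurable_Dom.
  - exact: measurable_Dom.
  - apply: measurable_funM.
      apply: measurable_funX; apply: continuous_measurable_prod; exact: smooth2_continuous.
    apply: (measurableT_comp measurable_invr); apply: measurable_funX.
    exact: continuous_measurable_prod.
  - by apply: measurable_hardy_density => //; exact: smooth2_continuous.
  - by move=> q; exact: sqr_div_ge0.
  - by move=> q; exact: sqr_div_ge0.
  - move=> q Dq _; split => //; rewrite ler_wpM2l ?sqr_ge0//.
    have dL0 := dist_Lambda_gt0 beta hbeta q (Dom_sub_Lambda _ Dq).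
    have dLG := dist_Lambda_le_Gamma0 beta hbeta r r00 q.
    have dG0 := lt_le_trans dL0 dLG.
    by rewrite lef_pV2 ?posrE ?exprn_gt0// lerXn2r ?nnegrE ?(ltW dL0) ?(ltW dG0).
apply: (sector_hardy beta hbeta) => //.
- exact: measurable_Dom.
- exact: Dom_sub_Lambda.
- move=> rho rho0; apply: (initial_arc_nonincreasing _ _ _ rho r) => //.
    by move=> th /andP[h1 h2]; apply: Dom_polar => //; apply/andP; split; lra.
  move=> h; apply: vanish; first exact: continuous_circle.
  by left; exists rho; [rewrite /= !ltW|rewrite /polar cos0 sin0 mulr1 mulr0].
- move=> rho rho0; apply: (initial_arc_nonincreasing _ _ _ rho (fun th => r (beta - th))).
  + by move=> x y x0 xy yb; apply: r_inc; lra.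
  + by move=> th /andP[h1 h2]; apply: Dom_polar => //; apply/andP; split; lra.
  + rewrite subr0 => h; apply: vanish; first exact: continuous_circle_rev.
    by rewrite subr0; right; exists rho => //; rewrite /= !ltW.
Qed.

End truncated_sector.

End domains.

(** * The best constant *)

Section best_constant.
Context {R : realType}.
Local Notation mu := (@lebesgue_measure R).
Variable beta : R.
Hypothesis hbeta : pi < beta <= 2 * pi.
Let beta_bounds : [/\ 0 < pi :> R, 0 < beta & beta <= 2 * pi].
Proof. by have := hbeta; have := @pi_gt0 R; move=> ? /andP[? ?]; split; lra. Qed.
Local Notation dL p := (dist_set p (bdry (Lambda beta))).
Let H := [set c : R | 0 <= c /\ hardy_ineq (Lambda beta) c].

Lemma hardy_constants0 : H 0.
Proof.
split=> // u _; rewrite mul0e; apply: integral_ge0 => q _; rewrite lee_fin.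
exact: grad_sq_ge0.
Qed.

(** Without a bound, [sup] would only be a default value. A bump [w] around the bisector gives one:
    as the potential is at least 1, every admissible [c] is at most the ratio of the integrals of
    [w'^2] and [w^2]. *)
Lemma hardy_constants_has_sup : has_sup H.
Proof.
split; first by exists 0; exact: hardy_constants0.
have [_ b0 _] := beta_bounds.
have [chi [schi chi01 chi1 chi0]] := @cutoff_bump R.
(* The factor [8 / beta] makes [w] equal to 1 within [beta / 8] of the bisector and 0 beyond
   [beta / 4]. *)
pose w (th : R) := chi ((th - beta / 2) * (8 / beta)).
have sw : smooth1 w.
  move=> n; apply: (Cn_comp n chi) => //.
  by apply: CnM; [apply: CnB; [exact: Cn_id|exact: Cn_cst]|exact: Cn_cst].
have [w' dw sw'] := smooth1_derive _ sw.
have mw2 : measurable_fun setT (fun th => w th ^+ 2).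
  by apply: measurable_funX; exact: measurable_smooth1.
have aw th : 0 < th < beta -> th < beta / 4 \/ beta - beta / 4 < th -> w th = 0.
  have dv : 2 = beta / 4 * (8 / beta) by field; rewrite gt_eqF.
  have k0 : 0 < 8 / beta by rewrite divr_gt0.
  move=> _ hth; apply: chi0; rewrite normrM (gtr0_norm k0) {1}dv ler_pM2r// ler_normr.
  by apply/orP; case: hth => h; [right|left]; lra.
have b4 : 0 < beta / 4 by rewrite divr_gt0.
set W0 := (\int[mu]_(th in `]0%R, beta[) (w th ^+ 2)%:E)%E.
set W1 := (\int[mu]_(th in `]0%R, beta[) (w' th ^+ 2)%:E)%E.
have f0 : (W0 \is a fin_num)%E by exact: smooth1_integral_fin.
have f1 : (W1 \is a fin_num)%E by exact: smooth1_integral_fin.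
have W0_gt0 : (0 < W0)%E.
  apply: (@lt_le_trans _ _ (\int[mu]_(th in `[(beta / 2 - beta / 8)%R, (beta / 2 + beta / 8)%R]) (cst 1 th)%:E)%E).
    have -> : (\int[mu]_(th in `[(beta / 2 - beta / 8)%R, (beta / 2 + beta / 8)%R]) (cst 1 th)%:E = 1%:E * mu `[(beta / 2 - beta / 8)%R, (beta / 2 + beta / 8)%R])%E.
      by rewrite -(@integral_cst _ _ R mu _ (measurable_itv `[beta / 2 - beta / 8, beta / 2 + beta / 8])).
    rewrite lebesgue_measure_itv/= lte_fin.
    have -> : beta / 2 - beta / 8 < beta / 2 + beta / 8 by lra.
    by rewrite mul1e -EFinB lte_fin; lra.
  apply: ge0_le_integral_sub => //.
  - by move=> th; exact: sqr_ge0.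
  - move=> th /=; rewrite !in_itv/= => /andP[h1 h2] _; split; first by apply/andP; split; lra.
    rewrite /w chi1 ?expr1n// normrM (gtr0_norm (divr_gt0 _ b0))//.
    have e1 : 1 = beta / 8 * (8 / beta) by field; rewrite gt_eqF.
    by rewrite [leRHS]e1 ler_pM2r ?divr_gt0// ler_norml; apply/andP; split; lra.
exists (fine W1 / fine W0) => c [c0 /(hardy_angular beta hbeta c c0) hc].
have fW0 : 0 < fine W0 by rewrite -lte_fin fineK.
rewrite ler_pdivlMr// -lee_fin EFinM !fineK//.
apply: le_trans (hc w w' _ sw dw b4 aw); apply: lee_wpmul2l; first by rewrite lee_fin.
apply: ge0_le_integral_sub => //.
- by apply: measurable_potential_sqr => //; exact: measurable_smooth1.
- by move=> th; exact: sqr_ge0.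
- by move=> th; rewrite mulr_ge0 ?potential_ge0 ?sqr_ge0.
- move=> th hth _; split => //; rewrite ler_peMl ?sqr_ge0//.
  by apply: (potential_ge1 beta hbeta); move: hth; rewrite /= in_itv.
Qed.

Lemma not_angular_hardy c : hardy_const (Lambda beta) < c -> 0 <= c /\ ~ angular_hardy beta c.
Proof.
move=> hc; have c0 : 0 <= c.
  by apply: le_trans (ltW hc); apply: (sup_upper_bound hardy_constants_has_sup); exact: hardy_constants0.
split=> // ac; suff : c <= hardy_const (Lambda beta) by rewrite leNgt hc.
apply: (sup_upper_bound hardy_constants_has_sup); split => //.
exact: angular_hardy_sector.
Qed.

(* Dilation invariance: [angular_hardy c] can be violated inside any disc about the vertex. *)
Lemma violating_function (c R0 : R) : 0 <= c -> ~ angular_hardy beta c -> 0 < R0 ->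
  exists u, [/\ Cc_infty (Lambda beta) u, forall q, Lambda beta q -> R0 <= nrm q -> u q = 0 &
    (\int[@leb2 R]_(q in Lambda beta) (grad_sq u q)%:E <
       c%:E * \int[@leb2 R]_(q in Lambda beta) (u q ^+ 2 / (dL q) ^+ 2)%:E)%E].
Proof.
move=> c0 nac R00.
have [w [w' [delta [sw dw d0 aw lt]]]] : exists w w' (delta : R), [/\ smooth1 w,
    forall t, is_derive t (1 : R) w (w' t), 0 < delta, angle_supported beta delta w &
    (\int[mu]_(th in `]0%R, beta[) (w' th ^+ 2)%:E <
     c%:E * \int[mu]_(th in `]0%R, beta[) (potential beta th * w th ^+ 2)%:E)%E].
  apply: contrapT => no; apply: nac => w w' delta sw dw d0 aw.
  by rewrite leNgt; apply/negP => lt; apply: no; exists w, w', delta.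
have sw' : smooth1 w'.
  have [w1 dw1 sw1] := smooth1_derive _ sw.
  by rewrite (is_derive_unique_fun _ _ _ dw dw1).
set W0 := (\int[mu]_(th in `]0%R, beta[) (w th ^+ 2)%:E)%E.
have f0 : (W0 \is a fin_num)%E by exact: smooth1_integral_fin.
have W00 : (0 <= W0)%E by apply: integral_ge0 => th _; rewrite lee_fin sqr_ge0.
set W1 := (\int[mu]_(th in _) (w' th ^+ 2)%:E)%E in lt *.
have [e e0 elt] : exists2 e : R, 0 < e & (e%:E + W1 < c%:E * \int[mu]_(th in `]0%R, beta[) (potential beta th * w th ^+ 2)%:E)%E.
  apply: contrapT => no; move: lt; rewrite ltNge => /negP; apply; apply/lee_addgt0Pr => e e0.
  by rewrite leNgt; apply/negP => h; apply: no; exists e => //; rewrite addeC.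
have k0 : 0 < fine W0 + 1 by rewrite ltr_wpDl// fine_ge0.
have [a [N [alpha [sa la hR0 al0 [h1 h2]]]]] :=
  test_function_profile beta hbeta w w' delta R0 _ sw dw sw' d0 aw R00 (divr_gt0 e0 k0).
exists (polar_prod beta a w); split.
- exact: (Cc_infty_separated beta N delta).
- move=> q Lq hq; move: (Lq); rewrite LambdaE// => -[sq aq].
  have q0 := slit_nrm_gt0 _ sq.
  by rewrite /polar_prod mem_set// hR0 ?mul0r// ler_ln ?posrE.
- apply: le_lt_trans h2 _; rewrite h1 muleCA lte_pmul2l//; apply: le_lt_trans elt.
  rewrite leeD2r// -/W0 -(fineK f0) -EFinM lee_fin mulrAC ler_pdivrMr// ler_pM2l//.
  by rewrite lerDl.
Qed.

End best_constant.

Theorem theorem3 (R : realType) (beta : R) (r : R -> R) :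
  pi < beta <= 2 * pi ->
  (forall th, 0 <= th <= beta -> 0 < r th) ->
  (exists L : R, forall x y, 0 <= x <= beta -> 0 <= y <= beta ->
       `|r x - r y| <= L * `|x - y|) ->
  {ae (@lebesgue_measure R), forall th, 0 < th < beta / 2 ->
       derivable r th 1 -> derive1 r th <= 0} ->
  {ae (@lebesgue_measure R), forall th, beta / 2 < th < beta ->
       derivable r th 1 -> 0 <= derive1 r th} ->
  let D := Dom beta r in
  let d := fun p => dist_set p (Gamma0 beta r) in
  let admissible := fun u : R * R -> R => smooth2 u /\
      exists eps : R, 0 < eps /\ forall p, d p < eps -> u p = 0 in
  (forall u, admissible u ->
     ((c_beta beta)%:E * \int[@leb2 R]_(p in D) ((u p) ^+ 2 / (d p) ^+ 2)%:E
       <= \int[@leb2 R]_(p in D) (grad_sq u p)%:E)%E) /\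
  (forall c : R, c_beta beta < c ->
     exists u, admissible u /\
     (\int[@leb2 R]_(p in D) (grad_sq u p)%:E
       < c%:E * \int[@leb2 R]_(p in D) ((u p) ^+ 2 / (d p) ^+ 2)%:E)%E).
Proof.
move=> hbeta r0 [L rL] ae1 ae2 D d admissible.
have b0 : 0 < beta by have /andP[h _] := hbeta; exact: lt_trans (pi_gt0 R) h.
have b2 : beta / 2 <= beta by lra.
have b20 : 0 <= beta / 2 by lra.
have r_dec x y : 0 <= x -> x <= y -> y <= beta / 2 -> r y <= r x.
  apply: (lipschitz_nonincreasing r L 0 (beta / 2)) => // s t /andP[s0 sb] /andP[t0 tb].
  by apply: rL; rewrite ?s0 ?t0; [exact: le_trans sb b2|exact: le_trans tb b2].
have r_inc x y : beta / 2 <= x -> x <= y -> y <= beta -> r x <= r y.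
  have rL' s t : beta / 2 <= s <= beta -> beta / 2 <= t <= beta ->
      `|- r s - - r t| <= L * `|s - t|.
    move=> /andP[s0 sb] /andP[t0 tb]; rewrite -opprD normrN.
    by apply: rL; rewrite ?sb ?tb andbT; [exact: le_trans b20 s0|exact: le_trans b20 t0].
  have ae' : {ae (@lebesgue_measure R), forall th, beta / 2 < th < beta ->
      derivable (fun t => - r t) th 1 -> derive1 (fun t => - r t) th <= 0}.
    apply: filterS ae2; first exact: (ae_filter_ringOfSetsType (@lebesgue_measure R)).
    move=> th hth hb dr; have dr' : derivable r th 1.
      have -> : r = (fun t => - - r t) by apply/funext => t; rewrite opprK.
      exact: derivableN.
    by rewrite derive1E deriveN// -derive1E oppr_le0; exact: hth.
  move=> hx xy hy.
  have := lipschitz_nonincreasing (fun t => - r t) L (beta / 2) beta b20 rL' ae' x y hx xy hy.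
  by rewrite /= lerN2.
have [r00 rb0] : 0 < r 0 /\ 0 < r beta by split; apply: r0; rewrite lexx ltW.
split=> [u [su [eps [e0 ue]]]|c hc].
  (* The supremum need not be known to be attained: each admissible constant of the sector is
     transferred to [D] separately. *)
  apply: sup_mule_le.
  - exact: hardy_constants_has_sup.
  - by move=> c [].
  - by apply: integral_ge0 => q _; rewrite lee_fin; exact: sqr_div_ge0.
  - by apply: integral_ge0 => q _; rewrite lee_fin; exact: grad_sq_ge0.
  - move=> c [c0 /(hardy_angular beta hbeta c c0) hc].
    exact: (Dom_hardy beta hbeta r L r0 rL r_dec r_inc c u eps).
have [c0 nac] := not_angular_hardy beta hbeta c hc.
(* [r (beta / 2)] is the minimum of [r]. Points of the sector closer than half of it to the vertex
   lie in [D] and satisfy the hypothesis of [dist_Gamma0_near0]. *)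
pose R0 := r (beta / 2) / 2.
have rm : 0 < r (beta / 2) by apply: r0; rewrite b20.
have R00 : 0 < R0 by rewrite divr_gt0.
have r_min th : 0 <= th <= beta -> r (beta / 2) <= r th.
  by move=> /andP[h1 h2]; have [h|/ltW h] := leP th (beta / 2); [exact: r_dec|exact: r_inc].
have [u [[su [K [cK [KL uK]]]] u0 lt]] := violating_function beta hbeta c R0 c0 nac R00.
have d_ge q := dist_Lambda_le_Gamma0 beta hbeta r r00 q.
have cL : continuous (fun q : R * R => dist_set q (bdry (Lambda beta))).
  by apply: continuous_dist_set; exact: bdry_Lambda_neq0.
have cG : continuous d by apply: continuous_dist_set; exact: Gamma0_neq0.
have mD := measurable_Dom beta hbeta r L rL.
exists u; split.
  split=> //; have [K0|/set0P K0] := eqVneq K set0.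
    by exists 1; split => // q _; apply: uK; rewrite K0.
  (* The distance to the boundary has a positive minimum on the compact support; since [d] is at
     least this distance, [u] vanishes wherever [d] is below that minimum. *)
  have [m Km hm] := compact_EVT_min K0 cK (continuous_subspaceT cL).
  exists (dist_set m (bdry (Lambda beta))); split.
    by apply: dist_Lambda_gt0 => //; apply: KL; rewrite inE in Km.
  move=> q hq; apply: uK => Kq; move: hq; rewrite ltNge => /negP; apply.
  by apply: le_trans (d_ge q); apply: hm; rewrite inE.
apply: (@le_lt_trans _ _ (\int[@leb2 R]_(q in Lambda beta) (grad_sq u q)%:E)%E).
  apply: ge0_le_integral_sub => //.
  - exact: measurable_Lambda.
  - exact: measurable_grad_sq.
  - exact: measurable_grad_sq.
  - by move=> q; exact: grad_sq_ge0.
  - by move=> q; exact: grad_sq_ge0.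
  - by move=> q Dq _; split=> //; exact: (Dom_sub_Lambda _ _ _ Dq).
(* The Hardy term loses nothing on passing to [D]: where [u] is not zero, the point is in [D] and
   both distances agree. *)
apply: lt_le_trans lt _; apply: lee_wpmul2l; first by rewrite lee_fin.
apply: ge0_le_integral_sub => //.
- exact: measurable_Lambda.
- by apply: measurable_hardy_density => //; exact: smooth2_continuous.
- apply: measurable_funM.
    apply: measurable_funX; apply: continuous_measurable_prod; exact: smooth2_continuous.
  apply: (measurableT_comp measurable_invr); apply: measurable_funX.
  exact: continuous_measurable_prod.
- by move=> q; exact: sqr_div_ge0.
- by move=> q; exact: sqr_div_ge0.
- move=> q Lq; have [hq|hq] := leP R0 (nrm q); first by rewrite u0// expr0n/= mul0r ltxx.
  move=> _; have q2 : 2 * nrm q < r (beta / 2) by move: hq; rewrite /R0; lra.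
  split; last first.
    rewrite /d dist_Gamma0_near0// lt_min; apply/andP; split.
      by apply: lt_le_trans q2 _; apply: r_min; rewrite lexx ltW.
    by apply: lt_le_trans q2 _; apply: r_min; rewrite lexx ltW.
  have [rho [th [rho0 [hth e]]]] := Lq; exists rho, th; split => //; split => //.
  rewrite rho0/=; apply: lt_le_trans (r_min th _).
    by move: hq; rewrite e nrm_polar gtr0_norm// /R0; lra.
  by have /andP[h1 h2] := hth; rewrite !ltW.
Qed.
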